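(* Let $\mathbb{E}\subseteq\otimes^p\mathbb{R}^3$ be a tensor space of order $p\geq 3$ defined solely by index symmetries, and let $\mathbb{T}^{2p}=\mathbb{E}\otimes^S\mathbb{E}$ be the space of tensors of the associated proper physics (self-adjoint linear maps on $\mathbb{E}$). Then $\mathfrak{I}(\mathbb{T}^{2p})=\mathfrak{I}(\mathbb{G}^{2p})$.
   Context: $\mathrm{SO}(3)$ acts on $\otimes^{m}\mathbb{R}^3$ by $(g\cdot T)_{i_1\dots i_m}=g_{i_1j_1}\cdots g_{i_mj_m}T_{j_1\dots j_m}$. $\mathbb{G}^{m}=\otimes^m\mathbb{R}^3$. A tensor space defined solely by index symmetries is a subspace of $\otimes^p\mathbb{R}^3$ consisting of the tensors invariant under a prescribed set of permutations of their indices (it contains the completely symmetric tensors). $\otimes^S$ denotes the symmetric tensor product, so $\mathbb{E}\otimes^S\mathbb{E}$ is identified with the space of self-adjoint linear maps $\mathbb{E}\to\mathbb{E}$. For an $\mathrm{SO}(3)$-representation $V$, $\mathfrak{I}(V)=\{[\Sigma_x]:x\in V\}$ where $\Sigma_x=\{g\in\mathrm{SO}(3):g\cdot x=x\}$ and $[K]$ is the conjugacy class of $K$ in $\mathrm{SO}(3)$. *)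

(* Defs.v *)
From HB Require Import structures.
From mathcomp Require Import all_boot all_order all_algebra perm.
From mathcomp Require Import boolp classical_sets reals.
Set Implicit Arguments. Unset Strict Implicit. Unset Printing Implicit Defensive.
Import GRing.Theory Num.Theory.
Local Open Scope ring_scope.
Local Open Scope classical_set_scope.

Definition tensor (R : realType) (m : nat) := {ffun 'I_m -> 'I_3} -> R.

Definition SO3 (R : realType) (g : 'M[R]_3) : Prop :=
  g *m g^T = 1%:M /\ \det g = 1.

Definition tact (R : realType) (m : nat) (g : 'M[R]_3) (T : tensor R m)
  : tensor R m :=
  fun i => \sum_(j : {ffun 'I_m -> 'I_3}) (\prod_(k < m) g (i k) (j k)) * T j.

Definition stab (R : realType) (m : nat) (x : tensor R m) : set 'M[R]_3 :=
  [set g | SO3 g /\ tact g x = x].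

Definition conj_class (R : realType) (H : set 'M[R]_3) : set (set 'M[R]_3) :=
  [set K | exists h : 'M[R]_3, SO3 h /\ K = [set g | H (h^T *m g *m h)]].

Definition isoclasses (R : realType) (m : nat) (V : set (tensor R m))
  : set (set (set 'M[R]_3)) :=
  [set conj_class (stab x) | x in V].

Definition idx_sym_space (R : realType) (p : nat) (S : {set {perm 'I_p}})
  : set (tensor R p) :=
  [set T : tensor R p | forall s, s \in S -> forall i : {ffun 'I_p -> 'I_3}, T [ffun k => i (s k)] = T i].

Definition join_idx (p : nat) (a b : {ffun 'I_p -> 'I_3}) : {ffun 'I_(p + p) -> 'I_3} :=
  [ffun k => match split k with inl k' => a k' | inr k' => b k' end].

(* E (x)^S E, as a subspace of order-2p tensors: tensors T_{a b} lying in E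
   in each multi-index and symmetric under exchange of the two. *)
Definition symtensor_sq (R : realType) (p : nat) (E : set (tensor R p))
  : set (tensor R (p + p)) :=
  [set T | (forall b, E (fun a => T (join_idx a b))) /\
           (forall a, E (fun b => T (join_idx a b))) /\
           (forall a b, T (join_idx a b) = T (join_idx b a))].

(* Main.v *)
(* Evaluating a tensor on (x, .., x, y, .., y) turns the tensors of the symmetric
   square that are also symmetric in each group of [p] indices (these belong to
   every [idx_sym_space]) into the symmetric forms P(x, y) of bidegree (p, p), and
   polarization makes this faithful.  It therefore suffices to realize every
   stabilizer G of a tensor of order 2p as the rotation group of such a form.

   Diagonalizing the rotations about an axis u over the complex numbers shows that
   those contained in G form either the full circle or the d-th roots of unity for
   some 0 < d <= 2p: d is the gcd of the weights of the nonzero components.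

   If G preserves a line, say that of e3, it is the rotation group of
     6 x3^p y3^p + al (A_k + A_l) + be B,
   where A_k is a wave of weight k and B a rotation-invariant form that changes sign
   under the half-turns reversing e3; the first term dominates on the unit sphere,
   so every rotation preserving the form preserves the line.
   If G preserves no line but contains a full circle of rotations, it is SO(3).
   Otherwise let c be the largest cosine of an angle of a nontrivial rotation in G.
   Two closest axes with this angle show c < 1/2, so the angle has order 3, 4 or 5,
   and the spherical law of cosines leaves a single possible angle between distinct
   axes.  This pins down the axes, and G is the rotation group of
     sum m_i^p + (m1-m2)(m2-m3)(m3-m1)(m1+m2+m3)^(p-3)   (tetrahedron),
     sum m_i^p                                           (octahedron),
     (x.y)^(p-3) sum_q (q.x)^3 (q.y)^3                   (icosahedron),
   with m_i = x_i y_i and q ranging over the six diagonals: the maxima of P(x, x) on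
   the sphere are the coordinate axes, resp. the diagonals. *)
Require Import Defs.
From HB Require Import structures.
From mathcomp Require Import all_boot all_order all_algebra perm.
From mathcomp Require Import boolp classical_sets reals.
From mathcomp Require Import complex ring lra zify.
From mathcomp Require Import trigo.
Set Implicit Arguments. Unset Strict Implicit. Unset Printing Implicit Defensive.
Import Order.TTheory GRing.Theory Num.Theory.
Local Open Scope ring_scope.
Local Open Scope classical_set_scope.

(** * Symmetric tensors and bihomogeneous forms *)

(** The hypothesis [3 <= p] enters through the forms. To exclude unwanted rotations a form needs a
    factor that is odd under them and yet symmetric in x and y. The twist B and the product of
    differences of the m_i are such factors, of bidegree (3, 3). For the icosahedron cubes are
    needed as well, since the second and fourth moments of the diagonals are constant on the sphere.
    The missing p - 3 degrees are supplied by powers of x.y, which every rotation preserves. It is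
    replaced by the uniform bound on the orders: the rotations of G have finitely many angles,
    hence, by the law of cosines, there are finitely many angles between the axes of largest cosine.
    Extremal angles and closest pairs therefore exist. The same bound d <= 2p is what lets a wave of
    weight d fit into bidegree (p, p). A wave of weight 1 would not be dominated by the leading
    term, which is why two waves are needed: the weights 2 and 3 together stand in for weight 1. *)

Lemma ryser_permanent (F : comPzRingType) (n : nat) (z : 'I_n -> 'I_n -> F) :
  \sum_(U : {ffun 'I_n -> bool})
     (\prod_j (-1) ^+ (~~ U j)) * \prod_k \sum_j ((U j)%:R * z k j)
  = \sum_(s : {perm 'I_n}) \prod_k z k (s k).
Proof.
have E (U : {ffun 'I_n -> bool}) : \prod_k \sum_j ((U j)%:R * z k j) =
    \sum_(f : {ffun 'I_n -> 'I_n}) (\prod_k (U (f k))%:R) * \prod_k z k (f k).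
  by rewrite bigA_distr_bigA; apply: eq_bigr => f _; rewrite big_split.
under eq_bigr => U _ do rewrite E big_distrr /=.
rewrite exchange_big /=.
(* The factors keep only the sets [U] containing the image of [f]. An index outside the image may be
   put into [U] or left out with opposite signs, so only onto functions, the permutations,
   survive. *)
have H (f : {ffun 'I_n -> 'I_n}) :
  \sum_(U : {ffun 'I_n -> bool}) (\prod_j (-1) ^+ (~~ U j)) *
     ((\prod_k (U (f k))%:R) * \prod_k z k (f k))
  = (injectiveb f)%:R * \prod_k z k (f k).
  rewrite (eq_bigr (fun U : {ffun 'I_n -> bool} => (\prod_j (-1) ^+ (~~ U j)) *
      (\prod_k (U (f k))%:R) * \prod_k z k (f k))); last by move=> U _; rewrite mulrA.
  rewrite -big_distrl /=; congr (_ * _).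
  pose h (j : 'I_n) (b : bool) : F :=
    (-1) ^+ (~~ b) * (if j \in codom f then b%:R else 1).
  transitivity (\sum_(U : {ffun 'I_n -> bool}) \prod_j h j (U j)).
    apply: eq_bigr => U _; rewrite /h big_split /=; congr (_ * _).
    case: (boolP [forall k, U (f k)]) => [/forallP Uf|].
      rewrite !big1 // => [j _|k _]; last by rewrite Uf.
      by case: ifP => // /codomP [k ->]; rewrite Uf.
    rewrite negb_forall => /existsP [k Uk].
    rewrite [LHS](bigD1 k) //= [RHS](bigD1 (f k)) //= (codom_f f k) (negbTE Uk).
    by rewrite !mul0r.
  rewrite -(bigA_distr_bigA h).
  case: (boolP (injectiveb f)) => [/injectiveP fI|fN].
    rewrite big1 // => j _; rewrite big_bool /h /=.
    have -> : j \in codom f by rewrite -[j](f_invF fI); exact: (codom_f f).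
    by rewrite expr0 mulr1 mulr0 addr0.
  have [j jN] : exists j, j \notin codom f.
    apply/existsP; rewrite -negb_forall; apply: contra fN => /forallP fS.
    have /image_injP fI : #|image_mem f (mem 'I_n)| == #|'I_n|.
      by apply/eqP/eq_card => j; rewrite !inE; exact: fS.
    by apply/injectiveP => i j; apply: fI.
  rewrite (bigD1 j) //= big_bool /h (negbTE jN) /= expr0 expr1 !mulr1 subrr.
  by rewrite mul0r.
rewrite (eq_bigr _ (fun f _ => H f)).
rewrite (bigID (fun f : {ffun 'I_n -> 'I_n} => injectiveb f)) /= addrC big1 ?add0r;
  last by move=> f /negbTE ->; rewrite mul0r.
rewrite (reindex (fun s : {perm 'I_n} => pval s)) /=.
  apply: eq_big => [s|s _]; first by rewrite (valP s).
  rewrite (valP s : injectiveb (pval s)) mul1r.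
  by apply: eq_bigr => k _; rewrite -pvalE.
by exists (insubd (1 : {perm 'I_n})%g) => f; rewrite ?inE => fI;
  [apply: valKd | rewrite insubdK].
Qed.

Section Arrays.
Context (R : realType).
Implicit Types (x y : 'rV[R]_3) (g : 'M[R]_3).

Definition monom (m : nat) (x : 'rV[R]_3) (a : {ffun 'I_m -> 'I_3}) : R :=
  \prod_k x 0 (a k).

Definition biarray (p : nat) := {ffun 'I_p -> 'I_3} -> {ffun 'I_p -> 'I_3} -> R.

Definition bieval (p : nat) (c : biarray p) x y : R :=
  \sum_a \sum_b c a b * (monom x a * monom y b).

Definition reidx (p : nat) (a : {ffun 'I_p -> 'I_3}) (s : {perm 'I_p}) :
  {ffun 'I_p -> 'I_3} := [ffun k => a (s k)].

(** Not normalized: the factor computed in [bieval_bisym] is nonzero and can be cancelled. *)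
Definition bisym (p : nat) (c : biarray p) : biarray p := fun a b =>
  \sum_(s : {perm 'I_p}) \sum_(t : {perm 'I_p}) c (reidx a s) (reidx b t).

Definition biact (p : nat) g (c : biarray p) : biarray p := fun a b =>
  \sum_(a' : {ffun 'I_p -> 'I_3}) \sum_(b' : {ffun 'I_p -> 'I_3})
    (\prod_k g (a k) (a' k)) * (\prod_k g (b k) (b' k)) * c a' b'.

Lemma reidxM (p : nat) (a : {ffun 'I_p -> 'I_3}) (s t : {perm 'I_p}) :
  reidx (reidx a s) t = reidx a (t * s)%g.
Proof. by apply/ffunP => k; rewrite !ffunE permM. Qed.

Lemma reidx_bij (p : nat) (s : {perm 'I_p}) : bijective (fun a => reidx a s).
Proof.
exists (fun a => reidx a (s^-1)%g) => a; rewrite reidxM ?mulgV ?mulVg;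
  by apply/ffunP => k; rewrite ffunE perm1.
Qed.

Lemma monom_reidx (p : nat) x (a : {ffun 'I_p -> 'I_3}) (s : {perm 'I_p}) :
  monom x (reidx a s) = monom x a.
Proof.
by rewrite /monom [RHS](reindex_perm s); apply: eq_bigr => k _; rewrite ffunE.
Qed.

Definition polar_pt (p : nat) (a : {ffun 'I_p -> 'I_3}) (U : {ffun 'I_p -> bool}) :
  'rV[R]_3 := \row_i \sum_j ((U j)%:R * (i == a j)%:R).

Lemma monom_polar (p : nat) (a a' : {ffun 'I_p -> 'I_3}) :
  \sum_(U : {ffun 'I_p -> bool}) (\prod_j (-1) ^+ (~~ U j)) * monom (polar_pt a U) a'
  = \sum_(s : {perm 'I_p}) (a' == reidx a s)%:R.
Proof.
rewrite -[LHS]/(\sum_(U : {ffun 'I_p -> bool}) (\prod_j (-1) ^+ (~~ U j)) *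
   \prod_k polar_pt a U 0 (a' k)).
under eq_bigr => U _ do under [X in _ * X]eq_bigr => k _ do rewrite mxE.
rewrite (ryser_permanent (fun k j => (a' k == a j)%:R)); apply: eq_bigr => s _.
case: eqP => [->|ne].
  by rewrite big1 // => k _; rewrite ffunE eqxx.
have [k kP] : exists k, a' k != a (s k).
  apply/existsP; rewrite -negb_forall; apply/forallP => H; apply: ne.
  by apply/ffunP => k; rewrite ffunE; apply/eqP.
by rewrite (bigD1 k) //= (negbTE kP) mul0r.
Qed.

(** Polarization in both variables. The right-hand side sees [c] only through the values of its
    form, so invariance of the form passes to the symmetrized array. *)
Lemma bisym_polar (p : nat) (c : biarray p) a b :
  bisym c a b = \sum_(U : {ffun 'I_p -> bool}) \sum_(V : {ffun 'I_p -> bool})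
    (\prod_j (-1) ^+ (~~ U j)) * (\prod_j (-1) ^+ (~~ V j)) *
      bieval c (polar_pt a U) (polar_pt b V).
Proof.
pose w (U : {ffun 'I_p -> bool}) : R := \prod_j (-1) ^+ (~~ U j).
transitivity (\sum_a' \sum_b' c a' b' *
   ((\sum_U w U * monom (polar_pt a U) a') * (\sum_V w V * monom (polar_pt b V) b'))).
  under [RHS]eq_bigr => a' _ do under eq_bigr => b' _ do rewrite !monom_polar.
  have E a' b' : c a' b' * ((\sum_(s : {perm 'I_p}) (a' == reidx a s)%:R) *
      (\sum_(t : {perm 'I_p}) (b' == reidx b t)%:R)) =
      \sum_(s : {perm 'I_p}) \sum_(t : {perm 'I_p})
        c a' b' * ((a' == reidx a s)%:R * (b' == reidx b t)%:R).
    rewrite big_distrl big_distrr /=; apply: eq_bigr => s _.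
    by rewrite !big_distrr.
  under [RHS]eq_bigr => a' _ do (under eq_bigr => b' _ do rewrite E);
  under [RHS]eq_bigr => a' _ do rewrite exchange_big /=.
  rewrite exchange_big /=; apply: eq_bigr => s _.
  under [RHS]eq_bigr => a' _ do rewrite exchange_big /=.
  rewrite exchange_big /=; apply: eq_bigr => t _.
  rewrite (bigD1 (reidx a s)) //= (bigD1 (reidx b t)) //= !eqxx !mulr1.
  rewrite !big1 ?addr0 // => [a' /negbTE ne|b' /negbTE ->]; last by rewrite !mulr0.
  by rewrite big1 // => b' _; rewrite ne mul0r mulr0.
have E U V : w U * w V * bieval c (polar_pt a U) (polar_pt b V) =
   \sum_a' \sum_b' c a' b' * (w U * monom (polar_pt a U) a' * (w V * monom (polar_pt b V) b')).
  rewrite big_distrr /=; apply: eq_bigr => a' _; rewrite big_distrr /=.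
  by apply: eq_bigr => b' _; ring.
rewrite [RHS](eq_bigr _ (fun U _ => eq_bigr _ (fun V _ => E U V))).
under [RHS]eq_bigr => U _ do rewrite exchange_big /=.
rewrite [RHS]exchange_big /=; apply: eq_bigr => a' _.
under [RHS]eq_bigr => U _ do rewrite exchange_big /=.
rewrite [RHS]exchange_big /=; apply: eq_bigr => b' _.
rewrite big_distrl big_distrr /=; apply: eq_bigr => U _.
by rewrite !big_distrr.
Qed.

Lemma bieval_biact (p : nat) g (c : biarray p) x y :
  bieval (biact g c) x y = bieval c (x *m g) (y *m g).
Proof.
have M m (z : 'rV[R]_3) (a' : {ffun 'I_m -> 'I_3}) :
    monom (z *m g) a' = \sum_a monom z a * \prod_k g (a k) (a' k).
  rewrite /monom; under eq_bigr => k _ do rewrite mxE.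
  rewrite bigA_distr_bigA; apply: eq_bigr => a _; exact: big_split.
have E a b : biact g c a b * (monom x a * monom y b) = \sum_a' \sum_b'
   c a' b' * ((monom x a * \prod_k g (a k) (a' k)) * (monom y b * \prod_k g (b k) (b' k))).
  rewrite big_distrl /=; apply: eq_bigr => a' _; rewrite big_distrl /=.
  by apply: eq_bigr => b' _; ring.
rewrite /bieval; under eq_bigr => a _ do under eq_bigr => b _ do rewrite E.
under eq_bigr => a _ do rewrite exchange_big /=.
rewrite exchange_big /=; apply: eq_bigr => a' _.
under eq_bigr => a _ do rewrite exchange_big /=.
rewrite exchange_big /=; apply: eq_bigr => b' _.
rewrite !M big_distrl big_distrr /=; apply: eq_bigr => a _.
by rewrite !big_distrr.
Qed.

Lemma bisym_biact (p : nat) g (c : biarray p) :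
  bisym (biact g c) = biact g (bisym c).
Proof.
apply/funext => a; apply/funext => b; rewrite /bisym /biact.
have M (s : {perm 'I_p}) (d d' : {ffun 'I_p -> 'I_3}) :
    \prod_k g (reidx d s k) (reidx d' s k) = \prod_k g (d k) (d' k).
  by rewrite [RHS](reindex_perm s); apply: eq_bigr => k _; rewrite !ffunE.
transitivity (\sum_(s : {perm 'I_p}) \sum_(t : {perm 'I_p}) 
   \sum_(a' : {ffun 'I_p -> 'I_3}) \sum_(b' : {ffun 'I_p -> 'I_3})
   (\prod_k g (a k) (a' k)) * (\prod_k g (b k) (b' k)) * c (reidx a' s) (reidx b' t)).
  apply: eq_bigr => s _; apply: eq_bigr => t _.
  rewrite (reindex _ (onW_bij _ (reidx_bij s))) /=; apply: eq_bigr => a' _.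
  rewrite (reindex _ (onW_bij _ (reidx_bij t))) /=; apply: eq_bigr => b' _.
  by rewrite !M.
under eq_bigr => s _ do rewrite exchange_big /=.
rewrite exchange_big /=; apply: eq_bigr => a' _.
under eq_bigr => s _ do rewrite exchange_big /=.
rewrite exchange_big /=; apply: eq_bigr => b' _.
by rewrite big_distrr /=; apply: eq_bigr => s _; rewrite big_distrr.
Qed.

Lemma bieval_bisym (p : nat) (c : biarray p) x y :
  bieval (bisym c) x y = (p`!%:R) ^+ 2 * bieval c x y.
Proof.
have E a b : bisym c a b * (monom x a * monom y b) =
    \sum_(s : {perm 'I_p}) \sum_(t : {perm 'I_p})
      c (reidx a s) (reidx b t) * (monom x (reidx a s) * monom y (reidx b t)).
  rewrite big_distrl /=; apply: eq_bigr => s _; rewrite big_distrl /=.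
  by apply: eq_bigr => t _; rewrite !monom_reidx.
rewrite /bieval; under eq_bigr => a _ do under eq_bigr => b _ do rewrite E.
under eq_bigr => a _ do rewrite exchange_big /=.
rewrite exchange_big /=.
under eq_bigr => s _ do under eq_bigr => a _ do rewrite exchange_big /=.
under eq_bigr => s _ do rewrite exchange_big /=.
transitivity (\sum_(s : {perm 'I_p}) \sum_(t : {perm 'I_p}) bieval c x y).
  apply: eq_bigr => s _; apply: eq_bigr => t _; rewrite /bieval.
  rewrite [RHS](reindex _ (onW_bij _ (reidx_bij s))) /=; apply: eq_bigr => a _.
  by rewrite [RHS](reindex _ (onW_bij _ (reidx_bij t))).
rewrite !sumr_const (_ : #|_| = p`!); first by rewrite -[LHS]mulr_natl -[X in _ * X]mulr_natl mulrA expr2.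
by rewrite -[RHS]card_Sn; apply: eq_card.
Qed.

Lemma join_idx_bij (p : nat) :
  bijective (fun ab : {ffun 'I_p -> 'I_3} * {ffun 'I_p -> 'I_3} => join_idx ab.1 ab.2).
Proof.
exists (fun i : {ffun 'I_(p + p) -> 'I_3} =>
  ([ffun k => i (lshift p k)], [ffun k => i (rshift p k)])) => [[a b]|i] /=.
  congr (_, _); apply/ffunP => k; rewrite !ffunE.
    by rewrite -[lshift p k]/(unsplit (inl k)) unsplitK.
  by rewrite -[rshift p k]/(unsplit (inr k)) unsplitK.
apply/ffunP => k; rewrite !ffunE.
by case: (split k) (splitK k) => j /= <-; rewrite ffunE.
Qed.

Lemma tact_join (p : nat) g (T : tensor R (p + p)) a b :
  tact g T (join_idx a b) = biact g (fun a b => T (join_idx a b)) a b.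
Proof.
rewrite /tact (reindex _ (onW_bij _ (join_idx_bij p))) /= /biact pair_big /=.
apply: eq_bigr => -[a' b'] _ /=; congr (_ * _); rewrite big_split_ord /=.
congr (_ * _); apply: eq_bigr => k _; rewrite !ffunE.
  by rewrite -[lshift p k]/(unsplit (inl k)) unsplitK.
by rewrite -[rshift p k]/(unsplit (inr k)) unsplitK.
Qed.

Lemma tact_eq_join (p : nat) g (T : tensor R (p + p)) :
  tact g T = T <->
  biact g (fun a b => T (join_idx a b)) = (fun a b => T (join_idx a b)).
Proof.
split => H.
  by apply/funext => a; apply/funext => b; rewrite -tact_join H.
apply/funext => i; have [f _ fK] := join_idx_bij p.
by rewrite -(fK i) tact_join H.
Qed.

Definition dot (x y : 'rV[R]_3) : R := \sum_i x 0 i * y 0 i.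

(* A term [(c, us, vs)] stands for the product of [c], the linear forms [us] in
   the first variable and the linear forms [vs] in the second. *)
Definition term_eval (t : R * seq 'rV[R]_3 * seq 'rV[R]_3) x y : R :=
  t.1.1 * (\prod_(u <- t.1.2) dot u x) * (\prod_(v <- t.2) dot v y).

Definition bihom (m n : nat) (P : 'rV[R]_3 -> 'rV[R]_3 -> R) : Prop :=
  exists2 L : seq (R * seq 'rV[R]_3 * seq 'rV[R]_3),
    all (fun t => (size t.1.2 == m) && (size t.2 == n)) L &
    forall x y, P x y = \sum_(t <- L) term_eval t x y.

Lemma bihom_bieval (p : nat) P : bihom p p P -> exists c : biarray p, P = bieval c.
Proof.
case=> L; elim: L P => [|[[c us] vs] L IH] P /=.
  move=> _ H; exists (fun _ _ => 0); apply/funext => x; apply/funext => y.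
  by rewrite H big_nil /bieval big1 // => a _; rewrite big1 // => b _; rewrite mul0r.
move=> /andP [/andP [/eqP su /eqP sv] sL] H.
have [d Hd] := IH (fun x y => \sum_(t <- L) term_eval t x y) sL (fun x y => erefl).
exists (fun a b : {ffun 'I_p -> 'I_3} => c * (\prod_(k < p) (nth 0 us k) 0 (a k)) * (\prod_(k < p) (nth 0 vs k) 0 (b k)) + d a b).
apply/funext => x; apply/funext => y; rewrite H big_cons.
have -> : \sum_(j <- L) term_eval j x y = bieval d x y.
  exact: (congr1 (fun f => f x y) Hd).
have M (w : seq 'rV[R]_3) z : size w = p ->
    \prod_(u <- w) dot u z = \sum_(a : {ffun 'I_p -> 'I_3}) (\prod_(k < p) (nth 0 w k) 0 (a k)) * monom z a.
  move=> sw; rewrite (big_nth 0) big_mkord sw bigA_distr_bigA.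
  by apply: eq_bigr => a _; rewrite big_split.
rewrite /term_eval /= (M _ _ su) (M _ _ sv) /bieval.
rewrite [c * _]big_distrr /= big_distrl /= -big_split /=; apply: eq_bigr => a _.
rewrite big_distrr -big_split /=; apply: eq_bigr => b _; ring.
Qed.

(** The symmetrized coefficients are invariant under all permutations of either group of indices,
    hence under those in [S]. A fixed tensor gives an invariant form by evaluation, and the converse
    is polarization. *)
Lemma symtensor_of_bihom (p : nat) (S : {set {perm 'I_p}}) P :
  bihom p p P -> (forall x y, P x y = P y x) ->
  exists2 T : tensor R (p + p), symtensor_sq (@idx_sym_space R p S) T &
    forall g, tact g T = T <-> forall x y, P (x *m g) (y *m g) = P x y.
Proof.
move=> /bihom_bieval [c ->] Psym.
pose d := bisym c.
have pe a b : d a b = d b a.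
  rewrite /d !bisym_polar exchange_big /=; apply: eq_bigr => U _.
  by apply: eq_bigr => V _; rewrite Psym; congr (_ * _); rewrite mulrC.
have dl a b (s : {perm 'I_p}) : d (reidx a s) b = d a b.
  rewrite /d /bisym [RHS](reindex_inj (mulIg s)) /=; apply: eq_bigr => t _.
  by apply: eq_bigr => u _; rewrite reidxM.
have [f fK fK'] := join_idx_bij p.
pose T : tensor R (p + p) := fun i => d (f i).1 (f i).2.
have TE a b : T (join_idx a b) = d a b.
  by rewrite /T -[join_idx a b]/(join_idx (a, b).1 (a, b).2) fK.
exists T.
  split; [|split] => [b s _ i|a s _ i|a b]; rewrite !TE; [exact: dl| |exact: pe].
  by rewrite pe (pe _ i); exact: dl.
move=> g; rewrite tact_eq_join.
have -> : (fun a b => T (join_idx a b)) = d.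
  by apply/funext => a; apply/funext => b; rewrite TE.
split => [H x y|H].
  have : bieval d (x *m g) (y *m g) = bieval d x y by rewrite -bieval_biact H.
  rewrite !bieval_bisym; apply: mulfI.
  by rewrite expf_eq0 /= pnatr_eq0 -lt0n fact_gt0.
rewrite /d -bisym_biact; apply/funext => a; apply/funext => b; rewrite !bisym_polar.
by apply: eq_bigr => U _; apply: eq_bigr => V _; rewrite bieval_biact H.
Qed.

Lemma bihom_ext m n P Q : P =2 Q -> bihom m n P -> bihom m n Q.
Proof. by move=> PQ [L sL HL]; exists L => // x y; rewrite -PQ. Qed.

Lemma bihom0 m n : bihom m n (fun _ _ => 0).
Proof. by exists [::] => // x y; rewrite big_nil. Qed.

Lemma bihom1 c : bihom 0 0 (fun _ _ => c).
Proof.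
exists [:: (c, [::], [::])] => // x y.
by rewrite big_seq1 /term_eval /= !big_nil !mulr1.
Qed.

Lemma bihom_left u : bihom 1 0 (fun x _ => dot u x).
Proof.
exists [:: (1, [:: u], [::])] => // x y.
by rewrite big_seq1 /term_eval /= big_nil big_seq1 mulr1 mul1r.
Qed.

Lemma bihom_right u : bihom 0 1 (fun _ y => dot u y).
Proof.
exists [:: (1, [::], [:: u])] => // x y.
by rewrite big_seq1 /term_eval /= big_nil big_seq1 mulr1 mul1r.
Qed.

Lemma bihomD m n P Q :
  bihom m n P -> bihom m n Q -> bihom m n (fun x y => P x y + Q x y).
Proof.
move=> [L sL HL] [M sM HM]; exists (L ++ M); first by rewrite all_cat sL.
by move=> x y; rewrite HL HM big_cat.
Qed.

Lemma bihomM m n m' n' P Q : bihom m n P -> bihom m' n' Q ->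
  bihom (m + m') (n + n') (fun x y => P x y * Q x y).
Proof.
move=> [L sL HL] [M sM HM].
exists [seq (t.1.1 * t'.1.1, t.1.2 ++ t'.1.2, t.2 ++ t'.2) | t <- L, t' <- M].
  apply/allP => _ /allpairsP [[t t'] /= [tL tM ->]] /=.
  have /andP [/eqP s1 /eqP s2] := allP sL _ tL.
  have /andP [/eqP s3 /eqP s4] := allP sM _ tM.
  by rewrite !size_cat s1 s2 s3 s4 !eqxx.
move=> x y; rewrite HL HM big_distrl /= big_allpairs_dep /=; apply: eq_bigr => t _.
rewrite big_distrr /=; apply: eq_bigr => t' _.
by rewrite /term_eval /= !big_cat /=; ring.
Qed.

Lemma bihomZ m n c P : bihom m n P -> bihom m n (fun x y => c * P x y).
Proof. by move=> bP; rewrite -[m]add0n -[n]add0n; apply: bihomM => //; apply: bihom1. Qed.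

Lemma bihomN m n P : bihom m n P -> bihom m n (fun x y => - P x y).
Proof.
by move=> /(bihomZ (-1)); apply: bihom_ext => x y; rewrite mulN1r.
Qed.

Lemma bihomB m n P Q :
  bihom m n P -> bihom m n Q -> bihom m n (fun x y => P x y - Q x y).
Proof. by move=> bP bQ; apply: bihomD => //; apply: bihomN. Qed.

Lemma bihomX m n k P : bihom m n P -> bihom (k * m) (k * n) (fun x y => P x y ^+ k).
Proof.
move=> bP; elim: k => [|k IH].
  by rewrite !mul0n; apply: bihom_ext (bihom1 1) => x y; rewrite expr0.
by rewrite !mulSn; apply: bihom_ext (bihomM bP IH) => x y; rewrite exprS.
Qed.

Lemma bihom_sum m n (I : finType) (P : I -> _ -> _ -> R) :
  (forall i, bihom m n (P i)) -> bihom m n (fun x y => \sum_i P i x y).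
Proof.
move=> bP; elim: (index_enum I) => [|i r IH].
  by apply: bihom_ext (@bihom0 m n) => x y; rewrite big_nil.
by apply: bihom_ext (bihomD (bP i) IH) => x y; rewrite big_cons.
Qed.

End Arrays.

(** * Rotations of three-space *)

Section Geometry.
Context (R : realType).
Implicit Types (x y z u v w : 'rV[R]_3) (g h : 'M[R]_3) (c s : R).

Definition i0 : 'I_3 := @Ordinal 3 0 isT.
Definition i1 : 'I_3 := @Ordinal 3 1 isT.
Definition i2 : 'I_3 := @Ordinal 3 2 isT.

Lemma forall_ord3 (Q : 'I_3 -> Prop) : Q i0 -> Q i1 -> Q i2 -> forall i, Q i.
Proof.
move=> H0 H1 H2 [[|[|[|//]]] Hi].
- by have -> : Ordinal Hi = i0 by exact: val_inj.
- by have -> : Ordinal Hi = i1 by exact: val_inj.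
- by have -> : Ordinal Hi = i2 by exact: val_inj.
Qed.

Lemma sum_ord3 (V : nmodType) (F : 'I_3 -> V) : \sum_i F i = F i0 + F i1 + F i2.
Proof.
rewrite !big_ord_recr big_ord0 /= add0r.
by congr (F _ + F _ + F _); apply: val_inj.
Qed.

Definition vec a b d : 'rV[R]_3 := \row_i nth 0 [:: a; b; d] i.

Lemma vec0 a b d : vec a b d 0 i0 = a. Proof. by rewrite mxE. Qed.
Lemma vec1 a b d : vec a b d 0 i1 = b. Proof. by rewrite mxE. Qed.
Lemma vec2 a b d : vec a b d 0 i2 = d. Proof. by rewrite mxE. Qed.
Definition vecE := (vec0, vec1, vec2).

Lemma vec_eta x : x = vec (x 0 i0) (x 0 i1) (x 0 i2).
Proof. by apply/rowP; apply: forall_ord3; rewrite mxE. Qed.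

Lemma vec_ext x y : x 0 i0 = y 0 i0 -> x 0 i1 = y 0 i1 -> x 0 i2 = y 0 i2 -> x = y.
Proof. by move=> H0 H1 H2; rewrite (vec_eta x) (vec_eta y) H0 H1 H2. Qed.

Definition rows3 x y z : 'M[R]_3 := \matrix_i nth 0 [:: x; y; z] i.

Lemma rows3E x y z j :
  (rows3 x y z i0 j = x 0 j) * (rows3 x y z i1 j = y 0 j) * (rows3 x y z i2 j = z 0 j).
Proof. by rewrite !mxE. Qed.

Lemma mul_vecE x g j :
  (x *m g) 0 j = x 0 i0 * g i0 j + x 0 i1 * g i1 j + x 0 i2 * g i2 j.
Proof. by rewrite mxE sum_ord3. Qed.

Lemma dotE x y : dot x y = x 0 i0 * y 0 i0 + x 0 i1 * y 0 i1 + x 0 i2 * y 0 i2.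
Proof. exact: sum_ord3. Qed.

Definition cross x y : 'rV[R]_3 :=
  vec (x 0 i1 * y 0 i2 - x 0 i2 * y 0 i1)
      (x 0 i2 * y 0 i0 - x 0 i0 * y 0 i2)
      (x 0 i0 * y 0 i1 - x 0 i1 * y 0 i0).

Lemma crossE x y :
  (cross x y 0 i0 = x 0 i1 * y 0 i2 - x 0 i2 * y 0 i1) *
  (cross x y 0 i1 = x 0 i2 * y 0 i0 - x 0 i0 * y 0 i2) *
  (cross x y 0 i2 = x 0 i0 * y 0 i1 - x 0 i1 * y 0 i0).
Proof. by rewrite !vecE. Qed.

Lemma vaddE x y j : (x + y) 0 j = x 0 j + y 0 j. Proof. by rewrite mxE. Qed.
Lemma voppE x j : (- x) 0 j = - x 0 j. Proof. by rewrite mxE. Qed.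
Lemma vscaleE c x j : (c *: x) 0 j = c * x 0 j. Proof. by rewrite mxE. Qed.

Definition coordE := (vecE, rows3E, mul_vecE, dotE, crossE, vaddE, voppE, vscaleE).

Lemma dotC x y : dot x y = dot y x. Proof. by rewrite !coordE; ring. Qed.
Lemma dotDl x y z : dot (x + y) z = dot x z + dot y z.
Proof. by rewrite !coordE; ring. Qed.
Lemma dotZl c x y : dot (c *: x) y = c * dot x y.
Proof. by rewrite !coordE; ring. Qed.
Lemma dotNl x y : dot (- x) y = - dot x y.
Proof. by rewrite !coordE; ring. Qed.
Lemma dotDr x y z : dot x (y + z) = dot x y + dot x z.
Proof. by rewrite !coordE; ring. Qed.
Lemma dotZr c x y : dot x (c *: y) = c * dot x y.
Proof. by rewrite !coordE; ring. Qed.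
Lemma dotNr x y : dot x (- y) = - dot x y.
Proof. by rewrite !coordE; ring. Qed.

Lemma dot_mx x y : x *m y^T = (dot x y)%:M.
Proof.
apply/matrixP => i j; rewrite !ord1 !mxE eqxx mulr1n.
by apply: eq_bigr => k _; rewrite mxE.
Qed.

Lemma dot_adj x y g : dot (x *m g) y = dot x (y *m g^T).
Proof.
have : (dot (x *m g) y)%:M = (dot x (y *m g^T))%:M :> 'M[R]_1.
  by rewrite -!dot_mx trmx_mul trmxK mulmxA.
by move/matrixP/(_ 0 0); rewrite !mxE eqxx !mulr1n.
Qed.

Lemma dot_ge0 x : 0 <= dot x x.
Proof. by rewrite sumr_ge0 // => i _; rewrite -expr2 sqr_ge0. Qed.

Lemma dot_eq0 x : dot x x = 0 -> x = 0.
Proof.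
move/eqP; rewrite psumr_eq0; last by move=> i _; rewrite -expr2 sqr_ge0.
move=> /allP H; apply/rowP => i; rewrite mxE; apply/eqP.
by have := H i (mem_index_enum i); rewrite mulf_eq0 orbb.
Qed.

Lemma dot_ext x y : (forall z, dot x z = dot y z) -> x = y.
Proof.
move=> H; apply/eqP; rewrite -subr_eq0; apply/eqP/dot_eq0.
by rewrite dotDl dotNl H subrr.
Qed.

Lemma unit_eq u v : dot u u = 1 -> dot v v = 1 -> dot u v = 1 -> u = v.
Proof.
move=> Hu Hv Huv; apply/eqP; rewrite -subr_eq0; apply/eqP/dot_eq0.
rewrite dotDl !dotDr !dotNr !dotNl (dotC v u) Hu Hv Huv; ring.
Qed.

Lemma unit_eqN u v : dot u u = 1 -> dot v v = 1 -> dot u v = -1 -> u = - v.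
Proof.
by move=> Hu Hv Huv; apply: unit_eq => //; rewrite ?dotNl ?dotNr ?Hv ?Huv ?opprK.
Qed.

Lemma cauchy_schwarz u v : dot u u = 1 -> dot v v = 1 -> dot u v ^+ 2 <= 1.
Proof.
move=> Hu Hv; have := dot_ge0 (u + v); have := dot_ge0 (u - v).
rewrite !dotDl !dotDr !dotNr !dotNl (dotC v u) Hu Hv => H1 H2.
by rewrite expr2; nra.
Qed.

Lemma cross_sq u v : dot (cross u v) (cross u v) = dot u u * dot v v - dot u v ^+ 2.
Proof. by rewrite !coordE; ring. Qed.

Lemma det3E g : \det g =
  g i0 i0 * (g i1 i1 * g i2 i2 - g i1 i2 * g i2 i1)
  - g i0 i1 * (g i1 i0 * g i2 i2 - g i1 i2 * g i2 i0)
  + g i0 i2 * (g i1 i0 * g i2 i1 - g i1 i1 * g i2 i0).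
Proof.
rewrite (expand_det_row _ i0) sum_ord3 /cofactor.
rewrite !(expand_det_row _ ord0) !big_ord_recl !big_ord0 /cofactor !det_mx11 !mxE /=.
pose f a b := g (inord a) (inord b).
have gE i j : g i j = f (val i) (val j) by rewrite /f !inord_val.
by rewrite !gE /= /bump /= !addn0 !addn1 /=; ring.
Qed.

Lemma SO3M g h : SO3 g -> SO3 h -> SO3 (g *m h).
Proof.
move=> [g1 g2] [h1 h2]; split; last by rewrite det_mulmx g2 h2 mulr1.
by rewrite trmx_mul mulmxA -(mulmxA g) h1 mulmx1.
Qed.

Lemma SO3_trK g : SO3 g -> g *m g^T = 1%:M. Proof. by case. Qed.
Lemma SO3_trKl g : SO3 g -> g^T *m g = 1%:M. Proof. by case=> /mulmx1C. Qed.

Lemma SO3_tr g : SO3 g -> SO3 g^T.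
Proof. by move=> Hg; split; [rewrite trmxK SO3_trKl | rewrite det_tr; case: Hg]. Qed.

Lemma SO3_1 : SO3 (1%:M : 'M[R]_3).
Proof. by split; [rewrite trmx1 mulmx1 | rewrite det1]. Qed.

Lemma dot_SO3 g x y : SO3 g -> dot (x *m g) (y *m g) = dot x y.
Proof. by move=> Hg; rewrite dot_adj -mulmxA SO3_trK // mulmx1. Qed.

Lemma mulKSO3 (m : nat) (x : 'M[R]_(m, 3)) g : SO3 g -> x *m g *m g^T = x.
Proof. by move=> Hg; rewrite -mulmxA SO3_trK // mulmx1. Qed.
Lemma mulVKSO3 (m : nat) (x : 'M[R]_(m, 3)) g : SO3 g -> x *m g^T *m g = x.
Proof. by move=> Hg; rewrite -mulmxA SO3_trKl // mulmx1. Qed.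

Lemma cross_SO3 g x y : SO3 g -> cross (x *m g) (y *m g) = cross x y *m g.
Proof.
move=> Hg; apply: dot_ext => z; rewrite -[z](mulVKSO3 _ Hg) dot_SO3 //.
move: (z *m g^T) => t; rewrite -[RHS]mul1r -(proj2 Hg) det3E !coordE; ring.
Qed.

Lemma mx_ext g h : (forall x, x *m g = x *m h) -> g = h.
Proof. by move=> H; apply/row_matrixP => i; rewrite !rowE H. Qed.

(* Rodrigues' formula: the rotation about the unit vector [u] whose angle has
   cosine [c] and sine [s]. *)
Definition rod u c s : 'M[R]_3 :=
  c%:M + (1 - c) *: (u^T *m u) +
  s *: \matrix_(i, j) cross u (delta_mx 0 i) 0 j.

Lemma rodE x u c s :
  x *m rod u c s = c *: x + ((1 - c) * dot x u) *: u + s *: cross u x.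
Proof.
rewrite /rod !mulmxDr mul_mx_scalar -!scalemxAr mulmxA dot_mx mul_scalar_mx scalerA.
congr (_ + _ + _ *: _); apply/rowP => j; rewrite mxE sum_ord3 !mxE.
by move: j; apply: forall_ord3; rewrite /= ?vecE; ring.
Qed.

Lemma rod_conj u c s h : SO3 h -> h^T *m rod u c s *m h = rod (u *m h) c s.
Proof.
move=> Hh; apply: mx_ext => x; rewrite !mulmxA !rodE.
rewrite !mulmxDl -!scalemxAl mulVKSO3 // -cross_SO3 // mulVKSO3 //.
have E : dot (x *m h^T) u = dot x (u *m h) by rewrite -(dot_SO3 _ _ Hh) mulVKSO3.
by rewrite E.
Qed.

Lemma rodN u c s : rod (- u) c s = rod u c (- s).
Proof.
apply: mx_ext => x; rewrite !rodE dotNr; apply/rowP.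
by apply: forall_ord3; rewrite !coordE; ring.
Qed.

Lemma rod_id u : rod u 1 0 = 1%:M.
Proof. by apply: mx_ext => x; rewrite rodE subrr mul0r !scale0r !addr0 scale1r mulmx1. Qed.

Definition e3 : 'rV[R]_3 := vec 0 0 1.

Lemma e3_unit : dot e3 e3 = 1. Proof. by rewrite !coordE; ring. Qed.

Lemma rows3_SO3 u v : dot u u = 1 -> dot v v = 1 -> dot u v = 0 ->
  SO3 (rows3 u v (cross u v)).
Proof.
move=> Hu Hv Huv; split; last first.
  have := cross_sq u v; rewrite Hu Hv Huv => H.
  transitivity (dot (cross u v) (cross u v)); last by rewrite H; ring.
  by rewrite det3E !coordE; ring.
have D i j : (rows3 u v (cross u v) *m (rows3 u v (cross u v))^T) i j =
    dot (nth 0 [:: u; v; cross u v] i) (nth 0 [:: u; v; cross u v] j).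
  by rewrite mxE; apply: eq_bigr => k _; rewrite !mxE.
have c0 : dot u (cross u v) = 0 by rewrite !coordE; ring.
have c1 : dot v (cross u v) = 0 by rewrite !coordE; ring.
have c2 : dot (cross u v) (cross u v) = 1 by rewrite cross_sq Hu Hv Huv; ring.
apply/matrixP; apply: forall_ord3; apply: forall_ord3; rewrite D mxE /=;
  rewrite ?Hu ?Hv ?Huv ?c0 ?c1 ?c2 // dotC //.
Qed.

Lemma vec_rows3 a b d x y z : vec a b d *m rows3 x y z = a *: x + b *: y + d *: z.
Proof. by apply/rowP; apply: forall_ord3; rewrite !coordE. Qed.

Lemma exists_orthogonal u : dot u u = 1 -> exists2 v, dot v v = 1 & dot u v = 0.
Proof.
move=> Hu; have [E|N] := eqVneq (u 0 i0 ^+ 2 + u 0 i1 ^+ 2) 0.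
  exists (vec 1 0 0); rewrite !coordE; first by ring.
  have := E; move/eqP; rewrite paddr_eq0 ?sqr_ge0 // !expf_eq0 /= => /andP [/eqP -> _]; ring.
have P : 0 < u 0 i0 ^+ 2 + u 0 i1 ^+ 2 by rewrite lt_neqAle eq_sym N addr_ge0 ?sqr_ge0.
set n := Num.sqrt (u 0 i0 ^+ 2 + u 0 i1 ^+ 2).
have n2 : n ^+ 2 = u 0 i0 ^+ 2 + u 0 i1 ^+ 2 by rewrite sqr_sqrtr // ltW.
have n0 : n != 0 by rewrite -sqrf_eq0 n2.
exists (vec (- u 0 i1 / n) (u 0 i0 / n) 0); rewrite !coordE; last by field.
transitivity ((u 0 i0 ^+ 2 + u 0 i1 ^+ 2) / n ^+ 2); first by field.
by rewrite n2 divff.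
Qed.

Lemma exists_frame u v : dot u u = 1 -> dot v v = 1 -> dot u v ^+ 2 != 1 ->
  exists2 h, SO3 h & u = vec 1 0 0 *m h /\
    v = vec (dot u v) (Num.sqrt (1 - dot u v ^+ 2)) 0 *m h.
Proof.
move=> Hu Hv N; set s := dot u v; set n := Num.sqrt _.
have P : 0 < 1 - s ^+ 2.
  by rewrite subr_gt0 lt_neqAle N cauchy_schwarz.
have n2 : n ^+ 2 = 1 - s ^+ 2 by rewrite sqr_sqrtr // ltW.
have n0 : n != 0 by rewrite -sqrf_eq0 n2 lt0r_neq0.
pose w := n^-1 *: (v - s *: u).
exists (rows3 u w (cross u w)).
  apply: rows3_SO3 => //; rewrite /w.
    rewrite !dotZl !dotZr !dotDl !dotDr !dotNl !dotNr !dotZl !dotZr (dotC v u) -/s Hu Hv.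
    transitivity ((1 - s ^+ 2) / n ^+ 2); first by field.
    by rewrite n2 divff // lt0r_neq0.
  by rewrite !dotZr !dotDr !dotNr !dotZr -/s Hu; ring.
rewrite !vec_rows3 !scale0r !addr0 scale1r; split => //.
by rewrite /w scalerA divff // scale1r addrC subrK.
Qed.

Lemma exists_frame_e3 u : dot u u = 1 -> exists2 h, SO3 h & e3 *m h = u.
Proof.
move=> Hu; have [v Hv Huv] := exists_orthogonal Hu.
exists (rows3 v (cross u v) u); last by rewrite vec_rows3 !scale0r !add0r scale1r.
have H := rows3_SO3 Hu Hv Huv.
have -> : rows3 v (cross u v) u =
    rows3 (vec 0 1 0) (vec 0 0 1) (vec 1 0 0) *m rows3 u v (cross u v).
  apply/row_matrixP; apply: forall_ord3; apply/rowP => j; rewrite row_mul !mxE sum_ord3 !mxE /=; ring.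
apply: SO3M => //.
have -> : vec 1 0 0 = cross (vec 0 1 0) (vec 0 0 1).
  by apply/rowP; apply: forall_ord3; rewrite !coordE; ring.
by apply: rows3_SO3; rewrite !coordE; ring.
Qed.

(** The two pairs have the same coordinates in their Gram-Schmidt frames. *)
Lemma transport_pair u v u' v' :
  dot u u = 1 -> dot v v = 1 -> dot u' u' = 1 -> dot v' v' = 1 ->
  dot u v = dot u' v' -> dot u v ^+ 2 != 1 ->
  exists2 h, SO3 h & u *m h = u' /\ v *m h = v'.
Proof.
move=> Hu Hv Hu' Hv' E N.
have [g Hg [g1 g2]] := exists_frame Hu Hv N.
rewrite E in g2 N; have [h Hh [h1 h2]] := exists_frame Hu' Hv' N.
exists (g^T *m h); first by apply: SO3M => //; apply: SO3_tr.
by rewrite {1}g1 {1}g2 !mulmxA !mulKSO3 // -h1 -h2.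
Qed.

(** The cross product of [u] and [v] is fixed too, which gives a basis of fixed vectors. *)
Lemma SO3_fix2 u v g : SO3 g -> dot u u = 1 -> dot v v = 1 -> dot u v ^+ 2 != 1 ->
  u *m g = u -> v *m g = v -> g = 1%:M.
Proof.
move=> Hg Hu Hv N gu gv.
have gw : cross u v *m g = cross u v by rewrite -cross_SO3 // gu gv.
have w0 : dot (cross u v) (cross u v) != 0.
  by rewrite cross_sq Hu Hv mulr1 subr_eq0 eq_sym.
have [h Hh [hu hv]] := exists_frame Hu Hv N.
set n := Num.sqrt _ in hv.
have n0 : n != 0 by rewrite sqrtr_eq0 -ltNge subr_gt0 lt_neqAle N cauchy_schwarz.
rewrite {}hu {}hv in gu gv *.
have g1 : vec 1 0 0 *m h *m g = vec 1 0 0 *m h by [].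
have g2 : vec 0 1 0 *m h *m g = vec 0 1 0 *m h.
  have -> : vec 0 1 0 = n^-1 *: (vec (dot u v) n 0 - dot u v *: vec 1 0 0).
    by apply/rowP; apply: forall_ord3; rewrite !coordE; field.
  by rewrite -!scalemxAl !mulmxDl !mulNmx -!scalemxAl gv g1.
have g3 : vec 0 0 1 *m h *m g = vec 0 0 1 *m h.
  have -> : vec 0 0 1 = cross (vec 1 0 0) (vec 0 1 0).
    by apply/rowP; apply: forall_ord3; rewrite !coordE; ring.
  by rewrite -!cross_SO3 // g1 g2.
have E : h *m g = h.
  apply: mx_ext => x; rewrite (vec_eta x); set a := x _ _; set b := x _ _; set d := x _ _.
  have -> : vec a b d = a *: vec 1 0 0 + b *: vec 0 1 0 + d *: vec 0 0 1.
    by apply/rowP; apply: forall_ord3; rewrite !coordE; ring.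
  by rewrite mulmxA !mulmxDl -!scalemxAl g1 g2 g3.
by rewrite -[LHS](mul1mx g) -(SO3_trKl Hh) -mulmxA E.
Qed.
Lemma rod_e3E x c s :
  x *m rod e3 c s = vec (c * x 0 i0 - s * x 0 i1) (s * x 0 i0 + c * x 0 i1) (x 0 i2).
Proof. by rewrite rodE; apply/rowP; apply: forall_ord3; rewrite !coordE; ring. Qed.

Lemma fix_rod u c s : dot u u = 1 -> u *m rod u c s = u.
Proof.
move=> Hu; rewrite rodE Hu; apply/rowP.
by apply: forall_ord3; rewrite !coordE; ring.
Qed.

Lemma rodM u c s c' s' : dot u u = 1 ->
  rod u c s *m rod u c' s' = rod u (c * c' - s * s') (c * s' + s * c').
Proof.
move=> /exists_frame_e3 [h Hh <-]; rewrite -!rod_conj // !mulmxA (mulKSO3 _ Hh).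
congr (_ *m _); rewrite -!(mulmxA h^T); congr (_ *m _).
apply: mx_ext => x; rewrite mulmxA !rod_e3E; apply/rowP.
by apply: forall_ord3; rewrite !coordE; ring.
Qed.

Lemma trmx_rod u c s : (rod u c s)^T = rod u c (- s).
Proof.
apply/matrixP; apply: forall_ord3; apply: forall_ord3;
  rewrite /rod !mxE !big_ord1 !mxE /=; ring.
Qed.

Lemma rod_SO3 u c s : dot u u = 1 -> c ^+ 2 + s ^+ 2 = 1 -> SO3 (rod u c s).
Proof.
move=> Hu Hc; split; first by rewrite trmx_rod rodM // -(rod_id u); congr rod; lra.
have [h Hh <-] := exists_frame_e3 Hu.
rewrite -rod_conj // !det_mulmx det_tr (proj2 Hh) mul1r mulr1 det3E.
have E i j : rod e3 c s i j = ((delta_mx 0 i : 'rV[R]_3) *m rod e3 c s) 0 j by rewrite -rowE [RHS]mxE.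
by rewrite !E !rod_e3E !vecE !mxE /=; lra.
Qed.

Lemma tr3E g : \tr g = g i0 i0 + g i1 i1 + g i2 i2. Proof. exact: sum_ord3. Qed.

Lemma tr_rod u c s : dot u u = 1 -> \tr (rod u c s) = 1 + 2 * c.
Proof.
move=> Hu; transitivity (3 * c + (1 - c) * dot u u); last by rewrite Hu; ring.
by rewrite dotE tr3E /rod !mxE !big_ord1 !mxE /=; ring.
Qed.

(* The half-angle form of the spherical law of cosines. *)
Lemma tr_rod_mul u v c s : dot u u = 1 -> dot v v = 1 -> c ^+ 2 + s ^+ 2 = 1 ->
  \tr (rod u c s *m rod v c s) + 1 = ((1 + c) - dot u v * (1 - c)) ^+ 2.
Proof.
move=> Hu Hv Hc.
have E g h : \tr (g *m h) = \sum_i dot ((delta_mx 0 i : 'rV[R]_3) *m g) (delta_mx 0 i *m h^T).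
  by apply: eq_bigr => i _; rewrite mxE -!rowE; apply: eq_bigr => k _; rewrite !mxE.
rewrite E trmx_rod sum_ord3 !rodE.
have -> : (delta_mx 0 i0 : 'rV[R]_3) = vec 1 0 0.
  by apply/rowP; apply: forall_ord3; rewrite !mxE.
have -> : (delta_mx 0 i1 : 'rV[R]_3) = vec 0 1 0.
  by apply/rowP; apply: forall_ord3; rewrite !mxE.
have -> : (delta_mx 0 i2 : 'rV[R]_3) = vec 0 0 1.
  by apply/rowP; apply: forall_ord3; rewrite !mxE.
transitivity (1 + 3 * c ^+ 2 + c * (1 - c) * (dot u u + dot v v) +
   (1 - c) ^+ 2 * dot u v ^+ 2 - 2 * s ^+ 2 * dot u v).
  by rewrite !coordE; ring.
have -> : s ^+ 2 = 1 - c ^+ 2 by rewrite -Hc; ring.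
by rewrite Hu Hv; ring.
Qed.

Lemma SO3_fix_e3 g : SO3 g -> e3 *m g = e3 ->
  exists c s, c ^+ 2 + s ^+ 2 = 1 /\ g = rod e3 c s.
Proof.
move=> Hg ge; pose x := vec 1 0 0 *m g; pose y := vec 0 1 0 *m g.
have xx : dot x x = 1 by rewrite dot_SO3 // !coordE; ring.
have xe : dot x e3 = 0 by rewrite -ge dot_SO3 // !coordE; ring.
have ye : y = cross e3 x.
  rewrite -[in RHS]ge cross_SO3 //; congr (_ *m _).
  by apply/rowP; apply: forall_ord3; rewrite !coordE; ring.
have x2 : x 0 i2 = 0 by move: xe; rewrite !dotE !vecE !mulr0 !add0r mulr1.
exists (x 0 i0), (x 0 i1); split.
  by rewrite -xx dotE x2; ring.
apply: mx_ext => t; rewrite rod_e3E {1}(vec_eta t).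
set a := t _ _; set b := t _ _; set d := t _ _.
have -> : vec a b d = a *: vec 1 0 0 + b *: vec 0 1 0 + d *: e3.
  by apply/rowP; apply: forall_ord3; rewrite !coordE; ring.
rewrite !mulmxDl -!scalemxAl ge -/x -/y ye; move: x2; clearbody x => x2;
  apply/rowP; apply: forall_ord3;
  by rewrite !coordE ?x2; ring.
Qed.

(** Composition with the half-turn about the first coordinate axis reduces this to [SO3_fix_e3]. *)
Lemma SO3_antifix_e3 g : SO3 g -> e3 *m g = - e3 ->
  exists c s, c ^+ 2 + s ^+ 2 = 1 /\
    forall x, x *m g = vec (c * x 0 i0 + s * x 0 i1) (s * x 0 i0 - c * x 0 i1) (- x 0 i2).
Proof.
move=> Hg ge; pose f := rod (vec 1 0 0) (-1) 0.
have u1 : dot (vec 1 0 0) (vec 1 0 0) = 1 by rewrite !coordE; ring.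
have fE x : x *m f = vec (x 0 i0) (- x 0 i1) (- x 0 i2).
  rewrite rodE; apply/rowP; apply: forall_ord3; rewrite !coordE; ring.
have Hf : SO3 f by apply: rod_SO3 => //; ring.
have fg : e3 *m (f *m g) = e3.
  rewrite mulmxA fE (_ : vec _ _ _ = - e3) ?mulNmx ?ge ?opprK //.
  by apply/rowP; apply: forall_ord3; rewrite !coordE; ring.
have [c [s [Hc E]]] := SO3_fix_e3 (SO3M Hf Hg) fg.
exists c, s; split => // x.
have ff : f *m f = 1%:M by rewrite rodM // -(rod_id (vec 1 0 0)); congr rod; ring.
by rewrite -[g]mul1mx -ff -mulmxA E mulmxA rod_e3E fE; apply: vec_ext; rewrite !vecE; ring.
Qed.
End Geometry.
Arguments e3 {R}.

(** * Rotations about a fixed axis in a tensor stabilizer *)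

Section GeneralAction.
Context (F : comNzRingType) (m : nat).
Implicit Types (g h : 'M[F]_3) (T : {ffun 'I_m -> 'I_3} -> F).

(** The formula of [tact] over any commutative ring: the rotations about an axis are diagonalized
    over the complex numbers, and the result is then read back over the reals. *)
Definition gact g T : {ffun 'I_m -> 'I_3} -> F :=
  fun i => \sum_(j : {ffun 'I_m -> 'I_3}) (\prod_(k < m) g (i k) (j k)) * T j.

Lemma gactM g h T : gact (g *m h) T = gact g (gact h T).
Proof.
apply/funext => i; rewrite /gact.
have E (j : {ffun 'I_m -> 'I_3}) : \prod_k (g *m h) (i k) (j k) =
    \sum_(l : {ffun 'I_m -> 'I_3}) (\prod_k g (i k) (l k)) * \prod_k h (l k) (j k).
  under eq_bigr => k _ do rewrite mxE.
  by rewrite bigA_distr_bigA; apply: eq_bigr => l _; rewrite big_split.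
under eq_bigr => j _ do rewrite E big_distrl /=.
rewrite exchange_big /=; apply: eq_bigr => l _; rewrite big_distrr /=.
by apply: eq_bigr => j _; rewrite mulrA.
Qed.

Lemma gact_diag g T : is_diag_mx g ->
  gact g T = fun i => (\prod_k g (i k) (i k)) * T i.
Proof.
move=> /is_diag_mxP gd; apply/funext => i; rewrite /gact (bigD1 i) //= [X in _ + X]big1 ?addr0 //.
move=> j ji; have [k kP] : exists k, i k != j k.
  apply/existsP; rewrite -negb_forall; apply: contra ji => /forallP H.
  by apply/eqP/ffunP => k; rewrite (eqP (H k)).
by rewrite (bigD1 k) //= gd ?mul0r.
Qed.

Lemma gact1 T : gact 1%:M T = T.
Proof.
rewrite gact_diag; last by apply: scalar_mx_is_diag.
by apply/funext => i; rewrite big1 ?mul1r // => k _; rewrite mxE eqxx.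
Qed.

End GeneralAction.

(** * Angles as complex numbers of modulus one *)

Section ComplexRotations.
Context (R : realType).
Implicit Types (u v x : 'rV[R]_3) (z w : R[i]).

Definition cunit z : Prop := complex.Re z ^+ 2 + complex.Im z ^+ 2 = 1.

(** With the angle encoded by [z], composing rotations about [u] is multiplying complex numbers, and
    having order dividing d becomes [z ^+ d = 1]. *)
Definition crod u z : 'M[R]_3 := rod u (complex.Re z) (complex.Im z).

Lemma cunit1 : cunit 1. Proof. by rewrite /cunit /=; ring. Qed.

Lemma cunitM z w : cunit z -> cunit w -> cunit (z * w).
Proof.
case: z => a b; case: w => c d; rewrite /cunit /= => H1 H2.
transitivity ((a ^+ 2 + b ^+ 2) * (c ^+ 2 + d ^+ 2)); first by ring.
by rewrite H1 H2 mulr1.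
Qed.

Lemma cunitX z n : cunit z -> cunit (z ^+ n).
Proof.
by move=> Hz; elim: n => [|n IH]; [exact: cunit1 | rewrite exprS; apply: cunitM].
Qed.

Lemma cunit_neq0 z : cunit z -> z != 0.
Proof.
by move=> Hz; apply/eqP => z0; move: Hz; rewrite z0 /cunit /=; lra.
Qed.

Lemma cunit_conj z : cunit z -> z * z^*%C = 1.
Proof.
case: z => a b; rewrite /cunit /= => H; apply/eqP; rewrite eq_complex /=.
by apply/andP; split; apply/eqP; lra.
Qed.

Lemma crod_mul u z w : dot u u = 1 -> crod u z *m crod u w = crod u (z * w).
Proof.
move=> Hu; rewrite /crod rodM //; case: z => a b; case: w => c d /=; congr rod; ring.
Qed.

Lemma crod_SO3 u z : dot u u = 1 -> cunit z -> SO3 (crod u z).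
Proof. by move=> Hu Hz; apply: rod_SO3. Qed.

Lemma crod1 u : crod u 1 = 1%:M. Proof. exact: rod_id. Qed.

Lemma SO3_fix_crod u g : SO3 g -> dot u u = 1 -> u *m g = u ->
  exists2 z, cunit z & g = crod u z.
Proof.
move=> Hg Hu gu; have [h Hh E] := exists_frame_e3 Hu.
have [||c [s [Hc Er]]] := @SO3_fix_e3 R (h *m g *m h^T).
- by apply: SO3M; [apply: SO3M | apply: SO3_tr].
- by rewrite !mulmxA E gu -E mulKSO3.
exists (c +i* s)%C => //; rewrite /crod /= -E -rod_conj // -Er.
by rewrite !mulmxA (SO3_trKl Hh) mul1mx mulVKSO3.
Qed.

(** Since g - 1 = - g (g - 1)^T and the dimension is odd, the determinant of g - 1 equals its
    opposite, so 1 is an eigenvalue. *)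
Lemma euler_axis (g : 'M[R]_3) : SO3 g -> exists2 u, dot u u = 1 & u *m g = u.
Proof.
move=> Hg; have D : \det (g - 1%:M) = 0.
  have E : g - 1%:M = g *m ((-1) *: (g - 1%:M)^T).
    by rewrite linearB /= trmx1 scaleN1r mulmxN mulmxBr mulmx1 SO3_trK // opprB.
  have := congr1 determinant E; rewrite det_mulmx (proj2 Hg) mul1r detZ det_tr.
  by rewrite !exprS expr0 => H; lra.
have /det0P [v v0 vg] : \det (g - 1%:M) == 0 by rewrite D.
have vv : 0 < dot v v.
  by rewrite lt_neqAle dot_ge0 andbT eq_sym; apply/eqP => /dot_eq0 /eqP; apply/negP.
have n2 : Num.sqrt (dot v v) ^+ 2 = dot v v by rewrite sqr_sqrtr // ltW.
have n0 : Num.sqrt (dot v v) != 0 by rewrite -sqrf_eq0 n2 lt0r_neq0.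
exists ((Num.sqrt (dot v v))^-1 *: v).
  by rewrite dotZl dotZr -{3}n2; field.
rewrite -scalemxAl; congr (_ *: _).
by move: vg => /eqP; rewrite mulmxBr mulmx1 subr_eq0 => /eqP.
Qed.

Lemma SO3_crod (g : 'M[R]_3) : SO3 g ->
  exists u, dot u u = 1 /\ exists2 z, cunit z & g = crod u z.
Proof.
by move=> Hg; have [u Hu gu] := euler_axis Hg; exists u; split=> //; apply: SO3_fix_crod.
Qed.

(** All that the classification uses about the stabilizer of a tensor of order [N]. The exponent
    [d = 0] stands for a full circle of rotations, because [z ^+ 0 = 1] always holds. *)
Record axial (N : nat) (G : 'M[R]_3 -> Prop) : Prop := Axial {
  axial_SO3 : forall g, G g -> SO3 g;
  axial_1 : G 1%:M;
  axial_mul : forall g h, G g -> G h -> G (g *m h);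
  axial_tr : forall g, G g -> G g^T;
  axial_axis : forall u, dot u u = 1 ->
    exists2 d, (d <= N)%N & forall z, cunit z -> (G (crod u z) <-> z ^+ d = 1)
}.

Lemma expr_gcdn (F : fieldType) (z : F) (m n : nat) :
  z ^+ gcdn m n = 1 <-> z ^+ m = 1 /\ z ^+ n = 1.
Proof.
split=> [H|[Hm Hn]].
  by split; apply: (expr_dvd H); rewrite ?dvdn_gcdl ?dvdn_gcdr.
case: (posnP m) => [->|m0]; first by rewrite gcd0n.
case: (egcdnP n m0) => km kn E _.
have : z ^+ (km * m) = 1 by rewrite mulnC exprM Hm expr1n.
by rewrite E exprD mulnC exprM Hn expr1n mul1r.
Qed.

Lemma expr_big_gcdn (F : fieldType) (I : finType) (P : pred I) (w : I -> nat) (z : F) :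
  z ^+ (\big[gcdn/0%N]_(i | P i) w i) = 1 <-> forall i, P i -> z ^+ w i = 1.
Proof.
rewrite -big_filter; set r := filter _ _.
suff H : z ^+ (\big[gcdn/0%N]_(i <- r) w i) = 1 <-> forall i, i \in r -> z ^+ w i = 1.
  rewrite H; split=> HP i; first by move=> Pi; apply: HP; rewrite mem_filter Pi mem_index_enum.
  by rewrite mem_filter => /andP [Pi _]; apply: HP.
elim: r => [|j r IH]; first by rewrite big_nil; split.
rewrite big_cons expr_gcdn IH; split=> [[Hj Hr] i|H].
  by rewrite inE => /orP [/eqP ->|/Hr].
by split=> [|i ir]; apply: H; rewrite inE ?eqxx // ir orbT.
Qed.

Section AxisLemma.
Context (m : nat) (T : tensor R m).

Let toC (x : R) : R[i] := (x%:C)%C.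
(** Its rows are common left eigenvectors of all rotations about [e3], with eigenvalues z, 1/z and
    1; [eigV] is the inverse matrix. *)
Let eigB : 'M[R[i]]_3 := \matrix_(i, j)
  nth 0 (nth [::] [:: [:: 1; - 'i%C; 0]; [:: 1; 'i%C; 0]; [:: 0; 0; 1]] i) j.
Let eigV : 'M[R[i]]_3 := \matrix_(i, j)
  nth 0 (nth [::] [:: [:: 2^-1; 2^-1; 0]; [:: 'i%C / 2; - 'i%C / 2; 0]; [:: 0; 0; 1]] i) j.
Let eigD z : 'M[R[i]]_3 := \matrix_(i, j)
  if i == j then nth 0 [:: z; z^-1; 1] i else 0.

(** The absolute value of n0 - n1 through truncated subtractions. The rotation multiplies the
    component [i] by z to the power n0 - n1, and whether this is 1 does not depend on the sign of
    the exponent. *)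
Let weight (i : {ffun 'I_m -> 'I_3}) : nat :=
  let n0 := #|[pred k | i k == i0]| in let n1 := #|[pred k | i k == i1]| in
  ((n0 - n1) + (n1 - n0))%N.

Lemma eigVB : eigV *m eigB = 1%:M.
Proof.
have j2 : 'i%C * 'i%C = -1 :> R[i] by rewrite -expr2 sqr_i.
apply/matrixP; apply: forall_ord3; apply: forall_ord3; rewrite !mxE sum_ord3 !mxE /=;
  move: 'i%C j2 => j j2; rewrite ?mulr1n ?mulr0n; try by field.
by transitivity (- (j * j)); [field | rewrite j2 opprK].
Qed.

Lemma eig_rod z : cunit z ->
  eigB *m map_mx toC (crod e3 z) = eigD z *m eigB.
Proof.
move=> Hz; have zV : z^-1 = z^*%C.
  by apply: (mulfI (cunit_neq0 Hz)); rewrite cunit_conj // divff // cunit_neq0.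
have -> : crod e3 z = \matrix_(i, j) nth 0 (nth [::]
    [:: [:: complex.Re z; complex.Im z; 0]; [:: - complex.Im z; complex.Re z; 0];
        [:: 0; 0; 1]] i) j.
  apply: mx_ext => x; rewrite /crod rod_e3E.
  by apply: vec_ext; rewrite !vecE mul_vecE [_ i0 _]mxE [_ i1 _]mxE [_ i2 _]mxE /=; ring.
apply/matrixP; apply: forall_ord3; apply: forall_ord3; rewrite !mxE !sum_ord3 !mxE /=;
  rewrite ?zV; case: z {Hz zV} => a b;
  apply/eqP; rewrite eq_complex /=; apply/andP; split; apply/eqP; ring.
Qed.

Lemma gact_toC g : gact (map_mx toC g) (toC \o T) = toC \o tact g T.
Proof.
apply/funext => i; rewrite /gact /tact /= /toC rmorph_sum; apply: eq_bigr => j _.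
by rewrite rmorphM rmorph_prod; congr (_ * _); apply: eq_bigr => k _; rewrite mxE.
Qed.

Lemma eigD_weight z (i : {ffun 'I_m -> 'I_3}) : z != 0 ->
  \prod_k eigD z (i k) (i k) = 1 <-> z ^+ weight i = 1.
Proof.
move=> z0; set n0 := #|[pred k | i k == i0]|; set n1 := #|[pred k | i k == i1]|.
have -> : \prod_k eigD z (i k) (i k) = z ^+ n0 * z^-1 ^+ n1.
  rewrite -!prodr_const (big_mkcond (fun k => k \in [pred k | i k == i0]))
     (big_mkcond (fun k => k \in [pred k | i k == i1])) -big_split /=.
  apply: eq_bigr => k _; rewrite mxE eqxx !inE.
  by move: (i k); apply: forall_ord3; rewrite /= ?mulr1 ?mul1r.
rewrite /weight -/n0 -/n1 exprVn.
have zn n : z ^+ n != 0 by rewrite expf_neq0.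
have E : z ^+ n0 / z ^+ n1 = 1 <-> z ^+ n0 = z ^+ n1.
  by split=> [|->]; [move/(canRL (mulfVK (zn n1))); rewrite mul1r | rewrite divff].
rewrite E; case: (leqP n0 n1) => [le|/ltnW le].
  rewrite (eqP le) add0n -{1}(subnKC le) exprD; split=> [H|->]; last by rewrite mulr1.
  by apply: (mulfI (zn n0)); rewrite -H mulr1.
rewrite (eqP le) addn0 -{1}(subnKC le) exprD; split=> [H|->]; last by rewrite mulr1.
by apply: (mulfI (zn n1)); rewrite H mulr1.
Qed.

Lemma axis_e3 : exists2 d, (d <= m)%N &
  forall z, cunit z -> (tact (crod e3 z) T = T <-> z ^+ d = 1).
Proof.
pose S := gact eigB (toC \o T).
pose d := \big[gcdn/0%N]_(i | S i != 0) weight i.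
have wm i : (weight i <= m)%N.
  have c (A : {pred 'I_m}) : (#|A| <= m)%N by rewrite -[X in (_ <= X)%N]card_ord max_card.
  rewrite /weight; case: (leqP #|[pred k | i k == i0]| #|[pred k | i k == i1]|) => [le|/ltnW le].
    by rewrite (eqP le) add0n (leq_trans (leq_subr _ _)) ?c.
  by rewrite (eqP le) addn0 (leq_trans (leq_subr _ _)) ?c.
exists d.
  (* A gcd larger than [m] divides no positive weight, so all the weights involved are 0 and so is
     [d]. *)
  rewrite leqNgt; apply/negP => dm.
  suff d0 : d = 0%N by rewrite d0 in dm.
  apply: big1 => i Si; apply/eqP; rewrite eqn0Ngt; apply/negP => w0.
  have : (d %| weight i)%N by rewrite /d (bigD1 i) //= dvdn_gcdl.
  by move/(dvdn_leq w0); rewrite leqNgt (leq_ltn_trans (wm i)).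
move=> z Hz; have z0 := cunit_neq0 Hz.
rewrite /d expr_big_gcdn.
have tC : tact (crod e3 z) T = T <-> gact (map_mx toC (crod e3 z)) (toC \o T) = toC \o T.
  rewrite gact_toC; split=> [->//|H]; apply/funext => i.
  by have := congr1 (fun f => f i) H; rewrite /= => /complexI.
have tB : gact (map_mx toC (crod e3 z)) (toC \o T) = toC \o T <-> gact (eigD z) S = S.
  rewrite /S -gactM -eig_rod // gactM; split=> [->//|H].
  by rewrite -[LHS]gact1 -[RHS]gact1 -eigVB !(gactM eigV) H.
rewrite tC tB gact_diag; last by apply/is_diag_mxP => i j ij; rewrite mxE; case: eqP => [eij|//]; rewrite eij eqxx in ij.
split=> [H i Si|H].
  apply/eigD_weight => //; apply: (mulIf Si); rewrite mul1r.
  exact: (congr1 (fun f => f i) H).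
apply/funext => i; have [->|Si] := eqVneq (S i) 0; first by rewrite mulr0.
by rewrite (proj2 (eigD_weight i z0)) ?mul1r // H.
Qed.

End AxisLemma.

Lemma stab_conj (m : nat) (T : tensor R m) (g h : 'M[R]_3) : SO3 h ->
  stab (tact h T) g <-> stab T (h^T *m g *m h).
Proof.
move=> Hh; have A (a b : 'M[R]_3) (U : tensor R m) : tact (a *m b) U = tact a (tact b U).
  exact: gactM.
have A1 (U : tensor R m) : tact 1%:M U = U by exact: gact1.
split=> -[Hg E]; split.
- by apply: SO3M => //; apply: SO3M => //; apply: SO3_tr.
- by rewrite !A E -A SO3_trKl // A1.
- have -> : g = h *m (h^T *m g *m h) *m h^T by rewrite !mulmxA SO3_trK // mul1mx mulKSO3.
  by apply: SO3M; [apply: SO3M | apply: SO3_tr].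
- have -> : g = h *m (h^T *m g *m h) *m h^T by rewrite !mulmxA SO3_trK // mul1mx mulKSO3.
  by rewrite -A mulVKSO3 // A E.
Qed.

Lemma axial_stab (m : nat) (T : tensor R m) : axial m (stab T).
Proof.
have A (a b : 'M[R]_3) (U : tensor R m) : tact (a *m b) U = tact a (tact b U).
  exact: gactM.
have A1 (U : tensor R m) : tact 1%:M U = U by exact: gact1.
split=> [g []//||g h [Hg Eg] [Hh Eh]|g [Hg Eg]|u Hu].
- by split; [exact: SO3_1 | exact: A1].
- by split; [exact: SO3M | rewrite A Eh Eg].
- by split; [exact: SO3_tr | rewrite -[in LHS]Eg -A SO3_trKl // A1].
have [h Hh E] := exists_frame_e3 Hu.
have [d dm Hd] := axis_e3 (tact h T); exists d => // z Hz; rewrite -Hd //.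
have -> : crod u z = h^T *m crod e3 z *m h by rewrite rod_conj // E.
rewrite -stab_conj //; split=> [[]//|H]; split => //.
by apply: crod_SO3 => //; exact: e3_unit.
Qed.

Lemma axial_conj N (G : 'M[R]_3 -> Prop) (h : 'M[R]_3) : SO3 h -> axial N G ->
  axial N (fun g => G (h^T *m g *m h)).
Proof.
move=> Hh [GS G1 GM GT GA]; split=> [g /GS Hg||g k Hg Hk|g Hg|u Hu].
- have -> : g = h *m (h^T *m g *m h) *m h^T by rewrite !mulmxA SO3_trK // mul1mx mulKSO3.
  by apply: SO3M; [apply: SO3M | apply: SO3_tr].
- by rewrite mulmx1 SO3_trKl.
- have -> : h^T *m (g *m k) *m h = (h^T *m g *m h) *m (h^T *m k *m h); last exact: GM.
  by rewrite !mulmxA (mulKSO3 _ Hh).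
- by have := GT _ Hg; rewrite !trmx_mul trmxK mulmxA.
have [d dN Hd] : exists2 d, (d <= N)%N &
    forall z, cunit z -> (G (crod (u *m h) z) <-> z ^+ d = 1).
  by apply: GA; rewrite dot_SO3.
by exists d => // z /Hd <-; rewrite /crod rod_conj.
Qed.

End ComplexRotations.

(** * Roots of unity *)

Section RootsOfUnity.
Context (R : realType).
Implicit Types (z w : R[i]) (a : R).

Lemma de_moivre a n : (cos a +i* sin a)%C ^+ n = (cos (a *+ n) +i* sin (a *+ n))%C.
Proof.
elim: n => [|n IH]; first by rewrite expr0 mulr0n cos0 sin0.
by rewrite exprS IH mulrS cosD sinD; apply/eqP; rewrite eq_complex /= eqxx /= addrC.
Qed.

(** The triple-angle formula at pi turns into (c + 1)(2c - 1)^2 = 0, and the cosine c is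
    positive. *)
Lemma cos_pi3 : cos (pi / 3) = 1 / 2 :> R.
Proof.
have E : pi / 3 *+ 3 = pi :> R by rewrite -mulr_natr; field.
have := de_moivre (pi / 3) 3; rewrite E cospi sinpi => /(congr1 (@complex.Re R)).
rewrite !exprS expr0 /=.
have : 0 < cos (pi / 3 : R).
  apply: cos_gt0_pihalf; have := pi_gt0 R => p0.
  by apply/andP; split; lra.
have : cos (pi / 3 : R) ^+ 2 + sin (pi / 3) ^+ 2 = 1 by exact: cos2Dsin2.
set c := cos _; set s := sin _ => H c0 H3.
have F : (c + 1) * (2 * c - 1) ^+ 2 = 0.
  have s2 : s ^+ 2 = 1 - c ^+ 2 by lra.
  transitivity (4 * c ^+ 3 - 3 * c + 1); first by ring.
  have : c ^+ 3 - 3 * c * s ^+ 2 = -1 by rewrite -H3; ring.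
  rewrite s2; lra.
move/eqP: F; rewrite mulf_eq0 sqrf_eq0 => /orP [] /eqP; lra.
Qed.

Lemma exists_small_root d : (6 <= d)%N ->
  exists w, [/\ cunit w, w ^+ d = 1, w != 1 & 1 / 2 <= complex.Re w].
Proof.
move=> d6; pose a : R := (pi *+ 2) / d%:R.
have p0 := pi_gt0 R.
have d0 : (d%:R : R) != 0 by rewrite pnatr_eq0; lia.
have dp : (0 : R) < d%:R by rewrite ltr0n; lia.
have ad : a *+ d = pi *+ 2 by rewrite -mulr_natr /a divfK.
have a0 : 0 < a by rewrite /a divr_gt0 // mulrn_wgt0.
have a3 : a <= pi / 3.
  rewrite /a ler_pdivrMr // -mulr_natr.
  have : (6 : R) <= d%:R by rewrite ler_nat.
  by nra.
have ap : a <= pi by lra.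
exists (cos a +i* sin a)%C; split.
- exact: cos2Dsin2.
- by rewrite de_moivre ad cos2pi sin2pi.
- apply/eqP => /(congr1 (@complex.Re R)) /= c1.
  have : a = 0.
    by apply: cos_inj; rewrite ?in_itv /= ?cos0 ?lexx ?ap ?(ltW a0) ?(ltW p0).
  by move=> a00; rewrite a00 ltxx in a0.
suff : cos (pi / 3) <= cos a by rewrite cos_pi3.
rewrite leNgt ltr_cos ?in_itv /= -?leNgt ?(ltW a0) ?ap //.
by apply/andP; split; lra.
Qed.

Lemma exists_fifth_root : exists w, [/\ cunit w, w ^+ 5 = 1, w != 1 &
  0 < complex.Re w /\ 4 * complex.Re w ^+ 2 + 2 * complex.Re w - 1 = 0].
Proof.
pose r : R := Num.sqrt 5; have r2 : r ^+ 2 = 5 by rewrite sqr_sqrtr.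
have r0 : 0 <= r by exact: sqrtr_ge0.
(* The cosine of 2 pi / 5. It is a root of 4 a^2 + 2 a - 1, whose square times a - 1 is the real
   part of z^5 - 1 on the unit circle. *)
pose a := (r - 1) / 4.
have r3 : r < 3 by move: r2; rewrite expr2; nra.
have r1 : 1 < r by move: r2; rewrite expr2; nra.
have aE : 4 * a ^+ 2 + 2 * a - 1 = 0.
  by rewrite /a; transitivity ((r ^+ 2 - 5) / 4); [field | rewrite r2; field].
have b0 : 0 <= 1 - a ^+ 2 by rewrite expr2; move: aE; rewrite expr2 /a; nra.
pose b := Num.sqrt (1 - a ^+ 2).
have b2 : b ^+ 2 = 1 - a ^+ 2 by rewrite sqr_sqrtr.
exists (a +i* b)%C; split.
- by rewrite /cunit /= b2; ring.
- apply/eqP; rewrite eq_complex !exprS expr0 /=; apply/andP; split; apply/eqP.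
    transitivity (a ^+ 5 - 10 * a ^+ 3 * b ^+ 2 + 5 * a * (b ^+ 2) ^+ 2); first by ring.
    rewrite b2; transitivity (1 + (a - 1) * (4 * a ^+ 2 + 2 * a - 1) ^+ 2); first by ring.
    by rewrite aE; ring.
  transitivity (b * (5 * a ^+ 4 - 10 * a ^+ 2 * b ^+ 2 + (b ^+ 2) ^+ 2)); first by ring.
  rewrite b2; transitivity (b * (4 * a ^+ 2 - 2 * a - 1) * (4 * a ^+ 2 + 2 * a - 1)).
    by ring.
  by rewrite aE mulr0.
- by apply/eqP => /(congr1 (@complex.Re R)) /= a1; rewrite a1 in aE; lra.
by split => //=; rewrite /a; lra.
Qed.

(** The quantity 2 + 2 Re z is the trace of [crod u z] plus one, the left-hand side of [tr_rod_mul];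
    this is why this lemma and the next ones list its values. *)
Lemma Re_root2 z : cunit z -> z ^+ 2 = 1 ->
  2 + 2 * complex.Re z = 4 \/ 2 + 2 * complex.Re z = 0.
Proof.
case: z => a b; rewrite /cunit /= => H /(congr1 (@complex.Re R)).
rewrite !exprS expr0 /= => E.
have /eqP : (a - 1) * (a + 1) = 0 by lra.
by rewrite mulf_eq0 => /orP [] /eqP; [left | right]; lra.
Qed.

Lemma Re_root3 z : cunit z -> z ^+ 3 = 1 ->
  2 + 2 * complex.Re z = 4 \/ 2 + 2 * complex.Re z = 1.
Proof.
case: z => a b; rewrite /cunit /= => H /(congr1 (@complex.Re R)).
rewrite !exprS expr0 /= => E.
have b2 : b ^+ 2 = 1 - a ^+ 2 by lra.
have /eqP : (a - 1) * (2 * a + 1) ^+ 2 = 0.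
  have : a ^+ 3 - 3 * a * b ^+ 2 = 1 by rewrite -[RHS]E; ring.
  by rewrite b2 => E'; lra.
by rewrite mulf_eq0 sqrf_eq0 => /orP [] /eqP; [left | right]; lra.
Qed.

Lemma Re_root4 z : cunit z -> z ^+ 4 = 1 ->
  [\/ 2 + 2 * complex.Re z = 4, 2 + 2 * complex.Re z = 0 | 2 + 2 * complex.Re z = 2].
Proof.
case: z => a b; rewrite /cunit /= => H /(congr1 (@complex.Re R)).
rewrite !exprS expr0 /= => E.
have b2 : b ^+ 2 = 1 - a ^+ 2 by lra.
have /eqP : a ^+ 2 * ((a - 1) * (a + 1)) = 0.
  have : a ^+ 4 - 6 * a ^+ 2 * b ^+ 2 + (b ^+ 2) ^+ 2 = 1 by rewrite -[RHS]E; ring.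
  by rewrite b2 => E'; lra.
rewrite mulf_eq0 sqrf_eq0 mulf_eq0 => /orP [/eqP|/orP [] /eqP] h;
  [apply: Or33 | apply: Or31 | apply: Or32]; lra.
Qed.

Lemma Re_root5 z : cunit z -> z ^+ 5 = 1 ->
  2 + 2 * complex.Re z = 4 \/ 4 * complex.Re z ^+ 2 + 2 * complex.Re z - 1 = 0.
Proof.
case: z => a b; rewrite /cunit /= => H /(congr1 (@complex.Re R)).
rewrite !exprS expr0 /= => E.
have b2 : b ^+ 2 = 1 - a ^+ 2 by lra.
have /eqP : (a - 1) * (4 * a ^+ 2 + 2 * a - 1) ^+ 2 = 0.
  have : a ^+ 5 - 10 * a ^+ 3 * b ^+ 2 + 5 * a * (b ^+ 2) ^+ 2 = 1 by rewrite -[RHS]E; ring.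
  by rewrite b2 => E'; lra.
rewrite mulf_eq0 sqrf_eq0 => /orP [] /eqP h; [left | right] => /=; lra.
Qed.

End RootsOfUnity.

(** * Invariant forms with a distinguished axis *)

Section Realizable.
Context (R : realType).
Implicit Types (u v x y : 'rV[R]_3) (g h : 'M[R]_3) (z w : R[i]).

Definition preserves (P : 'rV[R]_3 -> 'rV[R]_3 -> R) g : Prop :=
  forall x y, P (x *m g) (y *m g) = P x y.

(** The conjugation by [h] is built in so that each kind of group can be treated with its axes in a
    standard position. *)
Definition realizable (p : nat) (G : 'M[R]_3 -> Prop) : Prop :=
  exists P, [/\ bihom p p P, forall x y, P x y = P y x &
    exists2 h, SO3 h & forall g, SO3 g -> (G (h^T *m g *m h) <-> preserves P g)].

Lemma realizable_id p G P : bihom p p P -> (forall x y, P x y = P y x) ->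
  (forall g, SO3 g -> (G g <-> preserves P g)) -> realizable p G.
Proof.
move=> bP sP H; exists P; split=> //; exists 1%:M; first exact: SO3_1.
by move=> g Hg; rewrite trmx1 mul1mx mulmx1; exact: H.
Qed.

Lemma realizable_conj p G h : SO3 h ->
  realizable p (fun g => G (h^T *m g *m h)) -> realizable p G.
Proof.
move=> Hh [P [bP sP [k Hk H]]]; exists P; split=> //.
exists (k *m h); first exact: SO3M.
by move=> g /H <-; rewrite trmx_mul !mulmxA.
Qed.

Lemma bihom_cast m n m' n' (P : 'rV[R]_3 -> 'rV[R]_3 -> R) :
  bihom m n P -> m = m' -> n = n' -> bihom m' n' P.
Proof. by move=> bP <- <-. Qed.

Definition zc x : R[i] := (x 0 i0 +i* x 0 i1)%C.

Lemma conj_mul z w : (z * w)^*%C = z^*%C * w^*%C. Proof. exact: rmorphM. Qed.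
Lemma conj_exp z n : (z ^+ n)^*%C = z^*%C ^+ n. Proof. exact: rmorphXn. Qed.
Lemma conj_add z w : (z + w)^*%C = z^*%C + w^*%C. Proof. exact: rmorphD. Qed.

Definition cbihom m n (Q : 'rV[R]_3 -> 'rV[R]_3 -> R[i]) : Prop :=
  bihom m n (fun x y => complex.Re (Q x y)) /\ bihom m n (fun x y => complex.Im (Q x y)).

Lemma cbihomM m n m' n' P Q : cbihom m n P -> cbihom m' n' Q ->
  cbihom (m + m') (n + n') (fun x y => P x y * Q x y).
Proof.
move=> [P1 P2] [Q1 Q2]; split.
  apply: bihom_ext (bihomB (bihomM P1 Q1) (bihomM P2 Q2)) => x y.
  by case: (P x y) => a b; case: (Q x y).
apply: bihom_ext (bihomD (bihomM P1 Q2) (bihomM P2 Q1)) => x y.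
by case: (P x y) => a b; case: (Q x y) => c d /=; ring.
Qed.

Lemma cbihomX m n k P : cbihom m n P -> cbihom (k * m) (k * n) (fun x y => P x y ^+ k).
Proof.
move=> bP; elim: k => [|k IH].
  rewrite !mul0n; split; [apply: bihom_ext (bihom1 1)|apply: bihom_ext (bihom1 0)] => x y;
  by rewrite expr0.
rewrite !mulSn; have [H1 H2] := cbihomM bP IH.
by split; [apply: bihom_ext H1|apply: bihom_ext H2] => x y; rewrite exprS.
Qed.

Lemma bihom_x j : bihom 1 0 (fun x _ => x 0 j).
Proof.
apply: bihom_ext (bihom_left (delta_mx 0 j)) => x y; rewrite dotC /dot (bigD1 j) //= big1 ?addr0.
  by rewrite mxE !eqxx mulr1.
by move=> i ij; rewrite mxE (negbTE ij) andbF mulr0.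
Qed.

Lemma bihom_y j : bihom 0 1 (fun _ y => y 0 j).
Proof.
apply: bihom_ext (bihom_right (delta_mx 0 j)) => x y; rewrite dotC /dot (bigD1 j) //= big1 ?addr0.
  by rewrite mxE !eqxx mulr1.
by move=> i ij; rewrite mxE (negbTE ij) andbF mulr0.
Qed.

Lemma bihom_dot : bihom 1 1 (fun x y => dot x y).
Proof.
by apply: bihom_sum => i; apply: bihomM (bihom_x i) (bihom_y i).
Qed.

Lemma bihom_dotx : bihom 2 0 (fun x _ => dot x x).
Proof.
by apply: bihom_sum => i; apply: bihomM (bihom_x i) (bihom_x i).
Qed.

Lemma bihom_doty : bihom 0 2 (fun _ y => dot y y).
Proof.
by apply: bihom_sum => i; apply: bihomM (bihom_y i) (bihom_y i).
Qed.

(** * Waves, the twist and the symmetries of their combinations *)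

Section AxisPolynomials.
Context (p : nat) (p3 : (3 <= p)%N).

(** The weight [k] is placed on [x] as far as the degree p allows and the remainder on [y]; third
    coordinates fill up the bidegree (p, p). The subtractions are exact when [k <= p + p]. *)
Definition half_wave k x y : R[i] :=
  zc x ^+ minn k p * zc y ^+ (k - minn k p) *
  (x 0 i2 ^+ (p - minn k p) * y 0 i2 ^+ (p - (k - minn k p)))%:C%C.

(* Multiplied by [z ^+ k] under the rotation [crod e3 z], see [wave_rot]. *)
Definition wave k x y : R[i] := half_wave k x y + half_wave k y x.

(** The determinant of e3, x, y has the right sign under half-turns reversing [e3], but it
    alternates in x and y. The second factor also alternates, is invariant under these half-turns,
    and so restores the symmetry. *)
Definition twist x y : R :=
  dot e3 (cross x y) * (x 0 i2 ^+ 2 * dot y y - y 0 i2 ^+ 2 * dot x x) * dot x y ^+ (p - 3).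

Definition axis_poly (al be : R) k l x y : R :=
  6 * (x 0 i2 ^+ p * y 0 i2 ^+ p) +
  al * (complex.Re (wave k x y) + complex.Re (wave l x y)) + be * twist x y.

Lemma bihom_half_wave k : (k <= p + p)%N ->
  bihom p p (fun x y => complex.Re (half_wave k x y)).
Proof.
move=> kp; have lekp : (k - minn k p <= p)%N by lia.
have zx : cbihom 1 0 (fun x _ => zc x) by split; exact: bihom_x.
have zy : cbihom 0 1 (fun _ y => zc y) by split; exact: bihom_y.
have [H _] := cbihomM (cbihomX (minn k p) zx) (cbihomX (k - minn k p) zy).
have H3 := bihomM (bihomX (p - minn k p) (bihom_x i2)) (bihomX (p - (k - minn k p)) (bihom_y i2)).
apply: bihom_cast (bihom_ext _ (bihomM H H3)) _ _; [|lia|lia].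
move=> x y; rewrite /half_wave; case: (zc x ^+ _ * _) => a b /=; ring.
Qed.

Lemma bihom_swap m n P : bihom m n P -> bihom n m (fun x y => P y x : R).
Proof.
move=> [L sL HL]; exists [seq (t.1.1, t.2, t.1.2) | t <- L].
  by rewrite all_map; apply: sub_all sL => t /= /andP [-> ->].
move=> x y; rewrite HL big_map; apply: eq_bigr => t _.
by rewrite /term_eval /= mulrAC.
Qed.

Lemma bihom_twist : bihom p p twist.
Proof.
have H1 : bihom 1 1 (fun x y => dot e3 (cross x y)).
  apply: bihom_ext (bihomB (bihomM (bihom_x i0) (bihom_y i1)) (bihomM (bihom_x i1) (bihom_y i0))).
  by move=> x y; rewrite !coordE; ring.
have H2 : bihom 2 2 (fun x y => x 0 i2 ^+ 2 * dot y y - y 0 i2 ^+ 2 * dot x x).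
  apply: bihomB; first exact: bihom_cast (bihomM (bihomX 2 (bihom_x i2)) bihom_doty) _ _.
  exact: bihom_cast (bihomM (bihomX 2 (bihom_y i2)) bihom_dotx) _ _.
by apply: bihom_cast (bihomM (bihomM H1 H2) (bihomX (p - 3) bihom_dot)) _ _; lia.
Qed.

Lemma bihom_axis_poly al be k l : (k <= p + p)%N -> (l <= p + p)%N ->
  bihom p p (axis_poly al be k l).
Proof.
move=> kp lp; apply: bihomD; last exact: bihomZ bihom_twist.
apply: bihomD.
  apply: bihomZ; apply: bihom_cast (bihomM (bihomX p (bihom_x i2)) (bihomX p (bihom_y i2))) _ _; lia.
have W j : (j <= p + p)%N -> bihom p p (fun x y => complex.Re (wave j x y)).
  move=> /bihom_half_wave H; apply: bihom_ext (bihomD H (bihom_swap H)) => x y.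
  by rewrite /wave raddfD.
by apply: bihomZ; apply: bihomD; apply: W.
Qed.

Lemma waveC k x y : wave k x y = wave k y x. Proof. exact: addrC. Qed.

Lemma twistC x y : twist x y = twist y x.
Proof. by rewrite /twist (dotC y x); congr (_ * _); rewrite !coordE; ring. Qed.

Lemma axis_polyC al be k l x y : axis_poly al be k l x y = axis_poly al be k l y x.
Proof.
rewrite /axis_poly waveC (waveC l) twistC; congr (_ + _ + _); by rewrite [x 0 i2 ^+ p * _]mulrC.
Qed.

Lemma twist_diag x : twist x x = 0.
Proof. by rewrite /twist subrr mulr0 mul0r. Qed.

Lemma twist_fix g x y : SO3 g -> e3 *m g = e3 -> twist (x *m g) (y *m g) = twist x y.
Proof.
move=> Hg ge; have E (t : 'rV[R]_3) : (t *m g) 0 i2 = t 0 i2.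
  have F (s : 'rV[R]_3) : s 0 i2 = dot s e3 by rewrite !coordE; ring.
  by rewrite !F -{1}ge dot_SO3.
by rewrite /twist !E cross_SO3 // -{1}ge !dot_SO3.
Qed.

Lemma twist_antifix g x y : SO3 g -> e3 *m g = - e3 ->
  twist (x *m g) (y *m g) = - twist x y.
Proof.
move=> Hg ge; have E (t : 'rV[R]_3) : (t *m g) 0 i2 = - t 0 i2.
  have F (s : 'rV[R]_3) : s 0 i2 = dot s e3 by rewrite !coordE; ring.
  by rewrite !F -[in LHS](opprK e3) -ge dotNr dot_SO3.
rewrite /twist !E cross_SO3 // -{1}(opprK e3) -ge dotNl !dot_SO3 //; ring.
Qed.

Lemma zc_rot x z : zc (x *m crod e3 z) = z * zc x.
Proof.
rewrite /zc /crod rod_e3E !vecE; case: z => a b; apply/eqP; rewrite eq_complex /=.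
by apply/andP; split; apply/eqP; ring.
Qed.

Lemma i2_rot x z : (x *m crod e3 z) 0 i2 = x 0 i2.
Proof. by rewrite /crod rod_e3E vecE. Qed.

Lemma half_wave_rot k x y z : half_wave k (x *m crod e3 z) (y *m crod e3 z) =
  z ^+ k * half_wave k x y.
Proof.
have -> : z ^+ k = z ^+ minn k p * z ^+ (k - minn k p) by rewrite -exprD subnKC // geq_minl.
by rewrite /half_wave !zc_rot !i2_rot !exprMn; ring.
Qed.

Lemma wave_rot k x y z : wave k (x *m crod e3 z) (y *m crod e3 z) = z ^+ k * wave k x y.
Proof. by rewrite /wave !half_wave_rot mulrDr. Qed.

(* [w] encodes a half-turn about an axis orthogonal to [e3]. *)
Definition flips g w := forall x, zc (x *m g) = w * (zc x)^*%C /\ (x *m g) 0 i2 = - x 0 i2.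

Lemma half_wave_flip k x y g w : (k <= p + p)%N -> flips g w ->
  half_wave k (x *m g) (y *m g) = (- w) ^+ k * (half_wave k x y)^*%C.
Proof.
move=> kp F; rewrite /half_wave; have [-> ->] := F x; have [-> ->] := F y.
set a := minn k p; set b := (k - a)%N.
have lea : (a <= p)%N by rewrite /a; lia.
have leb : (b <= p)%N by rewrite /b /a; lia.
have Ek : k = (a + b)%N by rewrite /b /a; lia.
rewrite !conj_mul !conj_exp conjc_real.
rewrite (exprNn (x 0 i2)) (exprNn (y 0 i2)) (exprNn w) !exprMn.
(* Third coordinates occur 2p - k times in all, a number of the parity of k; this sign turns w^k
   into (-w)^k. *)
have S : (-1) ^+ (p - a) * (-1) ^+ (p - b) = (-1) ^+ k :> R.
  have H : (p - a + (p - b) + k = p + p)%N by rewrite Ek; lia.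
  apply: (@mulIf _ ((-1) ^+ k)); first by rewrite expf_neq0 // oppr_eq0 oner_eq0.
  by rewrite -exprD -exprD H -exprD -signr_odd -[RHS]signr_odd !oddD !addbb.
have -> : (-1) ^+ (p - a) * x 0 i2 ^+ (p - a) * ((-1) ^+ (p - b) * y 0 i2 ^+ (p - b))
   = (-1) ^+ k * (x 0 i2 ^+ (p - a) * y 0 i2 ^+ (p - b)) by rewrite -S; ring.
rewrite rmorphM rmorphXn rmorphN1.
have -> : w ^+ k = w ^+ a * w ^+ b by rewrite -exprD -Ek.
ring.
Qed.

Lemma wave_flip k x y g w : (k <= p + p)%N -> flips g w ->
  wave k (x *m g) (y *m g) = (- w) ^+ k * (wave k x y)^*%C.
Proof. by move=> kp F; rewrite /wave !(half_wave_flip _ _ kp F) conj_add mulrDr. Qed.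

Definition sqn z : R := complex.Re z ^+ 2 + complex.Im z ^+ 2.

Lemma sqnM z w : sqn (z * w) = sqn z * sqn w.
Proof. by case: z => a b; case: w => c d; rewrite /sqn /=; ring. Qed.

Lemma sqnX z n : sqn (z ^+ n) = sqn z ^+ n.
Proof.
by elim: n => [|n IH]; [rewrite !expr0 /sqn /=; ring | rewrite !exprS sqnM IH].
Qed.

Lemma wave_diag k x : (k <= p + p)%N ->
  wave k x x = zc x ^+ k * (x 0 i2 ^+ (p + p - k))%:C%C *+ 2.
Proof.
move=> kp; rewrite /wave -mulr2n /half_wave -!exprD subnKC ?geq_minl //.
by congr ((_ * (_ ^+ _)%:C%C) *+ 2); lia.
Qed.

(** With r = 1 - x3^2 = |zc x|^2, half of the wave has squared modulus at most r^k, hence at most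
    r^2. This is where weight at least 2 is needed. *)
Lemma Re_wave_le k x : (2 <= k <= p + p)%N -> dot x x = 1 ->
  complex.Re (wave k x x) <= 2 * (1 - x 0 i2 ^+ 2).
Proof.
move=> /andP [k2 kp]; rewrite wave_diag // dotE => x1.
set q := _ * _; set r := 1 - _.
have rE : sqn (zc x) = r by rewrite /r /sqn /= -x1; ring.
have r0 : 0 <= r by rewrite -rE addr_ge0 ?sqr_ge0.
have r1 : r <= 1 by rewrite /r lerBlDr lerDl sqr_ge0.
have : sqn q <= r ^+ 2.
  rewrite /q sqnM sqnX rE -[leRHS]mulr1; apply: ler_pM.
  - by rewrite exprn_ge0.
  - by rewrite addr_ge0 ?sqr_ge0.
  - by rewrite ler_wiXn2l.
  rewrite /sqn /= expr0n /= addr0 -exprM mulnC exprM exprn_ile1 ?sqr_ge0 //.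
  by move: r0; rewrite /r subr_ge0.
rewrite /sqn => H; have := sqr_ge0 (complex.Im q).
have -> : complex.Re (q *+ 2) = 2 * complex.Re q by rewrite raddfMn /= mulr_natl.
move: H; set a := complex.Re q; set b := complex.Im q ^+ 2; rewrite !expr2 => H b0.
by nra.
Qed.

Lemma wave_e3 k : (0 < k <= p + p)%N -> wave k e3 e3 = 0.
Proof.
move=> /andP [k0 kp]; rewrite wave_diag //.
have -> : zc e3 = 0 by rewrite /zc !vecE.
by rewrite expr0n eqn0Ngt k0 mul0r mul0rn.
Qed.

(** With t = x3^2 on the unit sphere, the value at (x, x) is at most 6 t + 4 al (1 - t): the twist
    vanishes on the diagonal and t^p <= t. As 6 exceeds 4 al, the value 6 taken at [e3] forces t =
    1. *)
Lemma preserves_axis al be k l g : 0 <= al <= 1 ->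
  (2 <= k <= p + p)%N -> (2 <= l <= p + p)%N ->
  SO3 g -> preserves (axis_poly al be k l) g -> e3 *m g = e3 \/ e3 *m g = - e3.
Proof.
move=> /andP [a0 a1] Hk Hl Hg /(_ e3 e3).
set x := e3 *m g; have x1 : dot x x = 1 by rewrite dot_SO3 // e3_unit.
rewrite /axis_poly !twist_diag !wave_e3; try by lia.
rewrite vecE expr1n /=.
have := Re_wave_le Hk x1; have := Re_wave_le Hl x1.
have t1 : x 0 i2 ^+ 2 <= 1.
  by rewrite -x1 dotE !expr2; have := sqr_ge0 (x 0 i0); have := sqr_ge0 (x 0 i1); rewrite !expr2; lra.
have -> : x 0 i2 ^+ p * x 0 i2 ^+ p = (x 0 i2 ^+ 2) ^+ p by rewrite -exprD addnn -mul2n exprM.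
have : (x 0 i2 ^+ 2) ^+ p <= x 0 i2 ^+ 2.
  rewrite -[leRHS]expr1 ler_wiXn2l ?sqr_ge0 ?t1 //; lia.
have xE : x 0 i2 = dot x e3 by rewrite dotE !vecE; ring.
rewrite xE in t1 *; move: t1.
set t := dot x e3 ^+ 2; set u := complex.Re (wave k _ _); set v := complex.Re (wave l _ _).
move=> t1 tp Hv Hu E.
have A1 : 0 <= al * (4 * (1 - t) - (u + v)) by rewrite mulr_ge0 // subr_ge0; lra.
have A2 : 0 <= (1 - al) * (1 - t) by rewrite mulr_ge0 // subr_ge0.
have T : t = 1 by move: E A1 A2; rewrite !mulrBr !mulrDr !mulrBl /=; lra.
have : (dot x e3 - 1) * (dot x e3 + 1) = t - 1 by rewrite /t; ring.
move/eqP; rewrite T subrr mulf_eq0 => /orP [] /eqP H.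
  by left; apply: unit_eq; rewrite ?e3_unit //; lra.
by right; apply: unit_eqN; rewrite ?e3_unit //; lra.
Qed.

Lemma Re_cunit_le z : cunit z -> complex.Re z <= 1.
Proof.
rewrite /cunit !expr2 => H; have := sqr_ge0 (complex.Im z); rewrite expr2 => H2; nra.
Qed.

Lemma Re_cunit_eq1 z : cunit z -> complex.Re z = 1 -> z = 1.
Proof.
case: z => a b; rewrite /cunit /= => H a1; move: H; rewrite a1.
move=> H; have /eqP : b ^+ 2 = 0 by lra.
by rewrite sqrf_eq0 => /eqP ->.
Qed.

Lemma SO3_antifix_flips g : SO3 g -> e3 *m g = - e3 -> exists2 w, cunit w & flips g w.
Proof.
move=> Hg /(SO3_antifix_e3 Hg) [c [s [Hc E]]]; exists (c +i* s)%C => // x.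
rewrite /zc E !vecE; split => //; apply/eqP; rewrite eq_complex /=.
by apply/andP; split; apply/eqP; ring.
Qed.

Let v101 : 'rV[R]_3 := vec 1 0 1.

Lemma axis_poly_v101 al be k l : (k <= p + p)%N -> (l <= p + p)%N ->
  axis_poly al be k l v101 v101 = 6 + al * 4.
Proof.
move=> kp lp; rewrite /axis_poly !twist_diag !wave_diag //.
have -> : zc v101 = 1 by rewrite /zc !vecE.
by rewrite !vecE !expr1n !mul1r /=; ring.
Qed.

(** At [v101] both [zc] and the third coordinate are 1, so a rotated wave has the value 2 z^k there.
    Invariance gives Re z^k + Re z^l = 2, and neither term exceeds 1. *)
Lemma preserves_rot al be k l z : (k <= p + p)%N -> (l <= p + p)%N ->
  al != 0 -> cunit z ->
  preserves (axis_poly al be k l) (crod e3 z) <-> z ^+ k = 1 /\ z ^+ l = 1.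
Proof.
move=> kp lp al0 Hz; have rf : e3 *m crod e3 z = e3 by rewrite fix_rod // e3_unit.
have HS : SO3 (crod e3 z) by apply: crod_SO3 => //; rewrite e3_unit.
split=> [/(_ v101 v101)|[zk zl] x y]; last first.
  by rewrite /axis_poly !wave_rot !i2_rot zk zl !mul1r twist_fix.
rewrite axis_poly_v101 // /axis_poly !wave_rot !twist_diag !wave_diag // !i2_rot.
have -> : zc v101 = 1 by rewrite /zc !vecE.
rewrite !vecE !expr1n !mul1r => H.
have Rk := Re_cunit_le (cunitX k Hz); have Rl := Re_cunit_le (cunitX l Hz).
have E : complex.Re (z ^+ k) + complex.Re (z ^+ l) = 2.
  apply: (mulfI al0); move: H; case: (z ^+ k) => a b; case: (z ^+ l) => c d /=; lra.
by split; (apply: Re_cunit_eq1; [exact: cunitX | lra]).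
Qed.

Lemma preserves_rot0 be k l z : cunit z -> preserves (axis_poly 0 be k l) (crod e3 z).
Proof.
move=> Hz; have rf : e3 *m crod e3 z = e3 by rewrite fix_rod // e3_unit.
have HS : SO3 (crod e3 z) by apply: crod_SO3 => //; rewrite e3_unit.
by move=> x y; rewrite /axis_poly !mul0r !i2_rot twist_fix.
Qed.

Lemma preserves_flip k l g w : (k <= p + p)%N -> (l <= p + p)%N ->
  SO3 g -> e3 *m g = - e3 -> cunit w -> flips g w ->
  preserves (axis_poly 1 0 k l) g <-> (- w) ^+ k = 1 /\ (- w) ^+ l = 1.
Proof.
move=> kp lp Hg ge Hw F.
have Hw' : cunit (- w) by move: Hw; rewrite /cunit; case: (w) => a b /=; rewrite !sqrrN.
have S2 (a b : R) : (- a) ^+ p * (- b) ^+ p = a ^+ p * b ^+ p.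
  by rewrite -!exprMn mulrNN.
split=> [/(_ v101 v101)|[wk wl] x y]; last first.
  rewrite /axis_poly !mul0r !addr0 !(wave_flip _ _ _ F) // wk wl !mul1r.
  by rewrite !(proj2 (F _)) S2; do 2 case: (wave _ _ _) => ? ?.
rewrite axis_poly_v101 // /axis_poly !(wave_flip _ _ _ F) // !wave_diag //.
have -> : zc v101 = 1 by rewrite /zc !vecE.
rewrite !(proj2 (F _)) S2 !vecE !expr1n !mul1r mul0r => H.
have Rk := Re_cunit_le (cunitX k Hw'); have Rl := Re_cunit_le (cunitX l Hw').
have E : complex.Re ((- w) ^+ k) + complex.Re ((- w) ^+ l) = 2.
  move: H; case: ((- w) ^+ k) => a b; case: ((- w) ^+ l) => c d /=; lra.
by split; (apply: Re_cunit_eq1; [exact: cunitX | lra]).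
Qed.

Lemma preserves_flip0 k l g : SO3 g -> e3 *m g = - e3 -> preserves (axis_poly 0 0 k l) g.
Proof.
move=> Hg ge x y; have [w Hw F] := SO3_antifix_flips Hg ge.
rewrite /axis_poly !mul0r !(proj2 (F _)) -[(- _) ^+ p * _]exprMn mulrNN exprMn //.
Qed.

(* Averaging over the rotations [ws] kills the waves and isolates the twist. *)
Lemma flip_not_preserves al k l g (ws : seq R[i]) : (k <= p + p)%N -> (l <= p + p)%N ->
  SO3 g -> e3 *m g = - e3 ->
  (0 < size ws)%N -> (forall w, w \in ws -> cunit w) ->
  al = 0 \/ (\sum_(w <- ws) w ^+ k = 0 /\ \sum_(w <- ws) w ^+ l = 0) ->
  ~ preserves (axis_poly al 1 k l) g.
Proof.
move=> kp lp Hg ge ws0 wsU wsK H; have [v Hv F] := SO3_antifix_flips Hg ge.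
(* At this pair the twist is 2, whatever p is, because [dot x y = 1]. *)
pose x : 'rV[R]_3 := vec 1 0 1; pose y : 'rV[R]_3 := vec 1 1 0.
have : \sum_(w <- ws) (axis_poly al 1 k l (x *m crod e3 w *m g) (y *m crod e3 w *m g) -
   axis_poly al 1 k l (x *m crod e3 w) (y *m crod e3 w)) = 0.
  by rewrite big1 // => w _; rewrite H subrr.
have E w : w \in ws -> axis_poly al 1 k l (x *m crod e3 w *m g) (y *m crod e3 w *m g) -
   axis_poly al 1 k l (x *m crod e3 w) (y *m crod e3 w) =
   al * complex.Re ((- v) ^+ k * (wave k x y)^*%C * (w ^+ k)^*%C +
                    (- v) ^+ l * (wave l x y)^*%C * (w ^+ l)^*%C -
                    (wave k x y * w ^+ k + wave l x y * w ^+ l)) - 2 * twist x y.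
  move=> wws; have Uw := wsU w wws.
  have rf : e3 *m crod e3 w = e3 by rewrite fix_rod // e3_unit.
  have HS : SO3 (crod e3 w) by apply: crod_SO3 => //; rewrite e3_unit.
  rewrite /axis_poly !(wave_flip _ _ _ F) // !wave_rot !(twist_antifix _ _ Hg ge) !twist_fix //.
  rewrite !(proj2 (F _)) -[(- _) ^+ p * _]exprMn mulrNN exprMn !conj_mul.
  case: ((- v) ^+ k) => ? ?; case: ((- v) ^+ l) => ? ?; case: (w ^+ k) => ? ?.
  case: (w ^+ l) => ? ?; case: (wave k x y) => ? ?; case: (wave l x y) => ? ? /=; ring.
rewrite big_seq (eq_bigr _ E) -big_seq big_split /= -big_distrr /= -raddf_sum.
rewrite sumrB !big_split /= -!big_distrr /=.
have cs n : \sum_(w <- ws) (w ^+ n)^*%C = (\sum_(w <- ws) w ^+ n)^*%C.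
  by rewrite -[RHS]/((conjc \o id) _) [RHS]raddf_sum.
rewrite !cs big_const_seq count_predT iter_addr addr0 /twist.
have -> : dot e3 (cross x y) = 1 by rewrite !coordE; ring.
have -> : x 0 i2 ^+ 2 * dot y y - y 0 i2 ^+ 2 * dot x x = 2 by rewrite !coordE; ring.
have -> : dot x y = 1 by rewrite !coordE; ring.
rewrite expr1n.
case: wsK => [->|[-> ->]].
  by rewrite mul0r add0r => /eqP; rewrite mulrn_eq0 eqn0Ngt ws0 /= => /eqP; lra.
rewrite conjc0 !mulr0 !addr0 subrr /= mulr0 add0r => /eqP.
by rewrite mulrn_eq0 eqn0Ngt ws0 /= => /eqP; lra.
Qed.

End AxisPolynomials.
End Realizable.

(** * Groups preserving a line *)

Section AxialGroups.
Context (R : realType) (p : nat) (p3 : (3 <= p)%N).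
Implicit Types (u v x y : 'rV[R]_3) (g h : 'M[R]_3) (z w : R[i]) (G : 'M[R]_3 -> Prop).

Lemma exists_cunit_root n w : (0 < n)%N -> cunit w -> exists2 z, cunit z & z ^+ n = w.
Proof.
move=> n0 Hw; exists (n.-root w); last exact: rootCK.
have := sqnX (n.-root w) n; rewrite rootCK // => E.
have /eqP : sqn (n.-root w) ^+ n = 1 by rewrite -E.
by rewrite pexpr_eq1 // ?addr_ge0 ?sqr_ge0 // => /eqP.
Qed.

Lemma cunitN z : cunit z -> cunit (- z).
Proof. by case: z => a b; rewrite /cunit /= !sqrrN. Qed.

Lemma cunitC z : cunit z -> cunit z^*%C.
Proof. by case: z => a b; rewrite /cunit /= !sqrrN. Qed.

Lemma fix_crod_e3 z : e3 *m crod e3 z = e3 :> 'rV[R]_3.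
Proof. by rewrite fix_rod // e3_unit. Qed.

Lemma realizable_fix_e3 G : axial (p + p) G -> (forall g, G g -> e3 *m g = e3) ->
  realizable p G.
Proof.
move=> HG Ge; have [d dN Hd] := axial_axis HG (e3_unit R).
suff [al [k [l [ws [[al0 Hk Hl] [[ws0 wsU wsK] H]]]]]] : exists al k l (ws : seq R[i]),
    [/\ 0 <= al <= 1, (2 <= k <= p + p)%N & (2 <= l <= p + p)%N] /\
    [/\ [/\ (0 < size ws)%N, (forall w, w \in ws -> cunit w) &
      al = 0 \/ (\sum_(w <- ws) w ^+ k = 0 /\ \sum_(w <- ws) w ^+ l = 0)] &
     forall z, cunit z -> (z ^+ d = 1 <-> preserves (axis_poly p al 1 k l) (crod e3 z))].
  have /andP [k2 kp] := Hk; have /andP [l2 lp] := Hl.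
  apply: (@realizable_id _ _ _ (axis_poly p al 1 k l)).
  - exact: bihom_axis_poly.
  - exact: axis_polyC.
  move=> g Hg; split=> [Gg|Pg].
    have [z Hz E] := SO3_fix_crod Hg (e3_unit R) (Ge g Gg).
    by rewrite E -H // -Hd // -E.
  have [ge|ge] := preserves_axis p3 al0 Hk Hl Hg Pg.
    have [z Hz E] := SO3_fix_crod Hg (e3_unit R) ge.
    by rewrite E Hd // H // -E.
  by case: (flip_not_preserves p3 kp lp Hg ge ws0 wsU wsK Pg).
have [d0|dn0] := eqVneq d 0%N.
  exists 0, 2%N, 2%N, [:: 1]; split.
    by split; rewrite ?lexx ?ler01 //; lia.
  split; first by split=> //; [move=> w; rewrite inE => /eqP ->; exact: cunit1 | left].
  by move=> z Hz; rewrite d0 expr0; split=> // _; apply: preserves_rot0.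
have [d1|dn1] := eqVneq d 1%N.
  exists 1, 2%N, 3%N, [:: 1; 'i%C; -1; -'i%C]; split.
    by split; rewrite ?lexx ?ler01 //; lia.
  split.
    split=> //.
      by move=> w; rewrite !inE => /or4P [] /eqP ->; rewrite /cunit /=; ring.
    right; have i2 : 'i%C * 'i%C = -1 :> R[i] by rewrite -expr2 sqr_i.
    rewrite !big_cons !big_nil; split; last by ring.
    by rewrite !sqrrN !expr1n !expr2 i2 ; ring.
  move=> z Hz; rewrite preserves_rot ?oner_eq0 //; [|lia|lia].
  rewrite d1 expr1; split=> [->|[z2 z3]]; first by rewrite !expr1n.
  by rewrite exprS z2 mulr1 in z3.
have d2 : (2 <= d)%N by case: (d) dn0 dn1 => [|[]].
(* The rotations 1 and [z0] multiply a wave of weight [d] by 1 and -1, so their average removes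
   it. *)
have [|z0 Hz0 z0d] := @exists_cunit_root d (-1) _ (cunitN (cunit1 R)); first by lia.
exists 1, d, d, [:: 1; z0]; split.
  by split; rewrite ?lexx ?ler01 //; lia.
split.
  split=> //.
    by move=> w; rewrite !inE => /orP [] /eqP -> //; exact: cunit1.
  by right; rewrite !big_cons !big_nil z0d expr1n addr0 subrr.
by move=> z Hz; rewrite preserves_rot ?oner_eq0 //; split=> [|[]].
Qed.

Lemma flips_rot g w : SO3 g -> e3 *m g = - e3 -> flips g w -> forall f,
  SO3 f -> e3 *m f = - e3 -> flips f (-1) -> g *m f = crod e3 (- w)^*%C.
Proof.
move=> Hg ge Fg f Hf fe Ff.
have ke : e3 *m (g *m f) = e3 by rewrite mulmxA ge mulNmx fe opprK.
have [z Hz E] := SO3_fix_crod (SO3M Hg Hf) (e3_unit R) ke.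
have Z : zc (vec 1 0 0 *m (g *m f)) = (- w)^*%C.
  rewrite mulmxA (proj1 (Ff _)) (proj1 (Fg _)).
  have -> : zc (vec 1 0 0) = 1 :> R[i] by rewrite /zc !vecE.
  by rewrite conjc1 mulr1 mulN1r; case: (w).
rewrite E -Z E zc_rot.
by have -> : zc (vec 1 0 0) = 1 :> R[i]; [rewrite /zc !vecE | rewrite mulr1].
Qed.

(** Multiplication by the element [f] of [G] carries the rotations reversing [e3] to rotations about
    [e3], where membership in [G] is governed by [d]. *)
Lemma axial_flips G d f : axial (p + p) G ->
  (forall z, cunit z -> (G (crod e3 z) <-> z ^+ d = 1)) ->
  G f -> e3 *m f = - e3 -> flips f (-1) ->
  forall g w, SO3 g -> e3 *m g = - e3 -> cunit w -> flips g w -> (G g <-> (- w) ^+ d = 1).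
Proof.
move=> HG Hd Gf fe Ff g w Hg ge Hw Fg; have Hf := axial_SO3 HG Gf.
have E := flips_rot Hg ge Fg Hf fe Ff.
have -> : G g <-> G (g *m f).
  split=> [Gg|Ggf]; first exact: axial_mul HG _ _ Gg Gf.
  have -> : g = g *m f *m f^T by rewrite mulKSO3.
  by apply: (axial_mul HG) => //; apply: (axial_tr HG).
rewrite E Hd; last by apply/cunitC/cunitN.
rewrite -conj_exp; split=> H; last by rewrite H; exact: conjc1.
by have := congr1 (@conjc R) H; rewrite conjcK conjc1.
Qed.

Lemma realizable_flip G f : axial (p + p) G ->
  (forall g, G g -> e3 *m g = e3 \/ e3 *m g = - e3) ->
  G f -> e3 *m f = - e3 -> flips f (-1) -> realizable p G.
Proof.
move=> HG Ge Gf fe Ff; have [d dN Hd] := axial_axis HG (e3_unit R).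
have HF := axial_flips HG Hd Gf fe Ff.
(* Here [G] consists of the identity and one half-turn, whose axis is [e2]. Again weight 1 is
   missing, so [e2] is moved to [e3]: this axis is fixed pointwise by all of [G]. *)
have [d1|dn1] := eqVneq d 1%N.
  pose e2 : 'rV[R]_3 := vec 0 1 0.
  have e2u : dot e2 e2 = 1 by rewrite !coordE; ring.
  have [h Hh he] := exists_frame_e3 e2u.
  apply: (realizable_conj Hh); apply: realizable_fix_e3; first exact: axial_conj.
  move=> g; set k := _ *m h => Gk; have Hk := axial_SO3 HG Gk.
  have E : g = h *m k *m h^T by rewrite /k !mulmxA SO3_trK // mul1mx mulKSO3.
  clearbody k; suff ke : e2 *m k = e2.
    by rewrite E !mulmxA he ke -he mulKSO3.
  have [ke|ke] := Ge k Gk.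
    have [z Hz Ek] := SO3_fix_crod Hk (e3_unit R) ke.
    move: Gk; rewrite Ek Hd // d1 expr1 => ->; by rewrite crod1 mulmx1.
  have [w Hw Fw] := SO3_antifix_flips Hk ke.
  move: Gk; rewrite (HF _ w) // d1 expr1 => w1.
  have {w1}w1 : w = -1 by rewrite -w1 opprK.
  have [Z I] := Fw e2; move: Z; rewrite w1 /zc !vecE => /eqP; rewrite eq_complex /=.
  move=> /andP [/eqP Z0 /eqP Z1]; apply: vec_ext; rewrite ?Z0 ?Z1 ?I !vecE; ring.
suff [al [k [al0 Hk [HR HP]]]] : exists al k, [/\ 0 <= al <= 1, (2 <= k <= p + p)%N &
    (forall z, cunit z -> (z ^+ d = 1 <-> preserves (axis_poly p al 0 k k) (crod e3 z))) /\
    (forall g w, SO3 g -> e3 *m g = - e3 -> cunit w -> flips g w ->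
      ((- w) ^+ d = 1 <-> preserves (axis_poly p al 0 k k) g))].
  have /andP [k2 kp] := Hk.
  apply: (@realizable_id _ _ _ (axis_poly p al 0 k k)).
  - exact: bihom_axis_poly.
  - exact: axis_polyC.
  move=> g Hg.
  have main : e3 *m g = e3 \/ e3 *m g = - e3 -> (G g <-> preserves (axis_poly p al 0 k k) g).
    case=> ge.
      have [z Hz ->] := SO3_fix_crod Hg (e3_unit R) ge.
      exact: iff_trans (Hd z Hz) (HR z Hz).
    have [w Hw Fw] := SO3_antifix_flips Hg ge.
    exact: iff_trans (HF g w Hg ge Hw Fw) (HP g w Hg ge Hw Fw).
  split=> H; first by apply/main => //; apply: Ge.
  by apply/main => //; apply: (preserves_axis p3 al0 Hk Hk Hg H).
have [d0|dn0] := eqVneq d 0%N.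
  exists 0, 2%N; split; rewrite ?lexx ?ler01 //; first by lia.
  split=> [z Hz|g w Hg ge Hw Fg]; rewrite d0 expr0; split=> // _.
    exact: preserves_rot0.
  exact: preserves_flip0.
have d2 : (2 <= d)%N by case: (d) dn0 dn1 => [|[]].
exists 1, d; split; rewrite ?lexx ?ler01 //; first by lia.
split=> [z Hz|g w Hg ge Hw Fg].
  by rewrite preserves_rot ?oner_eq0 //; split=> [|[]].
by rewrite (preserves_flip p3 _ _ Hg ge Hw Fg) //; split=> [|[]].
Qed.

Lemma realizable_e3 G : axial (p + p) G ->
  (forall g, G g -> e3 *m g = e3 \/ e3 *m g = - e3) -> realizable p G.
Proof.
move=> HG Ge; case: (pselect (exists2 f, G f & e3 *m f = - e3)) => [[f Gf fe]|N]; last first.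
  apply: realizable_fix_e3 => // g Gg; case: (Ge g Gg) => // ge.
  by case: N; exists g.
have Hf := axial_SO3 HG Gf; have [w Hw Ff] := SO3_antifix_flips Hf fe.
(* Conjugation by the rotation [v] about [e3] changes the parameter of a half-turn by a factor v^2
   or its inverse; a square root of [- w] brings it to -1. *)
have [v Hv v2] := @exists_cunit_root 2 (- w) isT (cunitN Hw).
pose h : 'M[R]_3 := crod e3 v; have Hh : SO3 h by apply: crod_SO3 => //; exact: e3_unit.
have he : e3 *m h = e3 by exact: fix_crod_e3.
have heT : e3 *m h^T = e3 by rewrite -[in LHS]he mulKSO3.
have hT : h^T = crod e3 v^*%C by rewrite /h /crod trmx_rod; case: (v).
apply: (realizable_conj Hh); apply: (@realizable_flip _ (h *m f *m h^T)).
- exact: axial_conj.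
- move=> g; set k := _ *m h => Gk.
  have E : g = h *m k *m h^T by rewrite /k !mulmxA SO3_trK // mul1mx mulKSO3.
  clearbody k; rewrite E !mulmxA he; case: (Ge k Gk) => ->; [left | right] => //.
  by rewrite mulNmx heT.
- by rewrite !mulmxA SO3_trKl // mul1mx mulVKSO3.
- by rewrite !mulmxA he fe mulNmx heT.
move=> x; rewrite !mulmxA hT zc_rot i2_rot !(proj1 (Ff _), proj2 (Ff _)) zc_rot i2_rot.
split=> //; rewrite conj_mul.
have -> : v^*%C * (w * (v^*%C * (zc x)^*%C)) = - ((- w) * (v ^+ 2)^*%C) * (zc x)^*%C.
  by rewrite conj_exp; ring.
by rewrite v2 cunit_conj //; apply: cunitN.
Qed.

Lemma realizable_axis G u : axial (p + p) G -> dot u u = 1 ->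
  (forall g, G g -> u *m g = u \/ u *m g = - u) -> realizable p G.
Proof.
move=> HG Hu Gu; have [h Hh he] := exists_frame_e3 Hu.
apply: (realizable_conj Hh); apply: realizable_e3; first exact: axial_conj.
move=> g; set k := _ *m h => Gk.
have E : g = h *m k *m h^T by rewrite /k !mulmxA SO3_trK // mul1mx mulKSO3.
clearbody k; rewrite E !mulmxA he; case: (Gu k Gk) => ->; [left | right].
  by rewrite -he mulKSO3.
by rewrite mulNmx -he mulKSO3.
Qed.

End AxialGroups.

(** * Groups with a continuous axis *)

Section FullAxes.
Context (R : realType) (N : nat) (G : 'M[R]_3 -> Prop) (HG : axial N G).
Implicit Types (u v w x y : 'rV[R]_3) (g h : 'M[R]_3) (z : R[i]).

Definition full_axis u : Prop := dot u u = 1 /\ forall z, cunit z -> G (crod u z).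

Lemma crod_conj u z h : SO3 h -> h^T *m crod u z *m h = crod (u *m h) z.
Proof. exact: rod_conj. Qed.

Lemma crodN u z : crod (- u) z = crod u z^*%C.
Proof. by rewrite /crod rodN; case: z. Qed.

Lemma trmx_crod u z : (crod u z)^T = crod u z^*%C.
Proof. by rewrite /crod trmx_rod; case: z. Qed.

Lemma axial_crod_mx u z g : G g -> G (crod u z) -> G (crod (u *m g) z).
Proof.
move=> Gg Gu; rewrite -crod_conj; last exact: (axial_SO3 HG).
by apply: (axial_mul HG) => //; apply: (axial_mul HG) => //; apply: (axial_tr HG).
Qed.

Lemma axial_crodN u z : G (crod u z) -> G (crod (- u) z).
Proof. by move=> Gu; rewrite crodN -trmx_crod; apply: (axial_tr HG). Qed.

Lemma full_axis_mx u g : full_axis u -> G g -> full_axis (u *m g).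
Proof.
move=> [Hu Fu] Gg; split; first by rewrite dot_SO3 //; exact: (axial_SO3 HG).
by move=> z Hz; apply: axial_crod_mx => //; apply: Fu.
Qed.

Lemma full_axisN u : full_axis u -> full_axis (- u).
Proof.
move=> [Hu Fu]; split; first by rewrite dotNl dotNr opprK.
by move=> z Hz; apply: axial_crodN; apply: Fu.
Qed.

Lemma unit_sq_dot u v : dot u u = 1 -> dot v v = 1 -> dot u v ^+ 2 = 1 -> v = u \/ v = - u.
Proof.
move=> Hu Hv /eqP; rewrite sqrf_eq1 => /orP [] /eqP E.
  by left; apply: unit_eq => //; rewrite dotC.
by right; apply: unit_eqN => //; rewrite dotC.
Qed.

Lemma exists_rotation u x y : dot u u = 1 -> dot x x = 1 -> dot y y = 1 ->
  dot u x = dot u y -> exists2 z, cunit z & x *m crod u z = y.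
Proof.
move=> Hu Hx Hy E; have [s1|s1] := eqVneq (dot u x ^+ 2) 1.
  exists 1; first exact: cunit1.
  rewrite crod1 mulmx1; apply: unit_eq => //.
  have s2 : dot u y ^+ 2 = 1 by rewrite -E.
  have N1 : (1 == -1 :> R) = false by apply/negbTE; rewrite -addr_eq0; lra.
  move: E; case: (unit_sq_dot Hu Hx s1) => ->; case: (unit_sq_dot Hu Hy s2) => ->;
    by rewrite ?dotNl ?dotNr ?Hu ?opprK // => /eqP; rewrite 1?eq_sym ?N1 // eq_sym N1.
have [h Hh [h1 h2]] := transport_pair Hu Hx Hu Hy E s1.
by have [z Hz E'] := SO3_fix_crod Hh Hu h1; exists z => //; rewrite -E'.
Qed.

(** Rotating [v] about [u] reaches any unit x with x.u = v.u, and rotating [u] about such an x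
    reaches any unit w with x.w = x.u. So a unit x with x.u = x.w = s suffices: a multiple of u + w
    plus [l] times the normal to both, where the equation for [l] is solvable because the angle from
    u to w is at most twice that from u to v. *)
Lemma full_axis_cone u v w : full_axis u -> full_axis v -> dot w w = 1 ->
  2 * dot u v ^+ 2 - 1 <= dot u w -> full_axis w.
Proof.
move=> Fu Fv Hw le; have [Hu _] := Fu; have [Hv _] := Fv.
set s := dot u v in le; pose t := dot u w.
have [t1|tn1] := eqVneq (t ^+ 2) 1.
  by case: (unit_sq_dot Hu Hw t1) => -> //; apply: full_axisN.
have t2 : t ^+ 2 < 1 by rewrite lt_neqAle tn1 cauchy_schwarz.
have tb : 0 < 1 + t by rewrite expr2 in t2; nra.
have tb' : 1 + t != 0 by rewrite lt0r_neq0.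
have D0 : 1 - t ^+ 2 != 0 by rewrite subr_eq0 eq_sym.
pose l := Num.sqrt ((1 - 2 * s ^+ 2 / (1 + t)) / (1 - t ^+ 2)).
have l2 : l ^+ 2 = (1 - 2 * s ^+ 2 / (1 + t)) / (1 - t ^+ 2).
  rewrite sqr_sqrtr // divr_ge0 // subr_ge0 ?(ltW t2) //.
  by rewrite ler_pdivrMr // mul1r; rewrite -/t in le; lra.
pose x := (s / (1 + t)) *: (u + w) + l *: cross u w.
have uc : dot u (cross u w) = 0 by rewrite !coordE; ring.
have wc : dot w (cross u w) = 0 by rewrite !coordE; ring.
have cc : dot (cross u w) (cross u w) = 1 - t ^+ 2 by rewrite cross_sq Hu Hw mulr1.
have ux : dot u x = s by rewrite /x dotDr !dotZr dotDr uc Hu -/t; field.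
have wx : dot w x = s by rewrite /x dotDr !dotZr dotDr wc Hw (dotC w u) -/t; field.
have Hx : dot x x = 1.
  rewrite {1}/x dotDl !dotZl dotDl ux wx dotC /x dotDl !dotZl dotDl uc wc cc.
  rewrite addr0 mulr0 add0r mulrA -expr2 l2; field.
  by rewrite D0.
have [z Hz vz] : exists2 z, cunit z & v *m crod u z = x by apply: exists_rotation; rewrite ?ux.
have Fx : full_axis x by rewrite -vz; apply: full_axis_mx => //; apply: (proj2 Fu).
have [z' Hz' uz] : exists2 z, cunit z & u *m crod x z = w.
  by apply: exists_rotation; rewrite // dotC ux dotC wx.
by rewrite -uz; apply: full_axis_mx => //; apply: (proj2 Fx).
Qed.

(** Reflecting [u] in the line of [v] gives a full axis at twice the angle, and 1 - cos at least
    doubles. Once the double angle is obtuse or right, the cone around [u] contains a hemisphere,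
    and opposite vectors cover the rest. *)
Lemma full_axis_doubling n u v : full_axis u -> full_axis v -> 0 <= dot u v ->
  1 <= (2 ^ n)%:R * (1 - dot u v) -> forall w, dot w w = 1 -> full_axis w.
Proof.
elim: n u v => [|n IH] u v Fu Fv s0 le w Hw; have [Hu _] := Fu; have [Hv _] := Fv;
  have [s'|s'] := lerP (2 * dot u v ^+ 2 - 1) 0.
- have [t0|t0] := lerP 0 (dot u w); first by apply: (full_axis_cone Fu Fv) => //; lra.
  rewrite -(opprK w); apply: full_axisN; apply: (full_axis_cone Fu Fv).
    by rewrite dotNl dotNr opprK.
  by rewrite dotNr; lra.
- by move: le s'; rewrite expn0 mul1r expr2 => le s'; nra.
- have [t0|t0] := lerP 0 (dot u w); first by apply: (full_axis_cone Fu Fv) => //; lra.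
  rewrite -(opprK w); apply: full_axisN; apply: (full_axis_cone Fu Fv).
    by rewrite dotNl dotNr opprK.
  by rewrite dotNr; lra.
pose x := (2 * dot u v) *: v - u.
have ux : dot u x = 2 * dot u v ^+ 2 - 1 by rewrite /x dotDr dotZr dotNr Hu expr2; ring.
have Hx : dot x x = 1.
  by rewrite /x !dotDl !dotDr !dotNl !dotNr !dotZl !dotZr (dotC v u) Hu Hv; ring.
apply: (IH u x) => //.
- by apply: (full_axis_cone Fu Fv); rewrite ?ux.
- by rewrite ux ltW.
have H : 0 <= (1 - dot u v) * dot u v.
  by rewrite mulr_ge0 // subr_ge0; have := cauchy_schwarz Hu Hv; rewrite expr2; nra.
have K : 0 <= (2 ^ n)%:R * ((1 - dot u x) - 2 * (1 - dot u v)).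
  by rewrite mulr_ge0 // ux expr2; lra.
apply: le_trans le _; rewrite expnS natrM; lra.
Qed.

Lemma two_full_axes u v : full_axis u -> full_axis v -> v <> u -> v <> - u ->
  forall g, SO3 g -> G g.
Proof.
move=> Fu Fv n1 n2.
suff H : forall w, dot w w = 1 -> full_axis w.
  by move=> g /SO3_crod [w [Hw [z Hz ->]]]; apply: (proj2 (H w Hw)).
wlog s0 : v Fv n1 n2 / 0 <= dot u v.
  move=> H; have [s0|s0] := lerP 0 (dot u v); first exact: (H v).
  apply: (H (- v)); [exact: full_axisN| | |by rewrite dotNr; lra].
    by move=> E; apply: n2; rewrite -E opprK.
  by move=> E; apply: n1; rewrite -[v]opprK E opprK.
have [Hu _] := Fu; have [Hv _] := Fv.
have s1 : dot u v < 1.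
  rewrite lt_neqAle; apply/andP; split.
    by apply/eqP => E; apply: n1; apply: unit_eq => //; rewrite dotC.
  by have := cauchy_schwarz Hu Hv; rewrite expr2; nra.
have e0 : 0 < 1 - dot u v by rewrite subr_gt0.
pose n := Num.bound (1 - dot u v)^-1.
apply: (@full_axis_doubling n u v) => //.
have : (1 - dot u v)^-1 <= (2 ^ n)%:R.
  apply: le_trans (_ : n%:R <= _); last by rewrite ler_nat ltnW // ltn_expl.
  by apply/ltW/archi_boundP; rewrite invr_ge0 ltW.
by rewrite -ler_pdivrMr // mul1r.
Qed.

End FullAxes.

(** * Maxima and finitely many roots of unity *)

Section FiniteAxes.
Context (R : realType).
Implicit Types (z : R[i]).

Lemma exists_max_in_seq (Q : R -> Prop) (l : seq R) :
  (exists r, Q r) -> (forall r, Q r -> r \in l) ->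
  exists2 m, Q m & forall r, Q r -> r <= m.
Proof.
elim: l Q => [|a l IH] Q [r0 Qr0] Ql; first by have := Ql _ Qr0.
case: (pselect (exists r, Q r /\ r \in l)) => [[r [Qr rl]]|Nr].
  have [||m [Qm ml] Hm] := IH (fun r => Q r /\ r \in l); [by exists r | by move=> ? []|].
  case: (pselect (Q a /\ m < a)) => [[Qa ma]|Na].
    exists a => // t Qt; have := Ql _ Qt; rewrite inE => /orP [/eqP -> //|tl].
    by apply: le_trans (ltW ma); exact: (Hm t (conj Qt tl)).
  exists m => // t Qt; have := Ql _ Qt; rewrite inE => /orP [/eqP E|tl]; last exact: (Hm t (conj Qt tl)).
  by rewrite leNgt E; apply/negP => ma; apply: Na; split=> //; rewrite -E.
have E t : Q t -> t = a.
  move=> Qt; have := Ql _ Qt; rewrite inE => /orP [/eqP //|tl].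
  by case: Nr; exists t.
by exists r0 => // r Qr; rewrite (E r) // (E r0).
Qed.

Lemma unity_roots_finite n : (0 < n)%N ->
  exists l : seq R[i], forall z, z ^+ n = 1 -> z \in l.
Proof.
move=> n0; have [l E] := closed_field_poly_normal ('X^n - 1 : {poly R[i]}).
exists l => z zn; rewrite -root_prod_XsubC.
have : root ('X^n - 1 : {poly R[i]}) z by rewrite rootE !hornerE zn subrr.
by rewrite E rootZ // lead_coef_eq0 -size_poly_eq0 -[1]/(1%:P) size_XnsubC.
Qed.

End FiniteAxes.

(** * Finite groups without invariant line *)

Section IrreducibleGroups.
Context (R : realType) (N : nat) (G : 'M[R]_3 -> Prop) (HG : axial N G).
Implicit Types (u v w x y : 'rV[R]_3) (g h : 'M[R]_3) (z : R[i]).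

Hypothesis Gfin : forall u, ~ full_axis G u.
Hypothesis Girr : forall u, dot u u = 1 ->
  exists2 g, G g & u *m g <> u /\ u *m g <> - u.

Lemma axis_order u : dot u u = 1 ->
  exists2 d, (0 < d <= N)%N & forall z, cunit z -> (G (crod u z) <-> z ^+ d = 1).
Proof.
move=> Hu; have [d dN Hd] := axial_axis HG Hu; exists d => //; rewrite dN andbT lt0n.
by apply/eqP => d0; apply: (Gfin (u := u)); split => // z Hz; rewrite Hd // d0.
Qed.

(** Every order is at most [N] and divides N!, so one list of roots of unity serves all axes at
    once, however many there are. *)
Lemma axis_angles_finite : exists l : seq R[i],
  forall u z, dot u u = 1 -> cunit z -> G (crod u z) -> z \in l.
Proof.
have [l Hl] := unity_roots_finite R (fact_gt0 N); exists l => u z Hu Hz Gz.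
have [d /andP [d0 dN] Hd] := axis_order Hu; apply: Hl.
by apply: (expr_dvd (proj1 (Hd z Hz) Gz)); apply: dvdn_fact; rewrite d0.
Qed.

Definition top_angle z : Prop := [/\ cunit z, z != 1,
  exists2 u, dot u u = 1 & G (crod u z) &
  forall v (w : R[i]), dot v v = 1 -> cunit w -> G (crod v w) -> w != 1 ->
    complex.Re w <= complex.Re z].

Lemma exists_top_angle : exists z, top_angle z.
Proof.
have [l Hl] := axis_angles_finite.
pose Q r := exists u z, [/\ dot u u = 1, cunit z, G (crod u z), z != 1 & r = complex.Re z].
have [||m [u [z [Hu Hz Gz z1 mE]]] Hm] :=
    @exists_max_in_seq R Q [seq complex.Re z | z <- l].
- have [g Gg [g1 _]] := Girr (e3_unit R).
  have [u [Hu [z Hz E]]] := SO3_crod (axial_SO3 HG Gg).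
  exists (complex.Re z), u, z; split=> //; first by rewrite -E.
  by apply/eqP => zE; apply: g1; rewrite E zE crod1 mulmx1.
- by move=> r [u [z [Hu Hz Gz _ ->]]]; apply: map_f; apply: (Hl u z).
exists z; split=> //; first by exists u.
by move=> v w Hv Hw Gw w1; rewrite -mE; apply: Hm; exists v, w.
Qed.

(** * The largest cosine and the angles between its axes *)

Section TopAngle.
Context (z : R[i]) (Hz : top_angle z).
Let c := complex.Re z.

Definition top_axis u : Prop := dot u u = 1 /\ G (crod u z).

Lemma top_cunit : cunit z. Proof. by case: Hz. Qed.

Lemma top_axis_mx u g : top_axis u -> G g -> top_axis (u *m g).
Proof.
move=> [Hu Gu] Gg; split; first by rewrite dot_SO3 //; exact: (axial_SO3 HG).
exact: (axial_crod_mx HG Gg Gu).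
Qed.

Lemma top_axisN u : top_axis u -> top_axis (- u).
Proof.
move=> [Hu Gu]; split; first by rewrite dotNl dotNr opprK.
exact: (axial_crodN HG Gu).
Qed.

Lemma top_lt1 : c < 1.
Proof.
have := Re_cunit_le top_cunit; rewrite -/c => le; rewrite lt_neqAle le andbT; apply/eqP => c1.
by case: Hz => Hu /eqP n1 _ _; apply: n1; apply: Re_cunit_eq1.
Qed.

(** The product of the rotations by [z] about [u] and [v] is again in [G]; its trace is computed by
    [tr_rod_mul]. Finitely many angles [y] thus leave finitely many values of [dot u v]. *)
Lemma top_pair u v : top_axis u -> top_axis v -> exists w (y : R[i]),
  [/\ dot w w = 1, cunit y, G (crod w y) &
   ((1 + c) - dot u v * (1 - c)) ^+ 2 = 2 + 2 * complex.Re y].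
Proof.
move=> [Hu Gu] [Hv Gv]; have Gg := axial_mul HG Gu Gv.
have [w [Hw [y Hy E]]] := SO3_crod (axial_SO3 HG Gg).
exists w, y; split=> //; first by rewrite -E.
rewrite -(tr_rod_mul (s := complex.Im z)) //; last exact: top_cunit.
have := tr_rod (complex.Re y) (complex.Im y) Hw.
by rewrite -/(crod w y) -E /crod -/c => ->; ring.
Qed.

Lemma exists_top_pair : exists u v, [/\ top_axis u, top_axis v & 0 <= dot u v < 1].
Proof.
have [Hz1 z1 [u Hu Gu] _] := Hz.
have [g Gg [g1 g2]] := Girr Hu.
have Xu : top_axis u by []. have Xv := top_axis_mx Xu Gg.
set v := u *m g in Xv g1 g2; have [Hv _] := Xv.
have [s0|s0] := lerP 0 (dot u v).
  exists u, v; split=> //; rewrite s0 /= lt_neqAle; apply/andP; split.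
    by apply/eqP => E; apply: g1; apply: unit_eq => //; rewrite dotC.
  by have := cauchy_schwarz Hu Hv; rewrite expr2; nra.
exists u, (- v); split=> //; first exact: top_axisN.
rewrite dotNr lt_neqAle; apply/andP; split; first by lra.
apply/andP; split; last by have := cauchy_schwarz Hu Hv; rewrite expr2; nra.
apply/eqP => E; apply: g2; apply: unit_eqN => //; rewrite dotC; lra.
Qed.

(* Rotating one of two closest top axes about the other would produce a closer
   one if the top angle were at most 60 degrees. *)
Lemma top_lt_half : c < 1 / 2.
Proof.
have [l Hl] := axis_angles_finite; have c1 := top_lt1.
pose Q (t : R) := 0 <= t < 1 /\ exists u v, [/\ top_axis u, top_axis v & t = dot u v].
(* The equation of [top_pair] solved for [dot u v], with [e] the sign of the square root. *)
pose f (e : R) (y : R[i]) : R := ((1 + c) - e * Num.sqrt (2 + 2 * complex.Re y)) / (1 - c).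
have [||t [t01 [u [v [Xu Xv tE]]]] Ht] :=
    @exists_max_in_seq R Q ([seq f 1 b | b <- l] ++ [seq f (-1) b | b <- l]).
- have [u [v [Xu Xv uv]]] := exists_top_pair.
  by exists (dot u v); split=> //; exists u, v.
- move=> r [r01 [u [v [Xu Xv rE]]]]; have [w [y [Hw Hy Gy E]]] := top_pair Xu Xv.
  have yl := Hl w y Hw Hy Gy.
  have q0 : 0 <= 2 + 2 * complex.Re y by rewrite -E sqr_ge0.
  have := sqr_sqrtr q0; rewrite -{2}E -rE => /eqP.
  have c0 : 1 - c != 0 by rewrite subr_eq0 eq_sym lt_eqF.
  rewrite eqf_sqr mem_cat => /orP [] /eqP E'; apply/orP; [left | right];
    apply/mapP; exists y => //; rewrite /f E'; field; exact: c0.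
have [Hu Gu] := Xu; have [Hv Gv] := Xv.
have Xw := top_axis_mx Xu Gv.
have uw : dot u (u *m crod v z) = t ^+ 2 + (1 - t ^+ 2) * c.
  rewrite /crod rodE !dotDr !dotZr Hu -tE.
  have -> : dot u (cross v u) = 0 by rewrite !coordE; ring.
  by rewrite -/c; ring.
have /andP [t0 t1] := t01.
have t2 : 0 < 1 - t ^+ 2 by rewrite expr2; nra.
set r := dot u _ in uw.
have r1 : r < 1 by rewrite uw; nra.
have rt : r <= t.
  have [r0|r0] := lerP 0 r; last by lra.
  by apply: Ht; split; [rewrite r0 | exists u, (u *m crod v z)].
(* The inequality t^2 + (1 - t^2) c <= t divided by 1 - t; with t < 1 it gives c <= t / (1 + t) <
   1/2. *)
have : (1 + t) * c <= t.
  have H : (1 - t) * ((1 + t) * c) <= (1 - t) * t by move: rt; rewrite uw expr2; lra.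
  by move: H; rewrite ler_pM2l // subr_gt0.
by move=> H; nra.
Qed.

(** The rotation by 2 pi / d cannot have a cosine above c. For d >= 6 this contradicts
    [top_lt_half]; for d = 4 and d = 5 it bounds c from below. *)
Lemma axis_order_bound u d : dot u u = 1 ->
  (forall w : R[i], cunit w -> (G (crod u w) <-> w ^+ d = 1)) -> (0 < d)%N ->
  [/\ (d <= 5)%N, d = 4%N -> 0 <= c &
      d = 5%N -> 0 < c /\ 0 <= 4 * c ^+ 2 + 2 * c - 1].
Proof.
move=> Hu Hd d0; have [_ _ _ top] := Hz; split.
- rewrite leqNgt; apply/negP => d6; have [w [Hw wd w1 w2]] := exists_small_root R d6.
  have := top u w Hu Hw (proj2 (Hd w Hw) wd) w1.
  by have := top_lt_half; rewrite /c; lra.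
- move=> d4; apply: (top u 'i%C) => //.
  + by rewrite /cunit /=; ring.
  + by apply/Hd; [rewrite /cunit /=; ring | rewrite d4 -[4%N]/(2 * 2)%N exprM sqr_i sqrrN expr1n].
  + by rewrite eq_complex /= eq_sym oner_eq0.
move=> d5; have [w [Hw w5 w1 [w0 wE]]] := exists_fifth_root R.
have := top u w Hu Hw; rewrite Hd // d5 => /(_ w5 w1); rewrite -/c => le.
by split; [lra | move: wE; rewrite !expr2; nra].
Qed.

Definition pair_law (s : R) : Prop :=
  forall u v, top_axis u -> top_axis v -> 0 <= dot u v -> dot u v = s \/ dot u v = 1.

(** The values 4, 0, 1, 2 of [q] belong to the identity and to rotations of order 2, 3, 4; the roots
    of the quadratic are those of order 5. *)
Lemma axis_angle_cases w (y : R[i]) (q := 2 + 2 * complex.Re y) :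
  dot w w = 1 -> cunit y -> G (crod w y) ->
  [\/ q = 4, q = 0, q = 1 | 0 <= c /\ q = 2 \/
    0 < c /\ 0 <= 4 * c ^+ 2 + 2 * c - 1 /\ q ^+ 2 - 3 * q + 1 = 0].
Proof.
move=> Hw Hy Gy; have [d /andP [d0 _] Hd] := axis_order Hw.
have [d5 d4c d5c] := axis_order_bound Hw Hd d0.
have yd : y ^+ d = 1 by rewrite -Hd.
case: d d0 d5 d4c d5c yd {Hd} => [//|[|[|[|[|[|//]]]]]] _ _ c4 c5.
- by rewrite expr1 => y1; apply: Or41; rewrite /q y1 /=; ring.
- by case/(Re_root2 Hy) => E; [apply: Or41 | apply: Or42].
- by case/(Re_root3 Hy) => E; [apply: Or41 | apply: Or43].
- case/(Re_root4 Hy) => E; [exact: Or41 | exact: Or42 |].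
  by apply: Or44; left; split=> //; apply: c4.
case/(Re_root5 Hy) => E; first exact: Or41.
have [c0 cE] := c5 erefl.
by apply: Or44; right; split=> //; split=> //; rewrite /q; lra.
Qed.

Lemma top_classification :
  [\/ c = - (1 / 2) /\ pair_law (1 / 3), c = 0 /\ pair_law 0 |
      [/\ 0 < c, 4 * c ^+ 2 + 2 * c - 1 = 0 & pair_law (c / (1 - c))]].
Proof.
have [Hz1 _ [u Hu Gu] top] := Hz; have c1 := top_lt1; have ch := top_lt_half.
have P (s : R) : (forall q t : R, 0 <= t <= 1 -> ((1 + c) - t * (1 - c)) ^+ 2 = q ->
     [\/ q = 4, q = 0, q = 1 | 0 <= c /\ q = 2 \/
    0 < c /\ 0 <= 4 * c ^+ 2 + 2 * c - 1 /\ q ^+ 2 - 3 * q + 1 = 0] ->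
     t = s \/ t = 1) -> pair_law s.
  move=> H x y Xx Xy s0; have [w [t [Hw Ht Gt E]]] := top_pair Xx Xy.
  apply: (H _ _ _ E); last exact: (axis_angle_cases Hw).
  rewrite s0 /=; have := cauchy_schwarz (proj1 Xx) (proj1 Xy); rewrite expr2; nra.
have sq0 (a b : R) : (a - b) * (a + b) = 0 -> a = b \/ a = - b.
  by move/eqP; rewrite mulf_eq0 => /orP [] /eqP h; [left | right]; lra.
have cases := axis_angle_cases Hu Hz1 Gu; rewrite -/c in cases.
(* Otherwise all nontrivial rotations are half-turns. The product of two of them is the identity or
   a half-turn, so their axes are equal or orthogonal, and the line of [u] would be preserved. *)
have cm1 : c <> -1.
  move=> cE; have [g Gg [g1 g2]] := Girr Hu.
  have [v [Hv [w Hw gE]]] := SO3_crod (axial_SO3 HG Gg).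
  have w1 : w != 1 by apply/eqP => wE; apply: g1; rewrite gE wE crod1 mulmx1.
  have Gv : G (crod v w) by rewrite -gE.
  have rw : complex.Re w = -1.
    have := top v w Hv Hw Gv w1; rewrite -/c cE; move: Hw; rewrite /cunit expr2.
    by have := sqr_ge0 (complex.Im w); nra.
  have iw : complex.Im w = 0.
    by move: Hw; rewrite /cunit rw => h; apply/eqP; rewrite -sqrf_eq0; apply/eqP; lra.
  have wz : w = z.
    move: Hz1 iw rw; rewrite /cunit; case: (w) => a b; case EZ: (z) => [a' b'] /= h -> ->.
    have a1 : a' = -1 by rewrite -cE /c EZ.
    by move: h; rewrite a1 => h; congr (_ +i* _)%C;
      apply/esym/eqP; rewrite -sqrf_eq0; apply/eqP; lra.
  have Xu : top_axis u by []. have Xv : top_axis v by rewrite wz in Gv; split.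
  have [x [y [Hx Hy Gy E]]] := top_pair Xu Xv.
  have [y1|y1] := eqVneq y 1; last first.
    have := top x y Hx Hy Gy y1; rewrite -/c => le; apply: g2.
    have D : dot u v = 0.
      apply/eqP; rewrite -sqrf_eq0; apply/eqP; have := sqr_ge0 (dot u v).
      by move: E; rewrite cE !expr2 => E; nra.
    rewrite gE /crod rw iw rodE D; apply: vec_ext; rewrite !coordE; ring.
  have D : dot u v ^+ 2 = 1 by move: E; rewrite y1 cE /= !expr2; lra.
  apply: g1; rewrite gE; case: (unit_sq_dot Hu Hv D) => ->; last rewrite crodN;
    by rewrite fix_rod.
case: cases => [q4|q0|q1|[[c0 q2]|[c0 [_ q5]]]]; [exfalso; lra | exfalso; apply: cm1; lra | | |].
- apply: Or31; have cE : c = - (1 / 2) by lra.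
  split=> //; apply: P => q t /andP [t0 t1] E; rewrite cE; case=> [h|h|h|[[]|[]]]; try lra;
  move: E; rewrite h cE => E.
  + by right; move: E; rewrite expr2; nra.
  + left; have /eqP : (1 + - (1 / 2) - t * (1 - - (1 / 2))) ^+ 2 = 0 by [].
    by rewrite sqrf_eq0 => /eqP; lra.
  have /sq0 : ((1 + - (1 / 2) - t * (1 - - (1 / 2))) - 1) *
     ((1 + - (1 / 2) - t * (1 - - (1 / 2))) + 1) = 0 by move: E; rewrite expr2; lra.
  by case=> ?; right; lra.
- apply: Or32; have cE : c = 0 by lra.
  split=> //; apply: P => q t /andP [t0 t1] E; rewrite cE; case=> [h|h|h|[[_ h]|[]]]; try lra;
  move: E; rewrite h cE => E.
  + by right; move: E; rewrite expr2; nra.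
  + right; have /eqP : (1 + 0 - t * (1 - 0)) ^+ 2 = 0 by [].
    by rewrite sqrf_eq0 => /eqP; lra.
  + have /sq0 : ((1 + 0 - t * (1 - 0)) - 1) * ((1 + 0 - t * (1 - 0)) + 1) = 0.
      by move: E; rewrite expr2; lra.
    by case=> ?; left; lra.
  by exfalso; move: E; rewrite expr2; nra.
apply: Or33; have cE : 4 * c ^+ 2 + 2 * c - 1 = 0 by move: q5; rewrite !expr2; lra.
(* Here c = (sqrt 5 - 1) / 4, about 0.309. The rational bounds confine [q] to an interval that
   excludes 0, 2, 4 and the larger root 3 - 4 c^2 of the quadratic. The value 1 gives t = c / (1 -
   c), and 4 c^2, the double rotation about one axis, gives t = 1. *)
have c3 : 3 / 10 < c by move: cE; rewrite expr2; nra.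
have c4 : c < 31 / 100 by move: cE; rewrite expr2; nra.
have nc : 1 - c != 0 by rewrite lt0r_neq0 // subr_gt0.
split=> //; apply: P => q t /andP [t0 t1] E.
pose e := 1 + c - t * (1 - c); rewrite -/e in E.
have e0 : 2 * c <= e by rewrite /e; nra.
have e1 : e <= 1 + c by rewrite /e; nra.
have qb : q <= 1716 / 1000 by rewrite -E expr2; nra.
have q0 : 36 / 100 <= q by rewrite -E expr2; nra.
case=> [h|h|h|[[_ h]|[_ [_ h]]]]; try lra.
  left; have e2 : e = 1 by move: E; rewrite h expr2; nra.
  by apply: (mulIf nc); rewrite divfK //; rewrite /e in e2; lra.
right; have : (q - 4 * c ^+ 2) * (q - (3 - 4 * c ^+ 2)) = 0.
  have c2 : 4 * c ^+ 2 = 1 - 2 * c by lra.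
  by rewrite c2; move: h cE; rewrite !expr2; lra.
move/eqP; rewrite mulf_eq0 => /orP [] /eqP h'; last by move: h'; rewrite expr2; nra.
have : (e - 2 * c) * (e + 2 * c) = 0 by move: h'; rewrite -E !expr2; lra.
move/sq0; case=> h2; last by lra.
by apply: (mulIf nc); rewrite mul1r; rewrite /e in h2; lra.
Qed.

End TopAngle.
End IrreducibleGroups.

(** * Cubic groups *)

Section CubicGroups.
Context (R : realType).
Implicit Types (u v w x y : 'rV[R]_3) (g h : 'M[R]_3) (z : R[i]).

Definition e1 : 'rV[R]_3 := vec 1 0 0.
Definition e2 : 'rV[R]_3 := vec 0 1 0.

Lemma e1_unit : dot e1 e1 = 1. Proof. by rewrite !coordE; ring. Qed.
Lemma e2_unit : dot e2 e2 = 1. Proof. by rewrite !coordE; ring. Qed.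

Lemma row_e g j : ((e1 *m g) 0 j = g i0 j) * ((e2 *m g) 0 j = g i1 j) * ((e3 *m g) 0 j = g i2 j).
Proof. by rewrite !coordE !mul1r !mul0r !addr0 !add0r. Qed.

Definition sign01 (a : R) : Prop := [\/ a = 0, a = 1 | a = -1].

Lemma sign01N a : sign01 a -> sign01 (- a).
Proof.
by case=> ->; [apply: Or31; rewrite oppr0 | apply: Or33 | apply: Or32; rewrite opprK].
Qed.

(** For a rotation this means a signed permutation matrix, because the rows are unit vectors. *)
Definition monomial g : Prop := forall i j, sign01 (g i j).

Lemma sign01_axis x : (forall j, sign01 (x 0 j)) -> dot x x = 1 ->
  [\/ x = e1 \/ x = - e1, x = e2 \/ x = - e2 | x = e3 \/ x = - e3].
Proof.
move=> H; rewrite dotE (vec_eta x) !vecE.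
by case: (H i0) (H i1) (H i2) => -> [] -> [] -> h;
 first [ by exfalso; lra | by apply: Or31; left | by apply: Or32; left | by apply: Or33; left
   | by apply: Or31; right; apply: vec_ext; rewrite !coordE ?oppr0
   | by apply: Or32; right; apply: vec_ext; rewrite !coordE ?oppr0
   | by apply: Or33; right; apply: vec_ext; rewrite !coordE ?oppr0].
Qed.

Lemma monomial_mul_tr g h : SO3 g -> monomial g -> monomial h -> monomial (g *m h^T).
Proof.
move=> Hg mg mh i j.
have E : (g *m h^T) i j = dot (row i g) (row j h).
  by rewrite mxE; apply: eq_bigr => k _; rewrite !mxE.
have d1 : dot e1 (row j h) = h j i0 by rewrite !coordE !mxE; ring.
have d2 : dot e2 (row j h) = h j i1 by rewrite !coordE !mxE; ring.
have d3 : dot e3 (row j h) = h j i2 by rewrite !coordE !mxE; ring.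
rewrite E; have [||[->|->]|[->|->]|[->|->]] := @sign01_axis (row i g).
- by move=> k; rewrite mxE; apply: mg.
- have <- : (g *m g^T) i i = 1 by rewrite SO3_trK // mxE eqxx.
  by rewrite mxE; apply: eq_bigr => k _; rewrite !mxE.
all: rewrite ?dotNl ?d1 ?d2 ?d3 //; first [exact: mh | apply: sign01N; exact: mh].
Qed.

Definition cyc : 'M[R]_3 := rows3 e2 e3 e1.
Definition flip1 : 'M[R]_3 := rows3 e1 (- e2) (- e3).
Definition flip2 : 'M[R]_3 := rows3 (- e1) e2 (- e3).
Definition flip3 : 'M[R]_3 := rows3 (- e1) (- e2) e3.

Lemma cycE x : x *m cyc = vec (x 0 i2) (x 0 i0) (x 0 i1).
Proof. by apply: vec_ext; rewrite !coordE; ring. Qed.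
Lemma flip1E x : x *m flip1 = vec (x 0 i0) (- x 0 i1) (- x 0 i2).
Proof. by apply: vec_ext; rewrite !coordE; ring. Qed.
Lemma flip2E x : x *m flip2 = vec (- x 0 i0) (x 0 i1) (- x 0 i2).
Proof. by apply: vec_ext; rewrite !coordE; ring. Qed.
Lemma flip3E x : x *m flip3 = vec (- x 0 i0) (- x 0 i1) (x 0 i2).
Proof. by apply: vec_ext; rewrite !coordE; ring. Qed.

Lemma monomial_rows3 x y w : (forall j, sign01 (x 0 j)) -> (forall j, sign01 (y 0 j)) ->
  (forall j, sign01 (w 0 j)) -> monomial (rows3 x y w).
Proof. by move=> Hx Hy Hz; apply: forall_ord3 => j; rewrite rows3E. Qed.

Lemma sign01_e : (forall j, sign01 (e1 0 j)) /\ (forall j, sign01 (e2 0 j)) /\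
  (forall j, sign01 (@e3 R 0 j)).
Proof.
by do !split; apply: forall_ord3; rewrite !vecE; by [apply: Or31 | apply: Or32].
Qed.

(** The elements [cyc], [flip1], [flip2] already take [e1] to all six signed coordinate vectors.
    After correction by such an element, [g] fixes [e1] and is still monomial, so it is a multiple
    of the quarter-turn. *)
Lemma monomial_decomp (K : 'M[R]_3 -> Prop) g :
  (forall h, K h -> SO3 h) -> K 1%:M -> (forall h k, K h -> K k -> K (h *m k)) ->
  K cyc -> K flip1 -> K flip2 -> SO3 g -> monomial g ->
  exists2 h, K h & exists2 y : R[i], [\/ y = 1, y = -1, y = 'i%C | y = - 'i%C] &
    g = crod e1 y *m h.
Proof.
move=> KS K1 KM Kc Kf1 Kf2 Hg mg; have [m1 [m2 m3]] := sign01_e.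
have mN x : (forall j, sign01 (x 0 j)) -> forall j, sign01 ((- x) 0 j).
  by move=> H j; rewrite voppE; apply: sign01N.
have Kcc : K (cyc *m cyc) by apply: KM.
have m0 : monomial 1%:M by move=> i j; rewrite mxE; case: eqP => _; [apply: Or32 | apply: Or31].
have mc : monomial cyc by apply: monomial_rows3.
have mcc : monomial (cyc *m cyc).
  have -> : cyc *m cyc = rows3 e3 e1 e2.
    by apply: mx_ext => x; rewrite mulmxA !cycE; apply: vec_ext; rewrite !coordE; ring.
  exact: monomial_rows3.
have mf2 : monomial flip2 by apply: monomial_rows3 => //; apply: mN.
have mcf : monomial (cyc *m flip1).
  have -> : cyc *m flip1 = rows3 (- e2) (- e3) e1.
    by apply: mx_ext => x; rewrite mulmxA !cycE flip1E; apply: vec_ext; rewrite !coordE; ring.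
  by apply: monomial_rows3 => //; apply: mN.
have mccf : monomial (cyc *m cyc *m flip1).
  have -> : cyc *m cyc *m flip1 = rows3 (- e3) e1 (- e2).
    by apply: mx_ext => x; rewrite !mulmxA !cycE flip1E; apply: vec_ext; rewrite !coordE; ring.
  by apply: monomial_rows3 => //; apply: mN.
have [h [Kh mh E]] : exists h, [/\ K h, monomial h & e1 *m h = e1 *m g].
  have [||[->|->]|[->|->]|[->|->]] := @sign01_axis (e1 *m g).
  - by move=> j; rewrite row_e; apply: mg.
  - by rewrite dot_SO3 // e1_unit.
  - by exists 1%:M; rewrite mulmx1.
  - by exists flip2; split => //; rewrite flip2E; apply: vec_ext; rewrite !coordE ?oppr0.
  - by exists cyc; split => //; rewrite cycE; apply: vec_ext; rewrite !coordE.
  - exists (cyc *m flip1); split => //; first exact: KM.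
    by rewrite mulmxA cycE flip1E; apply: vec_ext; rewrite !coordE ?oppr0.
  - exists (cyc *m cyc); split => //.
    by rewrite mulmxA !cycE; apply: vec_ext; rewrite !coordE ?oppr0.
  exists (cyc *m cyc *m flip1); split => //; first exact: KM.
  by rewrite !mulmxA !cycE flip1E; apply: vec_ext; rewrite !coordE ?oppr0.
have Hh := KS h Kh.
have fix1 : e1 *m (g *m h^T) = e1 by rewrite mulmxA -E mulKSO3.
have Hgh : SO3 (g *m h^T) by apply: SO3M => //; apply: SO3_tr.
have [y Hy Ey] := SO3_fix_crod Hgh e1_unit fix1.
have mgh := monomial_mul_tr Hg mg mh.
exists h => //; exists y; last by rewrite -Ey mulVKSO3.
have Ea : complex.Re y = (g *m h^T) i1 i1.
  by rewrite -(row_e _ i1) Ey /crod rodE !coordE; ring.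
have Eb : complex.Im y = (g *m h^T) i1 i2.
  by rewrite -(row_e _ i2) Ey /crod rodE !coordE; ring.
have := mgh i1 i1; have := mgh i1 i2; rewrite -Ea -Eb; move: Hy.
rewrite /cunit; case: y {Ey Ea Eb} => a b /= H [] ? [] ?; subst a b;
  try (by exfalso; clear -H; rewrite ?expr0n ?expr1n ?sqrrN ?expr1n /= in H; lra).
- by apply: Or41.
- by apply: Or42; apply/eqP; rewrite eq_complex /= oppr0 !eqxx.
- by apply: Or43.
by apply: Or44; apply/eqP; rewrite eq_complex /= oppr0 !eqxx.
Qed.

Section CubicPoly.
Context (p : nat) (p3 : (3 <= p)%N).

Definition vdm3 (a b d : R) : R := (a - b) * (b - d) * (d - a).

(** The octahedral form for [be = 0] and the tetrahedral one for [be = 1]. *)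
Definition cubic_poly (be : R) x y : R :=
  (x 0 i0 * y 0 i0) ^+ p + (x 0 i1 * y 0 i1) ^+ p + (x 0 i2 * y 0 i2) ^+ p +
  be * vdm3 (x 0 i0 * y 0 i0) (x 0 i1 * y 0 i1) (x 0 i2 * y 0 i2) * dot x y ^+ (p - 3).

Lemma cubic_polyC be x y : cubic_poly be x y = cubic_poly be y x.
Proof.
by rewrite /cubic_poly dotC (mulrC (x 0 i0)) (mulrC (x 0 i1)) (mulrC (x 0 i2)).
Qed.

Lemma bihom_cubic_poly be : bihom p p (cubic_poly be).
Proof.
have M j : bihom 1 1 (fun x y : 'rV[R]_3 => x 0 j * y 0 j).
  exact: bihomM (bihom_x R j) (bihom_y R j).
have MX j : bihom p p (fun x y : 'rV[R]_3 => (x 0 j * y 0 j) ^+ p).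
  by apply: bihom_cast (bihomX p (M j)) _ _; lia.
apply: bihomD; first by apply: bihomD => //; apply: bihomD.
have V : bihom 3 3 (fun x y : 'rV[R]_3 =>
    vdm3 (x 0 i0 * y 0 i0) (x 0 i1 * y 0 i1) (x 0 i2 * y 0 i2)).
  exact: (bihom_ext _ (bihomM (bihomM (bihomB (M i0) (M i1)) (bihomB (M i1) (M i2)))
    (bihomB (M i2) (M i0)))).
apply: bihom_cast (bihomM (bihomZ be V) (bihomX (p - 3) (bihom_dot R))) _ _; lia.
Qed.

(** Put Q = (a + b)(b + d)(d + a). The sum of cubes is 1 - 3 Q, it bounds the sum of p-th powers,
    and |vdm3| <= Q factor by factor. The total is at most 1 - 2 Q, so Q = 0. *)
Lemma cubic_simplex_max (be a b d : R) : 0 <= be <= 1 -> 0 <= a -> 0 <= b -> 0 <= d ->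
  a + b + d = 1 -> 1 <= a ^+ p + b ^+ p + d ^+ p + be * vdm3 a b d ->
  (a + b) * (b + d) * (d + a) = 0.
Proof.
move=> /andP [be0 be1] a0 b0 d0 s1 H.
have cube (t : R) : 0 <= t <= 1 -> t ^+ p <= t ^+ 3 by move=> /andP [? ?]; apply: ler_wiXn2l.
have Ha : a ^+ p <= a ^+ 3 by apply: cube; lra.
have Hb : b ^+ p <= b ^+ 3 by apply: cube; lra.
have Hd : d ^+ p <= d ^+ 3 by apply: cube; lra.
have E : a ^+ 3 + b ^+ 3 + d ^+ 3 = 1 - 3 * ((a + b) * (b + d) * (d + a)).
  transitivity ((a + b + d) ^+ 3 - 3 * ((a + b) * (b + d) * (d + a))); first by ring.
  by rewrite s1 expr1n.
have L (x y : R) : 0 <= x -> 0 <= y -> `|x - y| <= x + y.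
  by move=> x0 y0; rewrite ler_norml; apply/andP; split; lra.
have V : be * vdm3 a b d <= (a + b) * (b + d) * (d + a).
  apply: le_trans (ler_norm _) _; rewrite normrM -[leRHS]mul1r ger0_norm //.
  apply: ler_pM => //; rewrite /vdm3 !normrM; apply: ler_pM; rewrite ?L //.
    by rewrite mulr_ge0.
  by apply: ler_pM; rewrite ?L.
have P : 0 <= (a + b) * (b + d) * (d + a) by rewrite !mulr_ge0 // addr_ge0.
lra.
Qed.

Lemma cubic_poly_max be x : 0 <= be <= 1 -> dot x x = 1 -> 1 <= cubic_poly be x x ->
  forall j, sign01 (x 0 j).
Proof.
move=> Hbe x1; rewrite /cubic_poly x1 expr1n mulr1 => H.
have := cubic_simplex_max Hbe _ _ _ _ H; rewrite -!expr2 !sqr_ge0 => /(_ isT isT isT).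
have S : x 0 i0 ^+ 2 + x 0 i1 ^+ 2 + x 0 i2 ^+ 2 = 1 by rewrite -x1 dotE !expr2.
have nn (t : R) : 0 <= t ^+ 2 by exact: sqr_ge0.
have Z (s t : R) : s ^+ 2 + t ^+ 2 = 0 -> s = 0 /\ t = 0.
  by move/eqP; rewrite paddr_eq0 // !sqrf_eq0 => /andP [/eqP -> /eqP ->].
have U (t : R) : t ^+ 2 = 1 -> sign01 t.
  by move/eqP; rewrite sqrf_eq1 => /orP [] /eqP ->; [apply: Or32 | apply: Or33].
move=> /(_ S) /eqP; rewrite !mulf_eq0 => /orP [/orP []|] /eqP /Z [h1 h2];
  move: S; rewrite h1 h2 expr0n /= ?addr0 ?add0r => /U h3; apply: forall_ord3 => //;
  by rewrite ?h1 ?h2; apply: Or31.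
Qed.

Lemma preserves_cubic_monomial be g : 0 <= be <= 1 -> SO3 g ->
  preserves (cubic_poly be) g -> monomial g.
Proof.
move=> Hbe Hg Pg.
have c1 : cubic_poly be e1 e1 = 1.
  rewrite /cubic_poly /vdm3 !vecE !mulr0 mul1r expr1n !expr0n eqn0Ngt; have -> : (0 < p)%N by lia.
  by rewrite /=; ring.
have c2 : cubic_poly be e2 e2 = 1.
  rewrite /cubic_poly /vdm3 !vecE !mulr0 mul1r expr1n !expr0n eqn0Ngt; have -> : (0 < p)%N by lia.
  by rewrite /=; ring.
have c3 : cubic_poly be e3 e3 = 1.
  rewrite /cubic_poly /vdm3 !vecE !mulr0 mul1r expr1n !expr0n eqn0Ngt; have -> : (0 < p)%N by lia.
  by rewrite /=; ring.
have M x : dot x x = 1 -> cubic_poly be x x = 1 -> forall j, sign01 ((x *m g) 0 j).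
  by move=> x1 cx; apply: (cubic_poly_max Hbe); rewrite ?dot_SO3 // Pg cx.
apply: forall_ord3 => j; rewrite -(row_e g j); apply: M => //.
- exact: e1_unit.
- exact: e2_unit.
exact: e3_unit.
Qed.

Lemma preservesM (P : 'rV[R]_3 -> 'rV[R]_3 -> R) g h :
  preserves P g -> preserves P h -> preserves P (g *m h).
Proof. by move=> Pg Ph x y; rewrite !mulmxA Ph Pg. Qed.

Lemma preserves_cyc be : preserves (cubic_poly be) cyc.
Proof.
move=> x y; rewrite !cycE /cubic_poly /vdm3.
have -> : dot (vec (x 0 i2) (x 0 i0) (x 0 i1)) (vec (y 0 i2) (y 0 i0) (y 0 i1)) = dot x y.
  by rewrite !coordE; ring.
by rewrite !vecE; ring.
Qed.

Lemma preserves_flip1 be : preserves (cubic_poly be) flip1.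
Proof. by move=> x y; rewrite !flip1E /cubic_poly /vdm3 !coordE !mulrNN. Qed.

Lemma preserves_flip2 be : preserves (cubic_poly be) flip2.
Proof. by move=> x y; rewrite !flip2E /cubic_poly /vdm3 !coordE !mulrNN. Qed.

Lemma crod_e1_i x : x *m crod e1 'i%C = vec (x 0 i0) (- x 0 i2) (x 0 i1).
Proof. by rewrite /crod rodE; apply: vec_ext; rewrite !coordE /=; ring. Qed.

Lemma crod_e1_N1 : crod e1 (-1) = flip1.
Proof.
by apply: mx_ext => x; rewrite flip1E /crod rodE; apply: vec_ext; rewrite !coordE /=; ring.
Qed.

(** The quarter-turn exchanges two of the products x_i y_i and so reverses the sign of [vdm3]. The
    chosen pair has products 0, 1, 2, for which [vdm3] is nonzero and [dot] is 3. *)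
Lemma preserves_cubic_i be : preserves (cubic_poly be) (crod e1 'i%C) <-> be = 0.
Proof.
split=> [/(_ (vec 1 1 1) (vec 0 1 2))|-> x y].
  rewrite !crod_e1_i /cubic_poly /vdm3 !vecE.
  have -> : dot (vec 1 (- 1) 1) (vec 0 (- 2) 1) = 3 :> R by rewrite !coordE; ring.
  have -> : dot (vec 1 1 1) (vec 0 1 2) = 3 :> R by rewrite !coordE; ring.
  rewrite mulrNN !mul1r => H; have /eqP : be * 3 ^+ (p - 3) = 0 by lra.
  by rewrite mulf_eq0 expf_eq0 pnatr_eq0 andbF orbF => /eqP.
by rewrite !crod_e1_i /cubic_poly !coordE !mul0r mulrNN; ring.
Qed.

Lemma preserves_cubic_Ni be : preserves (cubic_poly be) (crod e1 (- 'i%C)) <-> be = 0.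
Proof.
have E : crod e1 (- 'i%C) = crod e1 'i%C *m flip1.
  by rewrite -crod_e1_N1 crod_mul ?e1_unit // mulrN1.
have E' : crod e1 'i%C = crod e1 (- 'i%C) *m flip1.
  by rewrite -crod_e1_N1 crod_mul ?e1_unit // mulrN1 opprK.
rewrite -preserves_cubic_i; by split=> H; [rewrite E' | rewrite E];
  apply: preservesM => //; exact: preserves_flip1.
Qed.

(** Applying [monomial_decomp] to the intersection of [G] with the group of the form reduces their
    comparison to the multiples of the quarter-turn about [e1]. *)
Lemma realizable_cubic G (be : R) N : axial N G -> be = 0 \/ be = 1 ->
  G cyc -> G flip1 -> G flip2 -> (forall g, G g -> monomial g) ->
  (G (crod e1 'i%C) <-> be = 0) -> (G (crod e1 (- 'i%C)) <-> be = 0) -> realizable p G.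
Proof.
move=> HG be01 Gc Gf1 Gf2 Gm Gi GNi; have Hbe : 0 <= be <= 1 by case: be01 => ->; rewrite lexx ler01.
apply: (@realizable_id _ _ _ (cubic_poly be)).
- exact: bihom_cubic_poly.
- exact: cubic_polyC.
move=> g Hg.
suff main : monomial g -> (G g <-> preserves (cubic_poly be) g).
  by split=> H; apply/main => //; [apply: Gm | apply: preserves_cubic_monomial H].
move=> mg; pose K h := G h /\ preserves (cubic_poly be) h.
have [||||||h [Gh Ph] [y Hy ->]] := @monomial_decomp K g _ _ _ _ _ _ Hg mg.
- by move=> h [/(axial_SO3 HG)].
- by split; [exact: axial_1 HG | move=> x y; rewrite !mulmx1].
- by move=> h k [Gh Ph] [Gk Pk]; split; [exact: (axial_mul HG) | exact: preservesM].
- by split=> //; exact: preserves_cyc.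
- by split=> //; exact: preserves_flip1.
- by split=> //; exact: preserves_flip2.
have Hh := axial_SO3 HG Gh.
have -> : G (crod e1 y *m h) <-> G (crod e1 y).
  split=> H; last exact: (axial_mul HG).
  by rewrite -(mulKSO3 (crod e1 y) Hh); apply: (axial_mul HG) => //; apply: (axial_tr HG).
have -> : preserves (cubic_poly be) (crod e1 y *m h) <-> preserves (cubic_poly be) (crod e1 y).
  split=> H; last exact: preservesM.
  by move=> a b; rewrite -Ph -!mulmxA H.
case: Hy => ->.
- rewrite crod1; split=> _; last exact: (axial_1 HG).
  by move=> a b; rewrite !mulmx1.
- by rewrite crod_e1_N1; split=> _ //; exact: preserves_flip1.
- by rewrite Gi preserves_cubic_i.
by rewrite GNi preserves_cubic_Ni.
Qed.

End CubicPoly.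
End CubicGroups.

(** * Recognition of the octahedral and tetrahedral groups *)

Section OctahedralTetrahedral.
Context (R : realType) (p N : nat) (p3 : (3 <= p)%N).
Implicit Types (u v w x y : 'rV[R]_3) (g h : 'M[R]_3) (z : R[i]) (G : 'M[R]_3 -> Prop).

Lemma pair_law_abs G z s u v : axial N G -> pair_law G z s ->
  top_axis G z u -> top_axis G z v ->
  [\/ dot u v = s, dot u v = - s, dot u v = 1 | dot u v = -1].
Proof.
move=> HG Hs Xu Xv; have [s0|s0] := lerP 0 (dot u v).
  by case: (Hs u v Xu Xv s0) => ->; [apply: Or41 | apply: Or43].
have := Hs u (- v) Xu (top_axisN HG Xv); rewrite dotNr => /(_ _) [|E|E]; first by lra.
  by apply: Or42; rewrite -E opprK.
by apply: Or44; rewrite -E opprK.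
Qed.

Lemma top_axis_conj G z h x : SO3 h ->
  top_axis (fun g => G (h^T *m g *m h)) z x <-> top_axis G z (x *m h).
Proof.
by move=> Hh; rewrite /top_axis dot_SO3 // crod_conj.
Qed.

Lemma pair_law_conj G z s h : SO3 h -> pair_law G z s ->
  pair_law (fun g => G (h^T *m g *m h)) z s.
Proof.
move=> Hh H u v /(top_axis_conj _ _ _ Hh) Xu /(top_axis_conj _ _ _ Hh) Xv.
by rewrite -(dot_SO3 u v Hh); apply: H.
Qed.

(** The entries of an element of [G] are the inner products of the images of the coordinate axes
    with the coordinate axes. All of these are top axes, so the pair law leaves only 0, 1 and -1. *)
Lemma realizable_octahedral G z : axial N G -> cunit z -> complex.Re z = 0 ->
  top_axis G z (e1 R) -> top_axis G z (e2 R) -> pair_law G z 0 -> realizable p G.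
Proof.
move=> HG Hz z0 X1 X2 law.
have Gi u : top_axis G z u -> G (crod u 'i%C).
  move=> [Hu Gu]; have [zi|zi] : z = 'i%C \/ z = - 'i%C.
    move: Hz z0; rewrite /cunit; case: (z) => a b /= H a0; move: H; rewrite a0 expr0n /= add0r.
    move/eqP; rewrite sqrf_eq1 => /orP [] /eqP ->; [left|right] => //.
    by apply/eqP; rewrite eq_complex /= oppr0 !eqxx.
  - by rewrite -zi.
  have -> : crod u 'i%C = (crod u z)^T.
    by rewrite trmx_crod zi; congr crod; apply/eqP; rewrite eq_complex /= oppr0 opprK !eqxx.
  exact: (axial_tr HG).
have G1 := Gi _ X1; have G2 := Gi _ X2.
have X3 : top_axis G z e3.
  have -> : e3 = e2 R *m crod (e1 R) 'i%C.
    by rewrite crod_e1_i; apply: vec_ext; rewrite !coordE; ring.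
  exact: (top_axis_mx HG X2 G1).
have G3 := Gi _ X3.
apply: (@realizable_cubic R p p3 G 0 N) => //.
- by left.
- have -> : cyc R = crod (e1 R) 'i%C *m crod e3 'i%C.
    apply: mx_ext => x; rewrite mulmxA crod_e1_i /crod rod_e3E cycE.
    by apply: vec_ext; rewrite !coordE /=; ring.
  exact: (axial_mul HG).
- have -> : flip1 R = crod (e1 R) 'i%C *m crod (e1 R) 'i%C.
    by apply: mx_ext => x; rewrite mulmxA !crod_e1_i flip1E; apply: vec_ext; rewrite !coordE.
  exact: (axial_mul HG).
- have -> : flip2 R = crod (e2 R) 'i%C *m crod (e2 R) 'i%C.
    apply: mx_ext => x; rewrite crod_mul ?e2_unit // -expr2 sqr_i flip2E /crod rodE.
    by apply: vec_ext; rewrite !coordE /=; ring.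
  exact: (axial_mul HG).
- move=> g Gg.
  have S x y : top_axis G z x -> top_axis G z y -> sign01 (dot (x *m g) y).
    move=> Xx Xy; have := pair_law_abs HG law (top_axis_mx HG Xx Gg) Xy.
    by case=> ->; [apply: Or31 | apply: Or31; rewrite oppr0 | apply: Or32 | apply: Or33].
  have E x : (dot x (e1 R) = x 0 i0) * (dot x (e2 R) = x 0 i1) * (dot x e3 = x 0 i2).
    by rewrite !coordE; do !split; ring.
  apply: forall_ord3; apply: forall_ord3; rewrite -!(row_e g) -?E; exact: S.
have -> : crod (e1 R) (- 'i%C) = (crod (e1 R) 'i%C)^T.
  by rewrite trmx_crod; congr crod; apply/eqP; rewrite eq_complex /= oppr0 !eqxx.
by split=> // _; apply: (axial_tr HG).
Qed.

Lemma rod_scaledE x u (n c s : R) : n != 0 ->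
  x *m rod (n^-1 *: u) c s =
  c *: x + ((1 - c) / n ^+ 2 * dot x u) *: u + (s / n) *: cross u x.
Proof.
by move=> n0; rewrite rodE; apply: vec_ext; rewrite !coordE; field.
Qed.

Definition tetra_axis (a b d : R) : 'rV[R]_3 := (Num.sqrt 3)^-1 *: vec a b d.

Lemma sqrt3_sq : (Num.sqrt 3)^-1 * (Num.sqrt 3)^-1 = 3^-1 :> R.
Proof. by rewrite -invfM -expr2 sqr_sqrtr. Qed.

Lemma realizable_tetrahedral G z : axial N G -> cunit z -> complex.Re z = - (1 / 2) ->
  top_axis G z (tetra_axis 1 1 1) -> top_axis G z (tetra_axis (-1) 1 1) ->
  pair_law G z (1 / 3) ->
  (forall v (w : R[i]), dot v v = 1 -> cunit w -> G (crod v w) -> w != 1 ->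
    complex.Re w <= complex.Re z) ->
  realizable p G.
Proof.
move=> HG Hz zE X1 X2 law top.
pose r : R := Num.sqrt 3; have r2 : r ^+ 2 = 3 by rewrite sqr_sqrtr.
have r0 : r != 0 by rewrite -sqrf_eq0 r2 pnatr_eq0.
pose t : R[i] := ((- (1 / 2)) +i* (r / 2))%C.
have Gt u : top_axis G z u -> G (crod u t).
  move=> [Hu Gu]; have [zi|zi] : z = t \/ z = t^*%C.
    move: Hz zE; rewrite /cunit /t; case: (z) => a b /= H aE; move: H; rewrite aE => H.
    have /eqP : (b - r / 2) * (b + r / 2) = 0.
      by transitivity (b ^+ 2 - r ^+ 2 / 4); [field | rewrite r2; lra].
    by rewrite mulf_eq0 => /orP [] /eqP h; [left | right]; congr (_ +i* _)%C; lra.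
  - by rewrite -zi.
  have -> : crod u t = (crod u z)^T by rewrite trmx_crod zi conjcK.
  exact: (axial_tr HG).
have rotE x u : x *m crod (r^-1 *: u) t =
    (- (1 / 2)) *: x + (dot x u / 2) *: u + (1 / 2) *: cross u x.
  rewrite /crod rod_scaledE //= r2.
  by congr (_ + _ *: _ + _ *: _); field.
have Gc : G (cyc R).
  have -> : cyc R = crod (tetra_axis 1 1 1) t; last exact: Gt.
  apply: mx_ext => x; rewrite cycE /tetra_axis rotE.
  by apply: vec_ext; rewrite !coordE; field.
(* With the axis reversed, [k] permutes the coordinates as [cyc] does, with two signs changed; the
   quotient of the two is therefore a half-turn. *)
pose k : 'M[R]_3 := crod (- tetra_axis (-1) 1 1) t.
have Gk : G k by apply/Gt/(top_axisN HG).
have kE x : x *m k = vec (- x 0 i2) (- x 0 i0) (x 0 i1).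
  rewrite /k /tetra_axis -scalerN rotE.
  by apply: vec_ext; rewrite !coordE; field.
have Gf3 : G (flip3 R).
  have -> : flip3 R = (cyc R)^T *m k; last by apply: (axial_mul HG) => //; apply: (axial_tr HG).
  have cS := axial_SO3 HG Gc.
  apply: mx_ext => x; rewrite mulmxA kE flip3E -{1 2 3}(mulVKSO3 x cS) cycE.
  by apply: vec_ext; rewrite !coordE.
have Gf1 : G (flip1 R).
  have -> : flip1 R = (cyc R)^T *m flip3 R *m cyc R.
    have cS := axial_SO3 HG Gc.
    apply: mx_ext => x; rewrite !mulmxA cycE flip1E flip3E -{1 2 3}(mulVKSO3 x cS) cycE.
    by apply: vec_ext; rewrite !coordE.
  by apply: (axial_mul HG) => //; apply: (axial_mul HG) => //; apply: (axial_tr HG).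
have Gf2 : G (flip2 R).
  have -> : flip2 R = flip1 R *m flip3 R; last exact: (axial_mul HG).
  by apply: mx_ext => x; rewrite mulmxA flip1E flip3E flip2E; apply: vec_ext; rewrite !coordE ?opprK.
pose q (i : 'I_4) : 'rV[R]_3 := tetra_axis 1 1 1 *m nth 1%:M [:: 1%:M; flip1 R; flip2 R; flip3 R] i.
have Xq i : top_axis G z (q i).
  apply: (top_axis_mx HG) => //.
  by case: i => [[|[|[|[|//]]]]] /= _ //; exact: (axial_1 HG).
have q0 : q 0 = tetra_axis 1 1 1 by rewrite /q /= mulmx1.
have q1 : q 1 = tetra_axis 1 (-1) (-1).
  by rewrite /q /= flip1E; apply: vec_ext; rewrite !coordE; ring.
have q2 : q 2%:R = tetra_axis (-1) 1 (-1).
  by rewrite /q /= flip2E; apply: vec_ext; rewrite !coordE; ring.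
have q3 : q 3%:R = tetra_axis (-1) (-1) 1.
  by rewrite /q /= flip3E; apply: vec_ext; rewrite !coordE; ring.
have dq x a b d : dot x (tetra_axis a b d) = (x 0 i0 * a + x 0 i1 * b + x 0 i2 * d) / r.
  by rewrite /tetra_axis -/r !coordE; field.
(* For any unit vector the squared inner products with the four diagonals sum to 4/3, whereas a
   further top axis would make each of them 1/9. *)
have Xonly v : top_axis G z v -> exists i, v = q i \/ v = - q i.
  move=> Xv; have [Hv _] := Xv; apply: contrapT => Nv.
  have D i : dot v (q i) ^+ 2 = 1 / 9.
    case: (pair_law_abs HG law Xv (Xq i)) => E.
    - by rewrite E; field.
    - by rewrite E; field.
    - by case: Nv; exists i; left; apply: unit_eq => //; exact: (proj1 (Xq i)).
    by case: Nv; exists i; right; apply: unit_eqN => //; exact: (proj1 (Xq i)).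
  have S : dot v (q 0) ^+ 2 + dot v (q 1) ^+ 2 + dot v (q 2%:R) ^+ 2 + dot v (q 3%:R) ^+ 2 = 4 / 3.
    rewrite q0 q1 q2 q3 !dq.
    transitivity (4 * dot v v / r ^+ 2); first by rewrite !coordE; field.
    by rewrite Hv r2; field.
  by move: S; rewrite !D; lra.
have sqE x a b d : dot x (tetra_axis a b d) ^+ 2 = (x 0 i0 * a + x 0 i1 * b + x 0 i2 * d) ^+ 2 / 3.
  by rewrite dq exprMn exprVn r2.
have e_dot i : [/\ dot (e1 R) (q i) ^+ 2 = 1 / 3, dot (e2 R) (q i) ^+ 2 = 1 / 3 &
    dot e3 (q i) ^+ 2 = 1 / 3].
  have -> : q i = tetra_axis ((-1) ^+ (2 <= i)%N) ((-1) ^+ (odd i)) ((-1) ^+ (1 <= i <= 2)%N).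
    rewrite /q; case: i => [[|[|[|[|//]]]]] Hi /=; rewrite ?mulmx1 ?flip1E ?flip2E ?flip3E;
    by apply: vec_ext; rewrite !coordE; ring.
  have S (a : bool) : ((-1) ^+ a) ^+ 2 = 1 :> R by rewrite sqrr_sign.
  by split; rewrite sqE !vecE !mul0r !mul1r ?add0r ?addr0 S mul1r.
(* [G] permutes the diagonals up to sign, so the image of [x] also has the squares 1/3. Twice each
   coordinate is then a sum of two signs, that is, 0, 2 or -2. *)
have Gx x g : (forall i, dot x (q i) ^+ 2 = 1 / 3) -> G g -> forall j, sign01 ((x *m g) 0 j).
  move=> Hx Gg; have D i : dot (x *m g) (q i) ^+ 2 = 1 / 3.
    rewrite dot_adj; have [i' [E|E]] := Xonly _ (top_axis_mx HG (Xq i) (axial_tr HG Gg)).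
      by rewrite E.
    by rewrite E dotNr sqrrN.
  have sg (a : R) : a ^+ 2 / 3 = 1 / 3 -> a = 1 \/ a = -1.
    move=> h; have /eqP : a ^+ 2 = 1 by lra.
    by rewrite sqrf_eq1 => /orP [] /eqP; [left | right].
  move: (D 0) (D 1) (D 2%:R) (D 3%:R); rewrite q0 q1 q2 q3 !sqE.
  set a := (x *m g) 0 i0; set b := (x *m g) 0 i1; set d := (x *m g) 0 i2.
  move=> /sg s0 /sg s1 /sg s2 /sg s3.
  have half (s s' m : R) : 2 * m = s + s' -> s = 1 \/ s = -1 -> s' = 1 \/ s' = -1 -> sign01 m.
    by move=> E [] hs [] ht; [apply: Or32 | apply: Or31 | apply: Or31 | apply: Or33]; lra.
  apply: forall_ord3; rewrite -/a -/b -/d.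
  - by apply: half s0 s1; ring.
  - by apply: half s0 s2; ring.
  by apply: half s0 s3; ring.
have no_i (w : R[i]) : cunit w -> complex.Re w = 0 -> ~ G (crod (e1 R) w).
  move=> Hw w0 Gw; have w1 : w != 1 by apply/eqP => E; move: w0; rewrite E /=; lra.
  by have := top _ w (e1_unit R) Hw Gw w1; rewrite w0 zE; lra.
apply: (@realizable_cubic R p p3 G 1 N) => //.
- by right.
- move=> g Gg; apply: forall_ord3 => j; rewrite -(row_e g j); apply: Gx => // i;
  by case: (e_dot i).
- split=> [H|/eqP]; last by rewrite oner_eq0.
  by case: (no_i _ _ _ H); rewrite /cunit //=; ring.
split=> [H|/eqP]; last by rewrite oner_eq0.
by case: (no_i _ _ _ H); rewrite /cunit /= ?oppr0 //; ring.
Qed.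

End OctahedralTetrahedral.

(** * The icosahedral group *)

Section Icosahedral.
Context (R : realType) (p N : nat) (p3 : (3 <= p)%N).
Context (f : R) (f0 : 0 < f) (f2 : f ^+ 2 = f + 1).
Implicit Types (u v w x y : 'rV[R]_3) (g h : 'M[R]_3) (z : R[i]) (G : 'M[R]_3 -> Prop).

(* The six diagonals of a regular icosahedron when [f] is the golden ratio. *)
Definition ico (i : 'I_6) : 'rV[R]_3 := nth 0
  [:: vec 0 1 f; vec 0 (-1) f; vec 1 f 0; vec (-1) f 0; vec f 0 1; vec (- f) 0 1] i.

Lemma forall_ord6 (Q : 'I_6 -> Prop) :
  Q 0 -> Q 1 -> Q 2%:R -> Q 3%:R -> Q 4%:R -> Q 5%:R -> forall i, Q i.
Proof.
move=> H0 H1 H2 H3 H4 H5 [[|[|[|[|[|[|//]]]]]] Hi].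
- by have -> : Ordinal Hi = 0 by exact: val_inj.
- by have -> : Ordinal Hi = 1 by exact: val_inj.
- by have -> : Ordinal Hi = 2%:R by exact: val_inj.
- by have -> : Ordinal Hi = 3%:R by exact: val_inj.
- by have -> : Ordinal Hi = 4%:R by exact: val_inj.
by have -> : Ordinal Hi = 5%:R by exact: val_inj.
Qed.

Lemma sum_ord6 (F : 'I_6 -> R) :
  \sum_i F i = F 0 + F 1 + F 2%:R + F 3%:R + F 4%:R + F 5%:R.
Proof.
rewrite !big_ord_recr big_ord0 /= add0r.
by congr (F _ + F _ + F _ + F _ + F _ + F _); apply: val_inj.
Qed.

Let f3 : f ^+ 3 = 2 * f + 1. Proof. by rewrite exprS f2 mulrDr mulr1 -expr2 f2; ring. Qed.
Let f4 : f ^+ 4 = 3 * f + 2. Proof. by rewrite exprS f3 mulrDr mulr1 mulrCA -expr2 f2; ring. Qed.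

Lemma ico_sq i : dot (ico i) (ico i) = f + 2.
Proof. by move: i; apply: forall_ord6; rewrite /ico !coordE /=; move: f2; rewrite expr2; lra. Qed.

Lemma ico_dot i j : i != j -> dot (ico i) (ico j) = f \/ dot (ico i) (ico j) = - f.
Proof.
move: i j; apply: forall_ord6; apply: forall_ord6; rewrite // => _;
  rewrite /ico !coordE /=; move: f2; rewrite expr2 => h;
  by [left; lra | right; lra].
Qed.

Let n : R := Num.sqrt (f + 2).
Let f2p : 0 < f + 2. Proof. by move: f0; lra. Qed.
Let f1p : 0 < f + 1. Proof. by move: f0; lra. Qed.
Let n2 : n ^+ 2 = f + 2. Proof. by rewrite sqr_sqrtr // ltW. Qed.
Let n0 : 0 < n. Proof. by rewrite sqrtr_gt0. Qed.
Let nn0 : n != 0. Proof. exact: lt0r_neq0. Qed.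

Definition ico_unit (i : 'I_6) : 'rV[R]_3 := (Num.sqrt (f + 2))^-1 *: ico i.

Lemma ico_unit_sq i : dot (ico_unit i) (ico_unit i) = 1.
Proof. by rewrite dotZl dotZr ico_sq -/n -n2; field. Qed.

Lemma ico_unit_dot i j : i != j -> dot (ico_unit i) (ico_unit j) ^+ 2 = 1 / 5.
Proof.
move=> ij; rewrite dotZl dotZr -/n.
have -> : (n^-1 * (n^-1 * dot (ico i) (ico j))) ^+ 2 = dot (ico i) (ico j) ^+ 2 / (n ^+ 2) ^+ 2.
  by field.
have -> : dot (ico i) (ico j) ^+ 2 = f + 1 by case: (ico_dot ij) => ->; rewrite ?sqrrN f2.
rewrite n2; have -> : (f + 2) ^+ 2 = 5 * (f + 1) by rewrite sqrrD f2; ring.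
by rewrite invfM mulrCA divff ?mulr1 ?div1r // lt0r_neq0.
Qed.

(** Normal form modulo f^2 = f + 1, after which the moments below are matters of [ring]. *)
Let sqAB (a b : R) : (a + f * b) ^+ 2 = (a ^+ 2 + b ^+ 2) + f * (2 * a * b + b ^+ 2).
Proof.
transitivity (a ^+ 2 + f * (2 * a * b) + f ^+ 2 * b ^+ 2); first by ring.
by rewrite f2; ring.
Qed.

Let dot_icoE x : (dot x (ico 0) = x 0 i1 + f * x 0 i2) * (dot x (ico 1) = - x 0 i1 + f * x 0 i2) *
  (dot x (ico 2%:R) = x 0 i0 + f * x 0 i1) * (dot x (ico 3%:R) = - x 0 i0 + f * x 0 i1) *
  (dot x (ico 4%:R) = x 0 i2 + f * x 0 i0) * (dot x (ico 5%:R) = x 0 i2 + f * (- x 0 i0)).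
Proof. by do !split; rewrite /ico !coordE /=; ring. Qed.

Lemma ico_sum2 x : \sum_i dot x (ico i) ^+ 2 = 2 * (f + 2) * dot x x.
Proof.
by rewrite sum_ord6 !dot_icoE !sqAB !coordE; ring.
Qed.

Lemma ico_sum4 x : \sum_i (dot x (ico i) ^+ 2) ^+ 2 = 6 * (f + 1) * dot x x ^+ 2.
Proof.
by rewrite sum_ord6 !dot_icoE !sqAB !coordE; ring.
Qed.

Let t x i : R := dot x (ico_unit i) ^+ 2.

Let tE x i : t x i = dot x (ico i) ^+ 2 / n ^+ 2.
Proof. by rewrite /t dotZr -/n; field. Qed.

Lemma ico_unit_sum2 x : dot x x = 1 -> \sum_i t x i = 2.
Proof.
move=> x1; under eq_bigr => i _ do rewrite tE.
rewrite -big_distrl /= ico_sum2 x1 mulr1 n2 mulfK //.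
by rewrite lt0r_neq0.
Qed.

Lemma ico_unit_sum4 x : dot x x = 1 -> \sum_i t x i ^+ 2 = 6 / 5.
Proof.
move=> x1; under eq_bigr => i _ do rewrite tE exprMn.
rewrite -big_distrl /= ico_sum4 x1 expr1n mulr1 n2 exprVn.
have -> : (f + 2) ^+ 2 = 5 * (f + 1) by rewrite sqrrD f2; ring.
by field; apply: lt0r_neq0.
Qed.

(** If every value were 1/5, the second moment would be 6/5 instead of 2. *)
Lemma ico_exists x : dot x x = 1 -> (forall i, t x i = 1 / 5 \/ t x i = 1) ->
  exists i, x = ico_unit i \/ x = - ico_unit i.
Proof.
move=> x1 H; apply: contrapT => Nx.
have D i : t x i = 1 / 5.
  case: (H i) => // E; case: Nx; exists i.
  by apply: (unit_sq_dot (ico_unit_sq i) x1); rewrite dotC.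
have := ico_unit_sum2 x1; under eq_bigr => i _ do rewrite D.
by rewrite sumr_const card_ord -mulr_natr; lra.
Qed.

(* The sixth moment of the diagonals is extremal exactly on them, because
   [(t - 1/5)^2 (1 - t)] is nonnegative on [[0, 1]] and the lower moments are constant. *)
Lemma ico_max x : dot x x = 1 -> \sum_i t x i ^+ 3 = 26 / 25 ->
  exists i, x = ico_unit i \/ x = - ico_unit i.
Proof.
move=> x1 H; apply: ico_exists => //.
have le1 i : 0 <= (t x i - 1 / 5) ^+ 2 * (1 - t x i).
  by rewrite mulr_ge0 ?sqr_ge0 // subr_ge0; apply: cauchy_schwarz => //; exact: ico_unit_sq.
have S : \sum_i (t x i - 1 / 5) ^+ 2 * (1 - t x i) = 0.
  (* The expansion of (t - 1/5)^2 (1 - t), summed over six diagonals. It vanishes at 26/25 = 1 + 5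
     (1/5)^3, the sixth moment on a diagonal. *)
  transitivity (- (\sum_i t x i ^+ 3) + 7 / 5 * (\sum_i t x i ^+ 2)
     - 11 / 25 * (\sum_i t x i) + 6 / 25).
    by rewrite !sum_ord6; field.
  by rewrite H ico_unit_sum2 // ico_unit_sum4 //; field.
move=> i; have /eqP := S; rewrite psumr_eq0 // => /allP /(_ i (mem_index_enum i)) /=.
by rewrite mulf_eq0 sqrf_eq0 => /orP [] /eqP h; [left | right]; lra.
Qed.

Definition ico_poly x y : R :=
  dot x y ^+ (p - 3) * \sum_i dot (ico_unit i) x ^+ 3 * dot (ico_unit i) y ^+ 3.

Lemma bihom_ico_poly : bihom p p ico_poly.
Proof.
have H : bihom 3 3 (fun x y => \sum_i dot (ico_unit i) x ^+ 3 * dot (ico_unit i) y ^+ 3).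
  apply: bihom_sum => i.
  exact: (bihomM (bihomX 3 (bihom_left (ico_unit i))) (bihomX 3 (bihom_right (ico_unit i)))).
by apply: bihom_cast (bihomM (bihomX (p - 3) (bihom_dot R)) H) _ _; lia.
Qed.

Lemma ico_polyC x y : ico_poly x y = ico_poly y x.
Proof. by rewrite /ico_poly dotC; congr (_ * _); apply: eq_bigr => i _; rewrite mulrC. Qed.

Lemma ico_poly_diag x : dot x x = 1 -> ico_poly x x = \sum_i t x i ^+ 3.
Proof.
move=> x1; rewrite /ico_poly x1 expr1n mul1r; apply: eq_bigr => i _.
by rewrite /t (dotC x) -exprD -exprM.
Qed.

Definition ico_sym g : Prop := forall i, exists j, ico_unit i *m g = ico_unit j \/
  ico_unit i *m g = - ico_unit j.

Lemma preserves_ico_sym g : SO3 g -> preserves ico_poly g -> ico_sym g.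
Proof.
move=> Hg Pg i; have u1 : dot (ico_unit i *m g) (ico_unit i *m g) = 1.
  by rewrite dot_SO3 // ico_unit_sq.
apply: ico_max => //; rewrite -ico_poly_diag // Pg ico_poly_diag ?ico_unit_sq //.
rewrite (bigD1 i) //= /t ico_unit_sq !expr1n (eq_bigr (fun=> (1 / 5) ^+ 3)); last first.
  by move=> j ji; rewrite ico_unit_dot // eq_sym.
by rewrite sumr_const cardC1 card_ord /=; field.
Qed.

(** Moving [g] to the other side of the inner products makes [g^T] permute the diagonals up to sign,
    and the signs cancel between the two cubes. *)
Lemma ico_sym_preserves g : SO3 g -> ico_sym g^T -> preserves ico_poly g.
Proof.
move=> Hg Sg x y; rewrite /ico_poly dot_SO3 //; congr (_ * _).
have [s Hs] : {s : 'I_6 -> 'I_6 & forall i, ico_unit i *m g^T = ico_unit (s i) \/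
    ico_unit i *m g^T = - ico_unit (s i)}.
  by apply: (@choice _ _ (fun i j => ico_unit i *m g^T = ico_unit j \/
    ico_unit i *m g^T = - ico_unit j)).
have sI : injective s.
  move=> i j E; apply/eqP; apply: contrapT => /negP ij; have := ico_unit_dot ij.
  rewrite -(dot_SO3 _ _ (SO3_tr Hg)).
  by case: (Hs i) (Hs j) => -> [] ->; rewrite E ?dotNl ?dotNr ?sqrrN ico_unit_sq expr1n; lra.
rewrite [RHS](reindex_inj sI) /=; apply: eq_bigr => i _.
rewrite !(dotC (ico_unit i)) !dot_adj !(dotC _ (ico_unit i *m _)).
by case: (Hs i) => ->; rewrite ?dotNl //; ring.
Qed.

(** The angle 2 pi / 5 in terms of the golden ratio. *)
Definition ico_angle : R[i] := (((f - 1) / 2) +i* (Num.sqrt (f + 2) / 2))%C.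

Let rotE x i : x *m crod (ico_unit i) ico_angle =
  ((f - 1) / 2) *: x + ((2 - f) / 2 * dot x (ico i)) *: ico i + (1 / 2) *: cross (ico i) x.
Proof.
rewrite /crod rod_scaledE //= -/n n2; congr (_ + (_ * _) *: _ + _ *: _); last by field.
have f20 : f + 2 != 0 by rewrite lt0r_neq0.
apply: (mulIf f20); rewrite divfK // mulrAC.
have : (2 - f) * (f + 2) = 4 - f ^+ 2 by ring.
rewrite f2; lra.
Qed.

Let r0 : 'M[R]_3 := crod (ico_unit 0) ico_angle.
Let r1 : 'M[R]_3 := crod (ico_unit 1) ico_angle.

(** The other five diagonals are oriented towards [ico 0], so [r0] permutes them cyclically without
    signs. *)
Lemma ico_table0 : [/\ ico 1 *m r0 = ico 4%:R, ico 4%:R *m r0 = ico 2%:R,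
  ico 2%:R *m r0 = ico 3%:R, ico 3%:R *m r0 = ico 5%:R & ico 5%:R *m r0 = ico 1].
Proof.
by split; rewrite /r0 rotE /ico /=; apply: vec_ext; rewrite !coordE; move: f2 f3 f4 => h2 h3 h4; lra.
Qed.

Lemma ico_table1 : [/\ ico 0 *m r1 = ico 5%:R, ico 5%:R *m r1 = - ico 2%:R &
  ico 4%:R *m r1 = ico 0].
Proof.
by split; rewrite /r1 rotE /ico /=; apply: vec_ext; rewrite !coordE; move: f2 f3 f4 => h2 h3 h4; lra.
Qed.

Lemma realizable_icosahedral G z : axial N G -> cunit z -> f = 2 * complex.Re z + 1 ->
  0 < complex.Re z < 1 ->
  top_axis G z (ico_unit 0) -> top_axis G z (ico_unit 1) ->
  pair_law G z (complex.Re z / (1 - complex.Re z)) -> realizable p G.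
Proof.
move=> HG Hz fz /andP [z0 z1] X0 X1 law.
have Gt u : top_axis G z u -> G (crod u ico_angle).
  move=> [Hu Gu]; have [zi|zi] : z = ico_angle \/ z = ico_angle^*%C.
    have : complex.Im z ^+ 2 = n ^+ 2 / 4.
      have zr : complex.Re z = (f - 1) / 2 by lra.
      have E : ((f - 1) / 2) ^+ 2 = (f ^+ 2 - 2 * f + 1) / 4 by field.
      by move: Hz; rewrite /cunit n2 zr E f2; lra.
    move=> h; have /eqP : (complex.Im z - n / 2) * (complex.Im z + n / 2) = 0.
      by transitivity (complex.Im z ^+ 2 - n ^+ 2 / 4); [field | rewrite h subrr].
    rewrite mulf_eq0 => /orP [] /eqP h'; [left | right]; apply/eqP;
      rewrite eq_complex /= -/n; apply/andP; split; apply/eqP; lra.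
  - by rewrite -zi.
  have -> : crod u ico_angle = (crod u z)^T by rewrite trmx_crod zi conjcK.
  exact: (axial_tr HG).
have G0 : G r0 by exact: Gt.
have G1 : G r1 by exact: Gt.
have [t14 t42 t23 t35 t51] := ico_table0; have [s05 s52 s40] := ico_table1.
have scal i j (g : 'M[R]_3) : ico i *m g = ico j -> ico_unit i *m g = ico_unit j.
  by move=> E; rewrite /ico_unit -scalemxAl E.
have u52 : ico_unit 5%:R *m r1 = - ico_unit 2%:R.
  by rewrite /ico_unit -scalemxAl s52 scalerN.
(* The orbit of one diagonal vector. The tables lead from it to all twelve vertices; the sign in
   [ico_table1] gives access to the opposite ones. *)
pose O v := exists2 h, G h & ico_unit 0 *m h = v.
have Omx v w g : O v -> G g -> v *m g = w -> O w.
  by move=> [h Gh <-] Gg <-; exists (h *m g); [exact: (axial_mul HG) | rewrite mulmxA].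
have O0 : O (ico_unit 0) by exists 1%:M; [exact: (axial_1 HG) | rewrite mulmx1].
have O5 := Omx _ _ _ O0 G1 (scal _ _ _ s05).
have O1 := Omx _ _ _ O5 G0 (scal _ _ _ t51).
have O4 := Omx _ _ _ O1 G0 (scal _ _ _ t14).
have O2 := Omx _ _ _ O4 G0 (scal _ _ _ t42).
have O3 := Omx _ _ _ O2 G0 (scal _ _ _ t23).
have neg i j (g : 'M[R]_3) : ico i *m g = ico j -> - ico_unit i *m g = - ico_unit j.
  by move=> E; rewrite mulNmx (scal _ _ _ E).
have N2 := Omx _ _ _ O5 G1 u52.
have N3 := Omx _ _ _ N2 G0 (neg _ _ _ t23).
have N5 := Omx _ _ _ N3 G0 (neg _ _ _ t35).
have N1 := Omx _ _ _ N5 G0 (neg _ _ _ t51).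
have N4 := Omx _ _ _ N1 G0 (neg _ _ _ t14).
have N0 := Omx _ _ _ N4 G1 (neg _ _ _ s40).
have OP i : O (ico_unit i) by move: i; apply: forall_ord6.
have ON i : O (- ico_unit i) by move: i; apply: forall_ord6.
have Xq i : top_axis G z (ico_unit i).
  by have [h Gh <-] := OP i; apply: (top_axis_mx HG).
have law2 : (complex.Re z / (1 - complex.Re z)) ^+ 2 = 1 / 5.
  have q0 : 1 - complex.Re z != 0 by rewrite lt0r_neq0 // subr_gt0.
  have E : 5 * complex.Re z ^+ 2 = (1 - complex.Re z) ^+ 2.
    by move: f2; rewrite fz !expr2; lra.
  rewrite exprMn exprVn; apply: (mulIf (expf_neq0 2 q0)).
  by rewrite divfK ?expf_neq0 // -E; field.
have Xonly v : top_axis G z v -> exists i, v = ico_unit i \/ v = - ico_unit i.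
  move=> Xv; have [Hv _] := Xv; apply: ico_exists => // i.
  by case: (pair_law_abs HG law Xv (Xq i)) => E; rewrite /t E ?sqrrN ?law2 ?expr1n; [left|left|right|right].
have Gsym g : G g -> ico_sym g.
  by move=> Gg i; apply: Xonly; apply: (top_axis_mx HG).
apply: (@realizable_id _ _ _ ico_poly).
- exact: bihom_ico_poly.
- exact: ico_polyC.
move=> g Hg; split=> [Gg|/(preserves_ico_sym Hg) Sg].
  by apply: ico_sym_preserves => //; apply: Gsym; apply: (axial_tr HG).
have [h Gh hE] : O (ico_unit 0 *m g) by have [i [->|->]] := Sg 0.
have Hh := axial_SO3 HG Gh; have GhT := axial_tr HG Gh.
(* Transitivity of [G] on the vertices reduces [g] to a rotation [k] fixing the vertex 0. Such a [k]
   is determined by the image of the vertex 1, which a power of [r0] also attains. *)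
pose k := g *m h^T; have Hk : SO3 k by apply: SO3M => //; apply: SO3_tr.
have k0 : ico_unit 0 *m k = ico_unit 0 by rewrite /k mulmxA -hE mulKSO3.
suff Gk : G k.
  have -> : g = k *m h by rewrite /k mulVKSO3.
  exact: (axial_mul HG).
have [j kj] : exists j, ico_unit 1 *m k = ico_unit j \/ ico_unit 1 *m k = - ico_unit j.
  rewrite /k mulmxA; have [i [->|->]] := Sg 1; first exact: Gsym.
  by rewrite mulNmx; have [j [->|->]] := Gsym _ GhT i; exists j; rewrite ?opprK; [right|left].
have d01 : dot (ico_unit 0) (ico_unit 1 *m k) = f / (f + 2).
  rewrite -[in LHS]k0 dot_SO3 // dotZl dotZr -/n -n2.
  have -> : dot (ico 0) (ico 1) = f by rewrite /ico !coordE /=; move: f2; rewrite expr2; lra.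
  by field.
have dp : 0 < f / (f + 2) by rewrite divr_gt0.
have d1 : f / (f + 2) < 1 by rewrite ltr_pdivrMr // mul1r ltrDl.
have pos i : i != 0 -> 0 < dot (ico_unit 0) (ico_unit i).
  move=> i0; rewrite dotZl dotZr !mulr_gt0 ?invr_gt0 //.
  by move: i i0; apply: forall_ord6 => // _; rewrite /ico !coordE /=; move: f0 f2; rewrite expr2; lra.
(* The inner product with the vertex 0 lies strictly between 0 and 1, which excludes the opposite
   vertices and the vertex 0 itself. *)
have {kj} [j0 kj] : j != 0 /\ ico_unit 1 *m k = ico_unit j.
  case: kj => E; have := d01; rewrite E ?dotNr.
    by have [-> D|//] := eqVneq j 0; move: d1; rewrite -D ico_unit_sq ltxx.
  have [-> D|j0 D] := eqVneq j 0; first by move: dp; rewrite -D ico_unit_sq oppr_gt0 ltr10.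
  by have := pos j j0; move: dp; rewrite -D oppr_gt0 => /lt_trans lt /lt; rewrite ltxx.
have [r Gr [r0E rE]] : exists2 r, G r & ico_unit 0 *m r = ico_unit 0 /\ ico_unit 1 *m r = ico_unit j.
  have fx : ico_unit 0 *m r0 = ico_unit 0 by rewrite /r0 fix_rod // ico_unit_sq.
  have E1 := scal _ _ _ t14; have E2 := scal _ _ _ t42; have E3 := scal _ _ _ t23.
  have E4 := scal _ _ _ t35.
  have GG := axial_mul HG.
  move: j j0 {kj}; apply: forall_ord6 => // _.
  - by exists 1%:M; rewrite ?mulmx1; [exact: (axial_1 HG) | ].
  - by exists (r0 *m r0); [exact: GG | rewrite !mulmxA !(fx, E1, E2)].
  - exists (r0 *m r0 *m r0); first by apply: (GG) => //; exact: GG.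
    by rewrite !mulmxA !(fx, E1, E2, E3).
  - by exists r0; rewrite ?fx ?E1.
  exists (r0 *m r0 *m r0 *m r0); first by apply: (GG) => //; apply: (GG) => //; exact: GG.
  by rewrite !mulmxA !(fx, E1, E2, E3, E4).
have Hr := axial_SO3 HG Gr.
have K1 : k *m r^T = 1%:M.
  apply: (@SO3_fix2 R (ico_unit 0) (ico_unit 1)).
  - by apply: SO3M => //; apply: SO3_tr.
  - exact: ico_unit_sq.
  - exact: ico_unit_sq.
  - by rewrite ico_unit_dot //; apply/eqP; lra.
  - by rewrite mulmxA k0 -[in LHS]r0E mulKSO3.
  by rewrite mulmxA kj -rE mulKSO3.
by have -> : k = r by rewrite -[r]mul1mx -K1 mulVKSO3.
Qed.

End Icosahedral.

(** * Assembly of the classification *)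

Lemma realizable_pair (R : realType) (p N : nat) (G : 'M[R]_3 -> Prop) (z : R[i]) (s : R)
  (u v a b : 'rV[R]_3) : axial N G -> pair_law G z s ->
  top_axis G z u -> top_axis G z v -> dot a a = 1 -> dot b b = 1 ->
  dot a b = dot u v -> dot a b ^+ 2 != 1 ->
  (forall h, SO3 h -> let H := fun g => G (h^T *m g *m h) in
     axial N H -> top_axis H z a -> top_axis H z b -> pair_law H z s -> realizable p H) ->
  realizable p G.
Proof.
move=> HG law Xu Xv Ha Hb E ab HH.
(* A pair of top axes of [G] is matched with the standard pair [a], [b], and [G] is replaced by its
   conjugate. *)
have [h Hh [ha hb]] := transport_pair Ha Hb (proj1 Xu) (proj1 Xv) E ab.
apply: (realizable_conj Hh); apply: HH => //.
- exact: axial_conj.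
- by apply/top_axis_conj; rewrite ?ha.
- by apply/top_axis_conj; rewrite ?hb.
exact: pair_law_conj.
Qed.

Lemma axial_realizable (R : realType) (p : nat) (G : 'M[R]_3 -> Prop) :
  (3 <= p)%N -> axial (p + p) G -> realizable p G.
Proof.
move=> p3 HG.
case: (pselect (exists u, dot u u = 1 /\
    forall g, G g -> u *m g = u \/ u *m g = - u)) => [[u [Hu Gu]]|Nred].
  exact: realizable_axis HG Hu Gu.
have Girr u : dot u u = 1 -> exists2 g, G g & u *m g <> u /\ u *m g <> - u.
  move=> Hu; apply: contrapT => Ng; apply: Nred; exists u; split=> // g Gg.
  apply: contrapT => Nug; apply: Ng; exists g => //.
  by split=> E; apply: Nug; [left | right].
case: (pselect (exists u, full_axis G u)) => [[u Fu]|Nfull].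
  have [g Gg [g1 g2]] := Girr u (proj1 Fu).
  have GS := two_full_axes HG Fu (full_axis_mx HG Fu Gg) g1 g2.
  (* [G] contains every rotation, and the zero form is preserved by all of them. *)
  apply: (@realizable_id _ _ _ (fun _ _ => 0)) => //; first exact: bihom0.
  by move=> k /GS.
have Gfin u : ~ full_axis G u by move=> Fu; apply: Nfull; exists u.
have [z Hz] := exists_top_angle HG Gfin Girr.
have [Hz1 _ _ top] := Hz.
have [u [v [Xu Xv /andP [s0 s1]]]] := exists_top_pair HG Girr Hz.
have strict (s : R) : pair_law G z s -> dot u v = s.
  by move=> law; case: (law u v Xu Xv s0) => // E; rewrite E ltxx in s1.
have c1 := top_lt1 Hz.
case: (top_classification HG Gfin Girr Hz) => [[cE law]|[cE law]|[c0 cE law]].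
- have uv := strict _ law.
  have d11 : dot (tetra_axis 1 1 1) (tetra_axis 1 1 1) = 1 :> R.
    by rewrite dotZl dotZr mulrA sqrt3_sq !coordE; field.
  have d22 : dot (tetra_axis (-1) 1 1) (tetra_axis (-1) 1 1) = 1 :> R.
    by rewrite dotZl dotZr mulrA sqrt3_sq !coordE; field.
  have d12 : dot (tetra_axis 1 1 1) (tetra_axis (-1) 1 1) = 1 / 3 :> R.
    by rewrite dotZl dotZr mulrA sqrt3_sq !coordE; field.
  apply: (realizable_pair HG law Xu Xv d11 d22) => [||h Hh H HH X1 X2 lawH].
  + by rewrite d12 uv.
  + by rewrite d12; apply/eqP; lra.
  apply: (realizable_tetrahedral p3 HH Hz1 cE X1 X2 lawH) => x w Hx Hw Gw.
  by apply: (top (x *m h) w) => //; [rewrite dot_SO3 | move: Gw; rewrite /H crod_conj].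
- have uv := strict _ law.
  have d12 : dot (e1 R) (e2 R) = 0 by rewrite !coordE; ring.
  apply: (realizable_pair HG law Xu Xv (e1_unit R) (e2_unit R)) => [||h Hh H HH X1 X2 lawH].
  + by rewrite d12 uv.
  + by rewrite d12; apply/eqP; lra.
  exact: (realizable_octahedral p3 HH Hz1 cE X1 X2 lawH).
have uv := strict _ law; set c := complex.Re z in c0 c1 cE law uv *.
(* The golden ratio: 4 c^2 + 2 c - 1 = 0 is equivalent to f^2 = f + 1. *)
pose f := 2 * c + 1.
have f0 : 0 < f by rewrite /f; lra.
have f2 : f ^+ 2 = f + 1 by rewrite /f; lra.
have d01 : dot (ico_unit f 0) (ico_unit f 1) = c / (1 - c).
  rewrite dotZl dotZr mulrA -invfM -expr2 sqr_sqrtr; last by lra.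
  have -> : dot (ico f 0) (ico f 1) = f by rewrite /ico !coordE /=; move: f2; rewrite expr2; lra.
  have n1 : f + 2 != 0 by rewrite lt0r_neq0; lra.
  have n2 : 1 - c != 0 by rewrite lt0r_neq0 // subr_gt0.
  by apply/eqP; rewrite mulrC eqr_div // /f; apply/eqP; lra.
apply: (realizable_pair HG law Xu Xv (ico_unit_sq f0 f2 0) (ico_unit_sq f0 f2 1))
  => [||h Hh H HH X1 X2 lawH].
- by rewrite d01 uv.
- by rewrite ico_unit_dot //; apply/eqP; lra.
by apply: (realizable_icosahedral p3 f0 f2 HH Hz1 _ _ X1 X2 lawH) => //; apply/andP.
Qed.

Lemma conj_class_conj (R : realType) (H H' : set 'M[R]_3) (h : 'M[R]_3) : SO3 h ->
  (forall g, H' g <-> H (h^T *m g *m h)) -> conj_class H' = conj_class H.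
Proof.
move=> Hh E; apply/funext => K; apply/propext; split=> -[k [Hk ->]].
  exists (k *m h); split; first exact: SO3M.
  apply/funext => g; apply/propext; rewrite /mkset E trmx_mul !mulmxA; split=> ?; assumption.
exists (k *m h^T); split; first by apply: SO3M => //; apply: SO3_tr.
apply/funext => g; apply/propext; rewrite /mkset E trmx_mul trmxK !mulmxA SO3_trKl //.
by rewrite mul1mx mulVKSO3.
Qed.

Theorem mainTheorem3 (R : realType) (p : nat) (S : {set {perm 'I_p}}) :
  (3 <= p)%N ->
  isoclasses (symtensor_sq (@idx_sym_space R p S)) = isoclasses [set: tensor R (p + p)].
Proof.
move=> p3; apply/seteqP; split=> [K [T _ <-]|K [T _ <-]]; first by exists T.
have [P [bP sP [h Hh HP]]] := axial_realizable p3 (axial_stab T).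
have [T' ST HT] := symtensor_of_bihom S bP sP.
(* The stabilizer of [T'] is only a conjugate of that of [T], which is enough for equal classes. *)
exists T' => //; apply: (conj_class_conj Hh) => g; split=> [[Hg /HT Pg]|Hg].
  exact/HP.
have Hg' : SO3 g.
  have -> : g = h *m (h^T *m g *m h) *m h^T by rewrite !mulmxA SO3_trK // mul1mx mulKSO3.
  by apply: SO3M; [apply: SO3M => //; case: Hg | apply: SO3_tr].
by split=> //; apply/HT/HP.
Qed.
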